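(* Let $p\ge 1$, $q>0$, $\max\{0,1-\frac{q}{n}\}<s\le 1$, and let $f(z)=\sum_{k=0}^\infty P_{n_k}(z)$ be a holomorphic function on $\mathbb{B}$ with Hadamard gaps. Consider the following statements: (a) $\sum_{k=0}^\infty \frac{1}{2^{k(ns+q-n)}}\Big(\sum_{2^k\le n_j<2^{k+1}} M_j^p\Big)<\infty$; (b) $f\in \mathcal{N}^0(p,q,s)$; (c) $f\in\mathcal{N}(p,q,s)$; (d) $\sum_{k=0}^\infty \frac{1}{2^{k(ns+q-n)}}\Big(\sum_{2^k\le n_j<2^{k+1}} L_{j,p}^p\Big)<\infty$. Then (a) $\Rightarrow$ (b) $\Rightarrow$ (c) $\Rightarrow$ (d).
   Context: $\mathbb{B}$ is the open unit ball of $\mathbb{C}^n$, $\mathbb{S}=\partial\mathbb{B}$, $\sigma$ is the normalized surface measure on $\mathbb{S}$ ($\sigma(\mathbb{S})=1$), $H(\mathbb{B})$ is the space of holomorphic functions on $\mathbb{B}$, $dV$ is normalized volume measure on $\mathbb{B}$, and $d\lambda(z)=\frac{dV(z)}{(1-|z|^2)^{n+1}}$. For $a\in\mathbb{B}$, $\Phi_a(z)=\frac{a-P_az-s_aQ_az}{1-\langle z,a\rangle}$, where $s_a=\sqrt{1-|a|^2}$, $P_a$ is the orthogonal projection onto the span of $a$ and $Q_a=I-P_a$. For $p,q,s>0$ and $f\in H(\mathbb{B})$ put $\|f\|^p=\sup_{a\in\mathbb{B}}\int_{\mathbb{B}}|f(z)|^p(1-|z|^2)^q(1-|\Phi_a(z)|^2)^{ns}d\lambda(z)$;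 $\mathcal{N}(p,q,s)$ is the set of $f\in H(\mathbb{B})$ with $\|f\|<\infty$, and $\mathcal{N}^0(p,q,s)$ is the set of $f\in\mathcal{N}(p,q,s)$ with $\lim_{|a|\to1}\int_{\mathbb{B}}|f(z)|^p(1-|z|^2)^q(1-|\Phi_a(z)|^2)^{ns}d\lambda(z)=0$. A holomorphic function $f(z)=\sum_{k=0}^\infty P_{n_k}(z)$ on $\mathbb{B}$, where $P_{n_k}$ is a homogeneous polynomial of degree $n_k$, has Hadamard gaps if for some $c>1$ one has $n_{k+1}/n_k\ge c$ for all $k\ge 0$. Put $M_k=\sup_{\xi\in\mathbb{S}}|P_{n_k}(\xi)|$ and $L_{k,p}=\left(\int_{\mathbb{S}}|P_{n_k}(\xi)|^pd\sigma(\xi)\right)^{1/p}$. *)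

(* Defs.v *)
From HB Require Import structures.
From mathcomp Require Import all_boot all_order all_algebra complex.
(* The notations of [mpoly] clash with those of mathcomp-analysis. *)
From mathcomp Require mpoly.
Import -(notations) mpoly.
From mathcomp Require Import all_classical all_reals all_analysis.
From mathcomp Require Import measurable_realfun.
Set Implicit Arguments.
Unset Strict Implicit.
Unset Printing Implicit Defensive.
Import Order.TTheory GRing.Theory Num.Theory.
Import numFieldNormedType.Exports.

Local Open Scope classical_set_scope.
Local Open Scope ring_scope.
Local Open Scope complex_scope.

HB.instance Definition _ (R : realType) := PseudoPointedMetric.copy R[i] R[i]^o.
HB.instance Definition _ (R : realType) := NormedModule.copy R[i] R[i]^o.

(* The [Probability] instance of [\x] hides its sigma-finiteness from
   inference, hence this lemma. *)
Lemma product_sigma_finite d1 d2 (T1 : measurableType d1)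
    (T2 : measurableType d2) (R : realType)
    (m1 : {sigma_finite_measure set T1 -> \bar R})
    (m2 : {sigma_finite_measure set T2 -> \bar R}) :
  sigma_finite setT (m1 \x m2)%E.
Proof.
have /sigma_finiteP[F [TF ndF Foo]] := sigma_finiteT m1.
have /sigma_finiteP[G [TG ndG Goo]] := sigma_finiteT m2.
exists (fun n => F n `*` G n).
  rewrite -setXTT TF TG predeqE => -[x y]; split.
    move=> [/= [n _ Fnx] [k _ Gky]]; exists (maxn n k) => //; split.
    - by move: x Fnx; exact/subsetPset/ndF/leq_maxl.
    - by move: y Gky; exact/subsetPset/ndG/leq_maxr.
  by move=> [n _ []/= ? ?]; split; exists n.
move=> k; have [? ?] := Foo k; have [? ?] := Goo k.
split; first exact: measurableX.
by rewrite product_measure1E// lte_mul_pinfty// ge0_fin_numE.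
Qed.

(* [pushforward] with the measurability proof as an argument, so that the
   measure structure can be inferred. *)
Section image_measure.
Context d d' (T : measurableType d) (T' : measurableType d') (R : realType).
Variables (m : {measure set T -> \bar R}) (f : T -> T').

Definition image_measure of measurable_fun [set: T] f : set T' -> \bar R :=
  pushforward m f.

Hypothesis mf : measurable_fun [set: T] f.

Let image_measure0 : image_measure mf set0 = 0%E.
Proof. exact: measure0. Qed.

Let image_measure_ge0 A : (0 <= image_measure mf A)%E.
Proof. exact: measure_ge0. Qed.

Let image_measure_sigma_additive : semi_sigma_additive (image_measure mf).
Proof. exact: measure_semi_sigma_additive. Qed.

HB.instance Definition _ := isMeasure.Build _ _ _ (image_measure mf)
  image_measure0 image_measure_ge0 image_measure_sigma_additive.

End image_measure.

Section tuple_measure.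
Context d (T : measurableType d) (R : realType).

Definition tuple_cons n (x : T * n.-tuple T) : n.+1.-tuple T :=
  [the n.+1.-tuple T of x.1 :: x.2].

Lemma measurable_tuple_cons n :
  measurable_fun [set: T * n.-tuple T] (@tuple_cons n).
Proof. by apply: measurable_cons. Qed.

Section step.
Variables (n : nat) (m : {sigma_finite_measure set T -> \bar R}).
Variable mu : {sigma_finite_measure set (n.-tuple T) -> \bar R}.

Definition tuple_cons_measure : set (n.+1.-tuple T) -> \bar R :=
  image_measure (m \x mu)%E (@measurable_tuple_cons n).

HB.instance Definition _ := Measure.on tuple_cons_measure.

Let tcm_sigma_finite : sigma_finite setT tuple_cons_measure.
Proof.
have [F UF mF] := product_sigma_finite m mu.
pose uncons (t : n.+1.-tuple T) : T * n.-tuple T := (thead t, [tuple of behead t]).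
have muncons : measurable_fun setT uncons.
  apply: measurable_fun_pair; first exact: measurable_tnth.
  exact: measurable_behead.
have consK : cancel (@tuple_cons n) uncons.
  by move=> [x t]; rewrite /uncons; congr (_, _); exact/val_inj.
exists (fun k => uncons @^-1` F k).
  by rewrite -preimage_bigcup -UF preimage_setT.
move=> k; have [mFk Fk] := mF k; split.
  by rewrite -[X in measurable X]setTI; exact: muncons.
rewrite /tuple_cons_measure /image_measure /pushforward -comp_preimage.
rewrite (_ : uncons \o _ = id); first by rewrite preimage_id.
by apply/funext => x /=; rewrite consK.
Qed.

HB.instance Definition _ := Measure_isSigmaFinite.Build _ _ _
  tuple_cons_measure tcm_sigma_finite.

End step.

Fixpoint tuple_power (m : {sigma_finite_measure set T -> \bar R}) (n : nat) :
    {sigma_finite_measure set (n.-tuple T) -> \bar R} :=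
  match n with
  | 0 => \d_[tuple]
  | n'.+1 => tuple_cons_measure m (tuple_power m n')
  end.

End tuple_measure.

Section complex_space.
Variable R : realType.

Definition plane_measure : set (measurableTypeR R * measurableTypeR R) -> \bar R :=
  (@lebesgue_measure R \x @lebesgue_measure R)%E.

HB.instance Definition _ := Measure.on plane_measure.
HB.instance Definition _ := Measure_isSigmaFinite.Build _ _ _ plane_measure
  (product_sigma_finite _ _).


Section coordinates.
Variable n : nat.
Local Notation coords :=
  (n.-tuple (measurableTypeR R * measurableTypeR R)%type).
Implicit Types z : 'rV[R[i]]_n.

Definition to_coords z : coords :=
  [tuple (complex.Re (z 0 i), complex.Im (z 0 i)) | i < n].

Definition of_coords (t : coords) : 'rV[R[i]]_n :=
  \row_i ((tnth t i).1 +i* (tnth t i).2).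

Lemma to_coordsK : cancel to_coords of_coords.
Proof.
by move=> z; apply/rowP => i; rewrite mxE tnth_mktuple; case: (z 0 i).
Qed.

Lemma of_coordsK : cancel of_coords to_coords.
Proof.
by move=> t; apply: eq_from_tnth => i; rewrite tnth_mktuple mxE -surjective_pairing.
Qed.

(* C^n is identified with [(R * R)^n] through real and imaginary parts, and
   gets the product (hence the Borel) sigma-algebra from there. *)
Definition Cn_measurable : set (set 'rV[R[i]]_n) :=
  preimage_set_system setT to_coords measurable.

Let Cn_sigma_algebra : sigma_algebra setT Cn_measurable.
Proof. exact: sigma_algebra_preimage (sigma_algebra_measurable _). Qed.

Let Cn_measurable0 : Cn_measurable set0.
Proof. by case: Cn_sigma_algebra. Qed.

Let Cn_measurableC A : Cn_measurable A -> Cn_measurable (~` A).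
Proof. by rewrite -setTD; case: Cn_sigma_algebra => _ + _; apply. Qed.

Let Cn_measurable_bigcup (F : (set 'rV[R[i]]_n)^nat) :
  (forall k, Cn_measurable (F k)) -> Cn_measurable (\bigcup_k F k).
Proof. by case: Cn_sigma_algebra => _ _; apply. Qed.

HB.instance Definition _ := @isMeasurable.Build
  default_measure_display 'rV[R[i]]_n
  Cn_measurable Cn_measurable0 Cn_measurableC Cn_measurable_bigcup.

Lemma measurable_to_coords : measurable_fun [set: 'rV[R[i]]_n] to_coords.
Proof. by move=> _ A mA; exists A. Qed.

Lemma measurable_of_coords : measurable_fun [set: coords] of_coords.
Proof.
move=> _ _ [A mA <-]; rewrite !setTI -comp_preimage.
rewrite (_ : to_coords \o of_coords = id) ?preimage_id//.
by apply/funext => t /=; rewrite of_coordsK.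
Qed.

End coordinates.


Section geometry.
Variable n : nat.
Implicit Types z a : 'rV[R[i]]_n.

(* [dotmx z a] is the sum of the [z_i * (a_i)^*], and [0 <= dotmx z z]. *)
Definition hnorm z : R := Num.sqrt (complex.Re (dotmx z z)).

Definition Bn : set 'rV[R[i]]_n := [set z | hnorm z < 1].

Definition Sn : set 'rV[R[i]]_n := [set z | hnorm z = 1].

(* [radial 0 = 0]. *)
Definition radial z : 'rV[R[i]]_n := ((hnorm z)^-1)%:C *: z.

Lemma hnormE z :
  hnorm z = Num.sqrt (\sum_(i < n)
    ((complex.Re (z 0 i)) ^+ 2 + (complex.Im (z 0 i)) ^+ 2)).
Proof.
rewrite /hnorm dotmxE mxE raddf_sum /=; congr Num.sqrt.
apply: eq_bigr => i _; rewrite !mxE; case: (z 0 i) => x y /=.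
by rewrite mulrN opprK !expr2.
Qed.

Let measurable_ReIm i :
  measurable_fun [set: 'rV[R[i]]_n]
    (fun z => complex.Re (z 0 i) : measurableTypeR R) /\
  measurable_fun [set: 'rV[R[i]]_n]
    (fun z => complex.Im (z 0 i) : measurableTypeR R).
Proof.
have mi : measurable_fun [set: 'rV[R[i]]_n] (fun z => tnth (to_coords z) i).
  apply: (@measurableT_comp _ _ _ _ _ _ (fun t => tnth t i)).
    exact: measurable_tnth.
  exact: measurable_to_coords.
split.
  rewrite (_ : (fun _ => _) = fst \o (fun z => tnth (to_coords z) i)).
    exact: measurableT_comp.
  by apply/funext => z /=; rewrite tnth_mktuple.
rewrite (_ : (fun _ => _) = snd \o (fun z => tnth (to_coords z) i)).
  exact: measurableT_comp.
by apply/funext => z /=; rewrite tnth_mktuple.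
Qed.

Lemma measurable_hnorm : measurable_fun [set: 'rV[R[i]]_n] hnorm.
Proof.
rewrite (_ : hnorm = fun z => (\sum_(i < n)
    ((complex.Re (z 0 i)) ^+ 2 + (complex.Im (z 0 i)) ^+ 2)) `^ 2^-1).
  apply: (@measurableT_comp _ _ _ _ _ _ (@powR R ^~ 2^-1)).
    exact: measurable_powR.
  apply: measurable_sum => i; have [mr mi] := measurable_ReIm i.
  by apply: measurable_funD; exact: measurable_funX.
apply/funext => z; rewrite hnormE powR12_sqrt// sumr_ge0// => i _.
by rewrite addr_ge0// sqr_ge0.
Qed.

Lemma measurable_Bn : measurable Bn.
Proof.
rewrite (_ : Bn = hnorm @^-1` `]-oo, 1[).
  by rewrite -[X in measurable X]setTI; apply: measurable_hnorm.
by apply/seteqP; split=> z /=; rewrite /Bn/= in_itv.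
Qed.

Lemma measurable_radial : measurable_fun [set: 'rV[R[i]]_n] radial.
Proof.
suff : measurable_fun [set: 'rV[R[i]]_n] (@to_coords n \o radial).
  move=> mr _ _ [A mA <-]; rewrite !setTI -comp_preimage.
  by rewrite -[X in measurable X]setTI; exact: mr.
apply/measurable_fun_tnthP => i; have [mr mi] := measurable_ReIm i.
have mV : measurable_fun [set: 'rV[R[i]]_n] (fun z => (hnorm z)^-1).
  rewrite (_ : (fun _ => _) = fun z => hnorm z `^ (-1)).
    apply: (@measurableT_comp _ _ _ _ _ _ (@powR R ^~ (-1))).
      exact: measurable_powR.
    exact: measurable_hnorm.
  by apply/funext => z; rewrite powR_inv1// sqrtr_ge0.
rewrite (_ : _ \o _ = fun z => ((hnorm z)^-1 * complex.Re (z 0 i),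
                                (hnorm z)^-1 * complex.Im (z 0 i))).
  by apply: measurable_fun_pair; exact: measurable_funM.
apply/funext => z /=; rewrite tnth_mktuple !mxE; case: (z 0 i) => x y /=.
by rewrite !mul0r subr0 addr0.
Qed.

Definition volume : set 'rV[R[i]]_n -> \bar R :=
  image_measure (tuple_power plane_measure n) (@measurable_of_coords n).

HB.instance Definition _ := Measure.on volume.

Lemma inv_volume_Bn_ge0 : 0 <= (fine (volume Bn))^-1.
Proof. by rewrite invr_ge0 fine_ge0. Qed.

Definition dV : set 'rV[R[i]]_n -> \bar R :=
  mscale (NngNum inv_volume_Bn_ge0) (mrestr volume measurable_Bn).

HB.instance Definition _ := Measure.on dV.

(* Normalized surface measure of the unit sphere as cone measure: by polar
   coordinates, [A] has the normalized volume of the [z] in the unit ball such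
   that [z / |z|] is in [A].  The point [0], where [radial] is not on the
   sphere, is negligible. *)
Definition sigma : set 'rV[R[i]]_n -> \bar R :=
  image_measure dV measurable_radial.

HB.instance Definition _ := Measure.on sigma.

End geometry.
End complex_space.

Section function_spaces.
Variables (R : realType) (n : nat).
Implicit Types (f : 'rV[R[i]]_n -> R[i]) (z a : 'rV[R[i]]_n) (p q s : R).

Definition holomorphic_Bn f := forall z, Bn z -> differentiable f z.

(* [z *m proj_ortho a] is the orthogonal projection of [z] onto the span of
   [a]. *)
Definition Phi a z : 'rV[R[i]]_n :=
  (1 - dotmx z a)^-1 *:
    (a - z *m proj_ortho a
       - (Num.sqrt (1 - hnorm a ^+ 2))%:C *: (z - z *m proj_ortho a)).

(* The last factor is the density of the measure lambda with respect to dV. *)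
Definition Nintegral p q s f a : \bar R :=
  (\int[@dV R n]_(z in @Bn R n)
    (ComplexField.Normc.normc (f z) `^ p
     * (1 - hnorm z ^+ 2) `^ q
     * (1 - hnorm (Phi a z) ^+ 2) `^ (n%:R * s)
     * (1 - hnorm z ^+ 2) ^- n.+1)%:E)%E.

Definition Nnorm p q s f : \bar R :=
  (ereal_sup [set Nintegral p q s f a | a in @Bn R n] `^ p^-1)%E.

Definition Nspace p q s : set ('rV[R[i]]_n -> R[i]) :=
  [set f | holomorphic_Bn f /\ (Nnorm p q s f < +oo)%E].

Definition Bn_boundary : set_system 'rV[R[i]]_n :=
  filter_from [set r : R | r < 1] (fun r => [set a | r < hnorm a < 1]).

Definition N0space p q s : set ('rV[R[i]]_n -> R[i]) :=
  [set f | Nspace p q s f /\ Nintegral p q s f @ Bn_boundary --> 0%E].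

End function_spaces.

Section Hadamard.
Variables (R : realType) (n : nat).
Implicit Types (f : 'rV[R[i]]_n -> R[i]) (P : nat -> mpoly n R[i]).
Implicit Types (nn : nat -> nat).

Definition poly_eval (Q : mpoly n R[i]) (z : 'rV[R[i]]_n) : R[i] :=
  meval (z 0) Q.

(* As [x / 0 = 0], the gap condition forces [0 < nn k]. *)
Definition Hadamard_gaps f nn P :=
  [/\ holomorphic_Bn f,
      forall k, P k \is ishomog1 (nn k) mdeg,
      forall z, Bn z ->
        (fun m => \sum_(0 <= k < m) poly_eval (P k) z) @ \oo --> f z &
      exists2 c : R, 1 < c & forall k, c <= (nn k.+1)%:R / (nn k)%:R].

Definition Msup (Q : mpoly n R[i]) : R :=
  sup [set ComplexField.Normc.normc (poly_eval Q xi) | xi in @Sn R n].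

Definition Lp (p : R) (Q : mpoly n R[i]) : \bar R :=
  ((\int[@sigma R n]_(xi in @Sn R n)
     (ComplexField.Normc.normc (poly_eval Q xi) `^ p)%:E) `^ p^-1)%E.

Definition dyadic_sum (q s : R) nn (u : nat -> \bar R) : \bar R :=
  (\sum_(0 <= k <oo)
    ((2 `^ (k%:R * (n%:R * s + q - n%:R)))^-1)%:E
    * \sum_(0 <= j <oo | (2 ^ k <= nn j < 2 ^ k.+1)%N) u j)%E.

End Hadamard.

(* Main.v *)
Require Import Defs.
From mathcomp Require Import all_boot all_order all_algebra complex.
From mathcomp Require mpoly.
Import -(notations) mpoly.
From mathcomp Require Import all_classical all_reals all_analysis.
From mathcomp Require Import measurable_realfun.
From mathcomp Require Import ring lra zify.

(** Put [alpha = n s + q - n > 0]. Since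
    [1 - |Phi_a z|^2 = (1 - |a|^2) (1 - |z|^2) / |1 - <z, a>|^2], the integral
    defining the norm is that of [|f|^p (1 - |z|^2)^(alpha - 1) W^(n s)] with
    [W = (1 - |a|^2) / |1 - <z, a>|^2]. The ball is cut into the shells
    [1 - 2^-m <= |z| < 1 - 2^-(m+1)]. There the power of [1 - |z|^2] is of
    order [2^-(m (alpha - 1))] and the volume is of order [2^-m], so a bound on
    the shell [m] comes with the weight [2^-(m alpha)] of the dyadic sums.

    Two facts about volume are used. It is multiplied by [|l|^(2n)] under
    [z |-> l z] ([volume_scale]); for [l > 0] this separates the radius from
    the direction ([ge0_integral_shell_radial]), and for [|l| = 1] it is
    rotation invariance ([ge0_integral_shell_rot]). And the mean of
    [W^(n s)] over a shell is bounded uniformly in [a] and in the shell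
    ([integral_Mobius_weight]): as [s <= 1] it suffices to bound the mean of
    [W^n], and [W] is, up to a constant, [(1 - |a|) / |1 - <xi, a>|^2] with
    [xi = z / |z|], so the bound follows by summing over dyadic [t] the
    estimate [O(t^n)] for the measure of the cap [|1 - <xi, a>| < t]
    ([sigma_cap]).

    From the dyadic sum of the [M_j] to the norm: on the shell [m] one has
    [|f| <= sum_j M_j (1 - 2^-(m+1))^(n_j)]. A term whose exponent lies in the
    dyadic block [k] is damped by [2^(-|k - m| alpha / p)] relative to the
    weights, and a block contains boundedly many exponents, so a discrete
    convolution inequality ([gap_dyadic_majorant]) makes the contributions of
    the shells summable, uniformly in [a]. Each single contribution tends to
    [0] as [|a| -> 1] because [W -> 0] uniformly on compact sets, and dominated
    convergence for series ([nneseries_near_le]) gives the limit.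

    From the norm to the dyadic sum of the [L_j]: take [a = 0], where [W = 1].
    The term of degree [n_j] is a limit of averages of rotations of [f] by
    roots of unity, so by convexity ([p >= 1]), rotation invariance and Fatou's
    lemma its [p]-mean over a shell is at most that of [f]
    ([integral_poly_eval_le]). On the shell [k + 1] the damping [|z|^(n_j)] of
    the terms of block [k] is at least [1/4], so that shell controls each
    [L_j^p] of the block, and the block has boundedly many of them. *)

Set Implicit Arguments.
Unset Strict Implicit.
Unset Printing Implicit Defensive.
Import Order.TTheory GRing.Theory Num.Theory.
Import numFieldNormedType.Exports.

Local Open Scope classical_set_scope.
Local Open Scope ring_scope.
Local Open Scope complex_scope.

(** * Complex multiplication and volume *)

Section affine_line.
Variable R : realType.
Implicit Types u b : R.

Lemma measurable_affine u b :
  measurable_fun [set: measurableTypeR R]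
    (fun x => u * x + b : measurableTypeR R).
Proof.
apply: measurable_funD; last exact: measurable_cst.
by apply: measurable_funM; [exact: measurable_cst|exact: measurable_id].
Qed.

(** Both sides are measures, so half-open intervals suffice. *)
Lemma lebesgue_measure_affine u b (A : set (measurableTypeR R)) : u != 0 ->
  measurable A ->
  lebesgue_measure ((fun x => u * x + b) @^-1` A) =
  (`|u|^-1%:E * lebesgue_measure A)%E.
Proof.
move=> u0 mA.
have nu : 0 <= `|u| by [].
pose mu := mscale (NngNum nu) (image_measure lebesgue_measure (measurable_affine u b)).
have H : forall X, ocitv X -> lebesgue_measure X = mu X.
  move=> _ [[x y] _ <-].
  rewrite /mu /mscale /= /image_measure /pushforward.
  have [u1|u1|u1] := ltgtP u 0; last by rewrite u1 eqxx in u0.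
    rewrite (_ : _ @^-1` _ = [set` `[(y - b) / u, (x - b) / u[]); last first.
      apply/seteqP; split => z /=; rewrite !in_itv/=.
        by move=> /andP[h1 h2]; rewrite ler_ndivrMr// ltr_ndivlMr//; lra.
      by rewrite ler_ndivrMr// ltr_ndivlMr// => /andP[h1 h2]; lra.
    rewrite !lebesgue_measure_itv/= !lte_fin ltr_nM2r ?invr_lt0//.
    rewrite ltrD2r; case: ltP => _; last by rewrite mule0.
    rewrite -!EFinD -EFinM ltr0_norm//; congr EFin; field.
    by rewrite lt_eqF.
  rewrite (_ : _ @^-1` _ = [set` `](x - b) / u, (y - b) / u]]); last first.
    apply/seteqP; split => z /=; rewrite !in_itv/=.
      by move=> /andP[h1 h2]; rewrite ltr_pdivrMr// ler_pdivlMr//; lra.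
    by rewrite ltr_pdivrMr// ler_pdivlMr// => /andP[h1 h2]; lra.
  rewrite !lebesgue_measure_itv/= !lte_fin ltr_pM2r ?invr_gt0//.
  rewrite ltrD2r; case: ltP => _; last by rewrite mule0.
  rewrite -!EFinD -EFinM gtr0_norm//; congr EFin; field.
  by rewrite gt_eqF.
rewrite (lebesgue_measure_unique H mA) /mu /mscale/= /image_measure /pushforward.
by rewrite muleA -EFinM mulVf ?normr_eq0// mul1e.
Qed.

End affine_line.

Section fibrewise.
Local Open Scope ereal_scope.
Context d1 d2 (T1 : measurableType d1) (T2 : measurableType d2) (R : realType).
Variable m1 : {sigma_finite_measure set T1 -> \bar R}.
Variable m2 : {sigma_finite_measure set T2 -> \bar R}.

(** A map acting on one factor only, by a transformation that may depend on
    the other one, scales the product measure if it scales every fibre. *)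
Lemma product_measure1_fibrewise (g : T1 * T2 -> T2) (c : R) (E : set (T1 * T2)) :
  (0 <= c)%R -> measurable E -> measurable_fun setT g ->
  (forall x A, measurable A -> m2 ((fun y => g (x, y)) @^-1` A) = c%:E * m2 A) ->
  (m1 \x m2) ((fun z => (z.1, g z)) @^-1` E) = c%:E * (m1 \x m2) E.
Proof.
move=> c0 mE mg Hg.
rewrite /product_measure1 -ge0_integralZl//; last exact: measurable_fun_xsection.
apply: eq_integral => x _ /=; rewrite -(Hg x); last exact: measurable_xsection.
by [].
Qed.

Lemma product_measure2_fibrewise (g : T1 * T2 -> T1) (c : R) (E : set (T1 * T2)) :
  (0 <= c)%R -> measurable E -> measurable_fun setT g ->
  (forall y A, measurable A -> m1 ((fun x => g (x, y)) @^-1` A) = c%:E * m1 A) ->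
  (m1 \x m2) ((fun z => (g z, z.2)) @^-1` E) = c%:E * (m1 \x m2) E.
Proof.
move=> c0 mE mg Hg.
have mgE : measurable ((fun z => (g z, z.2)) @^-1` E).
  rewrite -[X in measurable X]setTI.
  suff : measurable_fun setT (fun z => (g z, z.2)) by exact.
  by apply: measurable_fun_pair.
have P X : measurable X -> (m1 \x m2) X = (m1 \x^ m2) X.
  move=> mX; apply: product_measure_unique => //.
  by move=> A B mA mB; rewrite [LHS]product_measure2E.
rewrite !P// /product_measure2 -ge0_integralZl//; last exact: measurable_fun_ysection.
apply: eq_integral => x _ /=; rewrite -(Hg x); last exact: measurable_ysection.
by [].
Qed.

Lemma product_measure_scale (f1 : T1 -> T1) (f2 : T2 -> T2) (c1 c2 : R)
    (E : set (T1 * T2)) :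
  (0 <= c1)%R -> (0 <= c2)%R -> measurable E ->
  measurable_fun setT f1 -> measurable_fun setT f2 ->
  (forall A, measurable A -> m1 (f1 @^-1` A) = c1%:E * m1 A) ->
  (forall A, measurable A -> m2 (f2 @^-1` A) = c2%:E * m2 A) ->
  (m1 \x m2) ((fun z => (f1 z.1, f2 z.2)) @^-1` E) =
  (c1 * c2)%:E * (m1 \x m2) E.
Proof.
move=> c10 c20 mE mf1 mf2 H1 H2.
have mfE : measurable ((fun z : T1 * T2 => (f1 z.1, z.2)) @^-1` E).
  rewrite -[X in measurable X]setTI.
  suff : measurable_fun setT (fun z : T1 * T2 => (f1 z.1, z.2)) by exact.
  by apply: measurable_fun_pair => //; exact: measurableT_comp.
have m2' : measurable_fun setT (fun z : T1 * T2 => f2 z.2).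
  exact: measurableT_comp.
have m1' : measurable_fun setT (fun z : T1 * T2 => f1 z.1).
  exact: measurableT_comp.
have := @product_measure1_fibrewise (fun z => f2 z.2) c2 _ c20 mfE m2' (fun _ A mA => H2 A mA).
rewrite -comp_preimage/= => E1; rewrite [LHS]E1 EFinM (muleC c1%:E) -muleA.
congr (_ * _).
exact: (@product_measure2_fibrewise (fun z => f1 z.1) c1 _ c10 mE m1' (fun _ A mA => H1 A mA)).
Qed.

End fibrewise.

Section plane.
Variable R : realType.
Local Notation plane := (measurableTypeR R * measurableTypeR R)%type.

(** Multiplication by [u + i v]. *)
Definition plane_mul (u v : R) (w : plane) : plane :=
  (u * w.1 - v * w.2, v * w.1 + u * w.2).

Lemma measurable_linear_form (a b : R) :
  measurable_fun [set: plane] (fun w => a * w.1 + b * w.2 : measurableTypeR R).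
Proof.
apply: measurable_funD.
  by apply: measurable_funM; [exact: measurable_cst|exact: measurable_fst].
by apply: measurable_funM; [exact: measurable_cst|exact: measurable_snd].
Qed.

Lemma measurable_plane_mul u v : measurable_fun setT (plane_mul u v).
Proof.
apply: measurable_fun_pair; last exact: measurable_linear_form.
rewrite (_ : (fun _ => _) = fun w : plane => u * w.1 + (- v) * w.2).
  exact: measurable_linear_form.
by apply/funext => w; rewrite mulNr.
Qed.

Lemma plane_mulM u v u' v' w :
  plane_mul u v (plane_mul u' v' w) =
  plane_mul (u * u' - v * v') (u * v' + v * u') w.
Proof. by rewrite /plane_mul/=; congr (_, _); ring. Qed.

(** If [u <> 0], then [(x, y) |-> (u x - v y, v x + u y)] is the composite of
    [(x, y) |-> (u x - v y, y)] and a map that fixes the first coordinate. *)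
Let plane_measure_mul_re u v (E : set plane) : u != 0 -> measurable E ->
  plane_measure (plane_mul u v @^-1` E) =
  ((u ^+ 2 + v ^+ 2)^-1%:E * plane_measure E)%E.
Proof.
move=> u0 mE.
have d0 : u ^+ 2 + v ^+ 2 != 0 by rewrite paddr_eq0 ?sqr_ge0// sqrf_eq0 (negbTE u0).
pose k := (u ^+ 2 + v ^+ 2) / u.
have k0 : k != 0 by rewrite mulf_neq0// invr_eq0.
pose g2 (z : plane) : measurableTypeR R := v / u * z.1 + k * z.2.
pose g1 (z : plane) : measurableTypeR R := u * z.1 + (- v) * z.2.
have mg2 : measurable_fun setT g2 by exact: measurable_linear_form.
have mg1 : measurable_fun setT g1 by exact: measurable_linear_form.
have -> : plane_mul u v = (fun z => (z.1, g2 z)) \o (fun z => (g1 z, z.2)).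
  by apply/funext => -[x y]; rewrite /plane_mul/g1/g2/k/=; congr (_, _); field.
rewrite comp_preimage.
have mE2 : measurable ((fun z : plane => (z.1, g2 z)) @^-1` E).
  rewrite -[X in measurable X]setTI.
  suff : measurable_fun setT (fun z : plane => (z.1, g2 z)) by exact.
  by apply: measurable_fun_pair.
rewrite /plane_measure.
rewrite (@product_measure2_fibrewise _ _ _ _ _ _ _ g1 `|u|^-1)//; last first.
  by move=> y A mA; rewrite -(lebesgue_measure_affine (- v * y))//.
rewrite (@product_measure1_fibrewise _ _ _ _ _ _ _ g2 `|k|^-1)//; last first.
  move=> x A mA; rewrite -(lebesgue_measure_affine (v / u * x))//.
  rewrite (_ : (fun y => g2 (x, y)) = (fun y => k * y + v / u * x))//.
  by apply/funext => y; rewrite /g2/= addrC.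
rewrite muleA -EFinM; congr (_%:E * _)%E.
rewrite /k normrM normfV -[in LHS]invfM mulrCA mulfV ?normr_eq0// mulr1.
by rewrite ger0_norm// addr_ge0 ?sqr_ge0.
Qed.

Lemma plane_measure_mul u v (E : set plane) :
  u ^+ 2 + v ^+ 2 != 0 -> measurable E ->
  plane_measure (plane_mul u v @^-1` E) =
  ((u ^+ 2 + v ^+ 2)^-1%:E * plane_measure E)%E.
Proof.
move=> d0 mE; have [u0|u0] := eqVneq u 0; last exact: plane_measure_mul_re.
have v0 : v != 0 by move: d0; rewrite u0 expr0n add0r sqrf_eq0.
(* i v = (1 + i) (v / 2 + i v / 2) *)
have -> : plane_mul u v = plane_mul 1 1 \o plane_mul (v / 2) (v / 2).
  by apply/funext => w; rewrite /= plane_mulM u0; congr (plane_mul _ _ _); field.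
have v2 : v / 2 != 0 by rewrite mulf_neq0// invr_eq0.
rewrite comp_preimage plane_measure_mul_re//; last first.
  by rewrite -[X in measurable X]setTI; exact: measurable_plane_mul.
rewrite plane_measure_mul_re ?oner_neq0// muleA -EFinM.
congr (_%:E * _)%E; rewrite u0; field.
by rewrite v0 -mulr2n mulrn_eq0 sqrf_eq0 v0.
Qed.

End plane.

Section tuple_scale.
Context d (T : measurableType d) (R : realType).
Variable m : {sigma_finite_measure set T -> \bar R}.

Lemma measurable_map_tuple (g : T -> T) n : measurable_fun setT g ->
  measurable_fun setT (fun t : n.-tuple T => [tuple of map g t]).
Proof.
move=> mg; apply/measurable_fun_tnthP => i.
rewrite (_ : _ \o _ = g \o (fun t => tnth t i)).
  by apply: measurableT_comp => //; exact: measurable_tnth.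
by apply/funext => t /=; rewrite tnth_map.
Qed.

Lemma tuple_power_scale (g : T -> T) (c : R) n (E : set (n.-tuple T)) :
  0 <= c -> measurable_fun setT g ->
  (forall A, measurable A -> m (g @^-1` A) = c%:E * m A)%E -> measurable E ->
  tuple_power m n ((fun t : n.-tuple T => [tuple of map g t]) @^-1` E) =
  ((c ^+ n)%:E * tuple_power m n E)%E.
Proof.
move=> c0 mg Hg; elim: n E => [|n IH] E mE.
  rewrite expr0 mul1e; congr (_ _); apply/seteqP; split => t /=;
    by rewrite [X in E X -> _]tuple0 [X in _ -> E X]tuple0.
rewrite /= /tuple_cons_measure /image_measure /pushforward.
rewrite -comp_preimage exprS.
rewrite -(@product_measure_scale _ _ _ _ _ _ _ g
  (fun t : n.-tuple T => [tuple of map g t])) //.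
- congr (_ _); apply/seteqP; split => -[x t] /=;
  by congr (E _); apply/val_inj.
- by rewrite exprn_ge0.
- by rewrite -[X in measurable X]setTI; exact: measurable_tuple_cons.
- exact: measurable_map_tuple.
Qed.

End tuple_scale.

Section volume.
Variables (R : realType) (n : nat).
Implicit Types (z : 'rV[R[i]]_n) (E : set 'rV[R[i]]_n) (l : R[i]).
Local Notation plane := (measurableTypeR R * measurableTypeR R)%type.

Lemma measurable_Cn (E : set 'rV[R[i]]_n) :
  measurable (@of_coords R n @^-1` E) -> measurable E.
Proof.
move=> mE; exists (@of_coords R n @^-1` E) => //.
rewrite setTI -comp_preimage (_ : @of_coords R n \o _ = id) ?preimage_id//.
by apply/funext => z /=; rewrite to_coordsK.
Qed.

Lemma of_coords_scale l (t : n.-tuple plane) :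
  l *: of_coords t =
  of_coords [tuple of map (plane_mul (complex.Re l) (complex.Im l)) t].
Proof.
apply/rowP => i; rewrite !mxE tnth_map /plane_mul; case: l => u v /=.
by apply/eqP; rewrite eq_complex/= eqxx addrC eqxx.
Qed.

Lemma measurable_scale l : measurable_fun setT (fun z => l *: z).
Proof.
move=> _ E mE; rewrite setTI; apply: measurable_Cn.
rewrite -comp_preimage.
rewrite (_ : _ \o _ = @of_coords R n \o (fun t : n.-tuple plane =>
   [tuple of map (plane_mul (complex.Re l) (complex.Im l)) t])); last first.
  by apply/funext => t; rewrite /= of_coords_scale.
rewrite comp_preimage -[X in measurable X]setTI.
apply: measurable_map_tuple => //; first exact: measurable_plane_mul.
by rewrite -[X in measurable X]setTI; exact: measurable_of_coords.
Qed.

(** A complex scalar acts on each coordinate as a similarity of the plane. *)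
Lemma volume_scale l E : l != 0 -> measurable E ->
  volume ((fun z => l *: z) @^-1` E) =
  (((ComplexField.Normc.normc l) ^- (2 * n))%:E * volume E)%E.
Proof.
move=> l0 mE; rewrite /volume /image_measure /pushforward -comp_preimage.
rewrite (_ : _ \o _ = @of_coords R n \o (fun t : n.-tuple plane =>
   [tuple of map (plane_mul (complex.Re l) (complex.Im l)) t])); last first.
  by apply/funext => t; rewrite /= of_coords_scale.
rewrite comp_preimage.
case: l l0 => u v /= l0.
have d0 : u ^+ 2 + v ^+ 2 != 0.
  by move: l0; rewrite eq_complex/= paddr_eq0 ?sqr_ge0// !sqrf_eq0.
rewrite (@tuple_power_scale _ _ _ _ (plane_mul u v) (u ^+ 2 + v ^+ 2)^-1).
- congr (_%:E * _)%E.
  by rewrite -exprVn exprM exprVn sqr_sqrtr ?addr_ge0 ?sqr_ge0.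
- by rewrite invr_ge0 addr_ge0 ?sqr_ge0.
- exact: measurable_plane_mul.
- by move=> A mA; exact: plane_measure_mul.
- by rewrite -[X in measurable X]setTI; exact: measurable_of_coords.
Qed.

End volume.

(** * Hermitian geometry of the ball *)

Notation normc := ComplexField.Normc.normc.

Section complex_modulus.
Variable R : realType.
Implicit Types x y : R[i].

Lemma normr_normc x : `|x| = (normc x)%:C.
Proof. by rewrite normc_def; case: x. Qed.

Lemma normc_sqr x : normc x ^+ 2 = complex.Re x ^+ 2 + complex.Im x ^+ 2.
Proof. by case: x => a b /=; rewrite sqr_sqrtr// addr_ge0 ?sqr_ge0. Qed.

Lemma normc_ge0 x : 0 <= normc x.
Proof. by case: x => a b /=; exact: sqrtr_ge0. Qed.

Lemma normc_real (r : R) : normc r%:C = `|r|.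
Proof. by rewrite /= expr0n/= addr0 sqrtr_sqr. Qed.

Lemma normcX x k : normc (x ^+ k) = normc x ^+ k.
Proof.
elim: k => [|k IH]; first by rewrite !expr0 ComplexField.Normc.normc1.
by rewrite !exprS ComplexField.Normc.normcM IH.
Qed.

Lemma normc_eq0 x : (normc x == 0) = (x == 0).
Proof.
apply/eqP/eqP; first exact: ComplexField.Normc.eq0_normc.
by move=> ->; rewrite ComplexField.Normc.normc0.
Qed.

Lemma normc_sum (I : Type) (r : seq I) (P : pred I) (F : I -> R[i]) :
  normc (\sum_(k <- r | P k) F k) <= \sum_(k <- r | P k) normc (F k).
Proof.
elim/big_ind2 : _ => //; first by rewrite ComplexField.Normc.normc0.
by move=> a b c d h1 h2; rewrite (le_trans (le_normcD _ _))// lerD.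
Qed.

Lemma normc_distC x y : normc (x - y) = normc (y - x).
Proof. by rewrite -normcN opprB. Qed.

Lemma ler_normcB x y : normc x - normc y <= normc (x - y).
Proof. by rewrite lerBlDr (le_trans _ (le_normcD _ _))// subrK. Qed.

Lemma normc_geRe x : complex.Re x <= normc x.
Proof.
rewrite (le_trans (ler_norm _))// -sqrtr_sqr; case: x => a b /=.
by rewrite ler_sqrt ?addr_ge0 ?sqr_ge0// lerDl sqr_ge0.
Qed.

End complex_modulus.

(** [hnorm] behind a lock, so that [nrm u] and [nrm v] are compared through
    [u] and [v] and never by unfolding them to matrix products. *)
Definition nrm (R : realType) n : 'rV[R[i]]_n -> R := locked (@hnorm R n).

Lemma nrmE (R : realType) n : @nrm R n = @hnorm R n.
Proof. by rewrite /nrm -lock. Qed.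

Section hermitian.
Variables (R : realType) (n : nat).
Implicit Types (z a u : 'rV[R[i]]_n) (l : R[i]).

Lemma nrm_ge0 z : 0 <= nrm z. Proof. by rewrite nrmE; exact: sqrtr_ge0. Qed.

Lemma dotmxxE z : dotmx z z = (nrm z ^+ 2)%:C.
Proof.
have h : 0 <= dotmx z z by exact: dnorm_ge0.
have h' : 0 <= complex.Re (dotmx z z) by move: h; rewrite lecE => /andP[].
rewrite nrmE /hnorm sqr_sqrtr// RRe_real//; exact: ger0_real.
Qed.

Lemma dotmxC z a : dotmx z a = (dotmx a z)^*.
Proof.
by rewrite !dotmxE !mxE rmorph_sum/=; apply: eq_bigr => i _;
  rewrite !mxE rmorphM/= mulrC conjcK.
Qed.

Lemma nrmZ l z : nrm (l *: z) = normc l * nrm z.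
Proof.
have : (nrm (l *: z) ^+ 2)%:C = ((normc l * nrm z) ^+ 2)%:C.
  by rewrite -dotmxxE dnormZ/= dotmxxE normr_normc -!rmorphXn -rmorphM exprMn.
move=> /complexI/eqP; rewrite eqrXn2 ?nrm_ge0 ?mulr_ge0 ?normc_ge0 ?nrm_ge0//.
by move=> /eqP.
Qed.

Lemma nrm_eq0 z : (nrm z == 0) = (z == 0).
Proof.
rewrite -(@dnorm_eq0 _ _ (@dotmx _ n)) /= dotmxxE.
by rewrite -(inj_eq (@complexI R)) rmorphXn/= expf_eq0.
Qed.

Lemma nrm0 : nrm (0 : 'rV[R[i]]_n) = 0.
Proof. by apply/eqP; rewrite nrm_eq0. Qed.

Lemma nrmN z : nrm (- z) = nrm z.
Proof. by rewrite -scaleN1r nrmZ normcN ComplexField.Normc.normc1 mul1r. Qed.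

Lemma nrm_sqrD z a :
  nrm (z + a) ^+ 2 = nrm z ^+ 2 + nrm a ^+ 2 + 2 * complex.Re (dotmx z a).
Proof.
apply: complexI; rewrite -dotmxxE dnormD/= !dotmxxE.
have H (x : R) : 2 * x%:C = (2 * x)%:C :> R[i].
  by rewrite !mulr_natl !mulr2n rmorphD.
by rewrite (addcJ (dotmx z a)) !rmorphD/= -H.
Qed.

Lemma nrm_sqrB z a :
  nrm (z - a) ^+ 2 = nrm z ^+ 2 + nrm a ^+ 2 - 2 * complex.Re (dotmx z a).
Proof.
have E := nrm_sqrD z (- a).
rewrite (nrmN a) (linearNr (@dotmx _ n) z a : dotmx z (- a) = - dotmx z a) in E.
by apply: (etrans E); case: (dotmx z a) => x y /=; rewrite mulrN.
Qed.

Lemma normc_dotmx_le z a : normc (dotmx z a) <= nrm z * nrm a.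
Proof.
have := (CauchySchwarz (@dotmx _ n) z a).1.
rewrite /= normr_normc !dotmxxE -rmorphXn -rmorphM lecR -exprMn.
by rewrite ler_pXn2r ?nnegrE ?mulr_ge0 ?normc_ge0 ?nrm_ge0.
Qed.

Lemma normc_coord_le z i : normc (z 0 i) <= nrm z.
Proof.
rewrite nrmE hnormE; case E : (z 0 i) => [x y] /=.
rewrite ler_sqrt ?sumr_ge0//; last by move=> k _; rewrite addr_ge0 ?sqr_ge0.
rewrite (bigD1 i)//= E/= lerDl sumr_ge0// => k _.
by rewrite addr_ge0 ?sqr_ge0.
Qed.

(** By pigeonhole; caps are sliced along this coordinate. *)
Lemma ex_coord_ge z : (0 < n)%N ->
  exists i, nrm z ^+ 2 <= n%:R * normc (z 0 i) ^+ 2.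
Proof.
move=> n0; pose i0 := Ordinal n0.
have [i _ hi] := @Order.TotalTheory.arg_maxP _ _ _ i0 xpredT
  (fun i => normc (z 0 i)) isT.
exists i; rewrite nrmE hnormE sqr_sqrtr; last first.
  by rewrite sumr_ge0// => k _; rewrite addr_ge0 ?sqr_ge0.
have -> : n%:R * normc (z 0 i) ^+ 2 = \sum_(k < n) normc (z 0 i) ^+ 2.
  by rewrite sumr_const card_ord mulr_natl.
apply: ler_sum => k _; rewrite -normc_sqr lerXn2r// ?nnegrE ?normc_ge0//.
exact: hi.
Qed.

Lemma nrm_radial z : z != 0 -> nrm (radial z) = 1.
Proof.
move=> z0; rewrite /radial -nrmE nrmZ normc_real ger0_norm ?invr_ge0 ?nrm_ge0//.
by rewrite mulVf// nrm_eq0.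
Qed.

Lemma nrm_radial_le1 z : nrm (radial z) <= 1.
Proof.
have [->|z0] := eqVneq z 0; last by rewrite nrm_radial.
by rewrite /radial scaler0 nrm0.
Qed.

Lemma radialK z : (nrm z)%:C *: radial z = z.
Proof.
have [->|z0] := eqVneq z 0; first by rewrite nrm0 scale0r.
by rewrite /radial -nrmE scalerA -rmorphM/= mulfV ?nrm_eq0// scale1r.
Qed.

Lemma radialZ (r : R) z : 0 < r -> radial (r%:C *: z) = radial z.
Proof.
move=> r0; rewrite /radial -nrmE nrmZ normc_real gtr0_norm// scalerA -rmorphM/=.
by rewrite invfM -mulrA mulrC -mulrA mulfV ?mulr1// gt_eqF.
Qed.

End hermitian.

Section automorphism.
Variables (R : realType) (n : nat).
Implicit Types (z a : 'rV[R[i]]_n).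

Lemma normc_1Bdot_ge z a : nrm a <= 1 -> 1 - nrm z <= normc (1 - dotmx z a).
Proof.
move=> a1; apply: le_trans (ler_normcB _ _); rewrite ComplexField.Normc.normc1.
rewrite lerD2l lerN2 (le_trans (normc_dotmx_le _ _))//.
by rewrite ler_piMr// nrm_ge0.
Qed.

Lemma normc_1Bdot_ger z a : nrm z <= 1 -> 1 - nrm a <= normc (1 - dotmx z a).
Proof.
move=> a1; apply: le_trans (ler_normcB _ _); rewrite ComplexField.Normc.normc1.
rewrite lerD2l lerN2 (le_trans (normc_dotmx_le _ _))//.
by rewrite ler_piMl// nrm_ge0.
Qed.

(** Moving [z] radially to the sphere does not increase [|1 - <z, a>|] much:
    the displacement is at most [1 - |<z, a>|], itself a lower bound. *)
Lemma normc_1Bdot_radial z a : nrm z <= 1 -> nrm a <= 1 ->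
  normc (1 - dotmx (radial z) a) <= 2 * normc (1 - dotmx z a).
Proof.
move=> z1 a1; set w := dotmx (radial z) a; set r := nrm z.
have zw : dotmx z a = r%:C * w by rewrite -[in LHS](radialK z) linearZl_LR.
have w1 : normc w <= 1.
  rewrite (le_trans (normc_dotmx_le _ _))// mulr_ile1 ?nrm_ge0//.
  exact: nrm_radial_le1.
have r0 : 0 <= r by exact: nrm_ge0.
rewrite zw mulr_natl mulr2n.
have -> : 1 - w = (1 - r%:C * w) - (1 - r)%:C * w.
  by rewrite rmorphB/= rmorph1; ring.
rewrite (le_trans (le_normcD _ _))// lerD2l normcN.
rewrite ComplexField.Normc.normcM normc_real ger0_norm ?subr_ge0//.
apply: le_trans (ler_normcB _ _).
rewrite ComplexField.Normc.normc1 ComplexField.Normc.normcM normc_real ger0_norm//.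
have := normc_ge0 w; set t := normc w in w1 *; nra.
Qed.

(** With [z = c a + u] and [u] orthogonal to [a], both sides are rational
    functions of [c], [|a|^2] and [|u|^2]. *)
Lemma one_minus_Phi a z : nrm a < 1 -> nrm z < 1 ->
  1 - nrm (Phi a z) ^+ 2 =
  (1 - nrm a ^+ 2) * (1 - nrm z ^+ 2) / normc (1 - dotmx z a) ^+ 2.
Proof.
move=> a1 z1; rewrite /Phi -nrmE; set w := z *m proj_ortho a.
have [c wE] : exists c, w = c *: a.
  by have /sub_rVP := proj_ortho_sub a z.
have := proj_ortho_compl_sub a z; rewrite -/w; set u := z - w => ua.
have zE : z = c *: a + u by rewrite -wE /u addrC subrK.
have {ua} ua : dotmx u a = 0.
  move: ua; rewrite orthomx1E => /eqP/matrixP/(_ 0 0).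
  by rewrite dotmxE mxE [in X in X -> _]mxE; apply.
have au : dotmx a u = 0 by rewrite dotmxC ua conjc0.
have dza : dotmx z a = c * (nrm a ^+ 2)%:C.
  by rewrite zE linearDl/= ua addr0 linearZl_LR/= dotmxxE.
have D0 : 0 < normc (1 - dotmx z a).
  by rewrite (lt_le_trans _ (normc_1Bdot_ge _ (ltW a1)))// subr_gt0.
have a1' : 0 <= 1 - nrm a ^+ 2.
  by rewrite subr_ge0 expr_le1 ?nrm_ge0// ltW.
rewrite nrmZ ComplexField.Normc.normcV exprMn exprVn.
have z2 : nrm z ^+ 2 = normc c ^+ 2 * nrm a ^+ 2 + nrm u ^+ 2.
  by rewrite zE nrm_sqrD linearZl_LR/= au mulr0 /= mulr0 addr0 nrmZ exprMn.
have -> : a - w - (Num.sqrt (1 - nrm a ^+ 2))%:C *: u = ((1 - c) *: a - (Num.sqrt (1 - nrm a ^+ 2))%:C *: u).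
  by rewrite wE scalerBl scale1r.
have ortho : dotmx ((1 - c) *: a) ((Num.sqrt (1 - nrm a ^+ 2))%:C *: u) = 0.
  by rewrite linearZl_LR/= linearZr_LR/= au !mulr0.
rewrite nrm_sqrB !nrmZ ortho [complex.Re 0]/= mulr0 subr0.
rewrite !exprMn normc_real real_normK ?num_real// sqr_sqrtr// z2.
have -> : normc (1 - c) ^+ 2 = (1 - complex.Re c) ^+ 2 + complex.Im c ^+ 2.
  by rewrite normc_sqr; case: (c) => x y /=; rewrite sub0r sqrrN.
have D2 : normc (1 - dotmx z a) ^+ 2 = (1 - complex.Re c * nrm a ^+ 2) ^+ 2
    + (complex.Im c * nrm a ^+ 2) ^+ 2.
  rewrite dza normc_sqr; case: (c) => x y /=.
  by rewrite !mulr0 subr0 !add0r sqrrN.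
have D20 : normc (1 - dotmx z a) ^+ 2 != 0 by rewrite expf_neq0// gt_eqF.
rewrite normc_sqr.
apply: (mulIf D20); rewrite mulfVK// mulrBl mul1r mulrC mulrA mulfV// mul1r D2.
ring.
Qed.

End automorphism.

(** * Volume on shells *)

Section restriction.
Local Open Scope ereal_scope.
Context d (T : measurableType d) (R : realType).

Lemma ge0_integral_mrestr (mu : {measure set T -> \bar R}) (D : set T)
    (mD : measurable D) (g : T -> \bar R) :
  measurable_fun setT g -> (forall x, 0 <= g x) ->
  \int[mrestr mu mD]_x g x = \int[mu]_(x in D) g x.
Proof.
move=> mg g0; rewrite (@ge0_negligible_integral _ _ _ _ setT (~` D))//.
- rewrite setTD setCK; apply: eq_measure_integral => A mA AD.
  by rewrite /= /mrestr setIidl.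
- exact: measurableC.
- by rewrite /= /mrestr setICl measure0.
Qed.

End restriction.

Section shells.
Variables (R : realType) (n : nat).
Hypothesis n_gt0 : (0 < n)%N.
Implicit Types (z : 'rV[R[i]]_n) (E : set 'rV[R[i]]_n).

Definition shell (r1 r2 : R) : set 'rV[R[i]]_n := [set z | r1 <= nrm z < r2].

Lemma measurable_nrm : measurable_fun setT (@nrm R n : _ -> measurableTypeR R).
Proof. by rewrite nrmE; exact: measurable_hnorm. Qed.

Lemma measurable_shell r1 r2 : measurable (shell r1 r2).
Proof.
rewrite (_ : shell r1 r2 = setT `&` @nrm R n @^-1` `[r1, r2[).
  exact: measurable_nrm.
by rewrite setTI; apply/seteqP; split=> z /=; rewrite /shell/= in_itv.
Qed.

Lemma BnE : @Bn R n = shell 0 1.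
Proof. by apply/seteqP; split=> z; rewrite /Bn /shell/= -nrmE nrm_ge0. Qed.

Lemma measurable_cone E : measurable E -> measurable (@radial R n @^-1` E).
Proof. by move=> mE; rewrite -[X in measurable X]setTI; exact: measurable_radial. Qed.

Lemma dVE E : dV E = ((fine (volume (@Bn R n)))^-1%:E * volume (E `&` @Bn R n))%E.
Proof. by []. Qed.

Lemma dV_fin_num E : measurable E -> dV E \is a fin_num.
Proof.
move=> mE; rewrite ge0_fin_numE// dVE.
have h : (volume (E `&` @Bn R n) <= volume (@Bn R n))%E.
  by apply: le_measure; rewrite ?inE//; [apply: measurableI|..] => //; exact: measurable_Bn.
case E1 : (volume (@Bn R n)) h => [r| |] h /=.
- rewrite (le_lt_trans (y := (r^-1%:E * r%:E)%E)) ?ltry//.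
  apply: lee_wpmul2l => //; rewrite lee_fin invr_ge0 -lee_fin -E1.
  exact: measure_ge0.
- by rewrite invr0 mul0e ltry.
- have h0 : (0 <= volume (@Bn R n))%E by exact: measure_ge0.
  by rewrite E1 in h0.
Qed.

(** Dilations preserve the direction [radial z]. *)
Lemma volume_cone (r : R) E : 0 < r -> measurable E ->
  volume (@radial R n @^-1` E `&` shell 0 r) =
  ((r ^+ (2 * n))%:E * volume (@radial R n @^-1` E `&` @Bn R n))%E.
Proof.
move=> r0 mE; pose l : R[i] := (r^-1)%:C.
have ir0 : 0 < r^-1 by rewrite invr_gt0.
have l0 : l != 0 by rewrite -normc_eq0 normc_real normr_eq0 gt_eqF.
have mB : measurable (@radial R n @^-1` E `&` @Bn R n).
  by apply: measurableI; [exact: measurable_cone|exact: measurable_Bn].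
rewrite (_ : (r ^+ (2 * n)) = (normc l ^- (2 * n))); last first.
  by rewrite normc_real gtr0_norm// exprVn invrK.
rewrite -volume_scale//; congr (volume _); rewrite BnE.
have sE z : shell 0 r z <-> shell 0 1 (l *: z).
  rewrite /shell/= !nrm_ge0/= nrmZ normc_real gtr0_norm//.
  by rewrite mulrC ltr_pdivrMr// mul1r.
apply/seteqP; split => z /= [Ez /sE rz]; split=> //.
- by rewrite radialZ.
- by rewrite radialZ in Ez.
Qed.

Lemma dV_cone (r : R) E : 0 <= r <= 1 -> measurable E ->
  dV (@radial R n @^-1` E `&` shell 0 r) =
  ((r ^+ (2 * n))%:E * dV (@radial R n @^-1` E))%E.
Proof.
move=> /andP[r0 r1] mE; rewrite !dVE -setIA (_ : shell 0 r `&` _ = shell 0 r); last first.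
  apply: setIidl => z; rewrite BnE /shell/= => /andP[-> h]/=.
  exact: lt_le_trans r1.
move: r0; rewrite le_eqVlt => /predU1P[<-|r0]; last first.
  by rewrite volume_cone// muleCA.
rewrite (_ : shell 0 0 = set0); last first.
  by apply/seteqP; split => z //=; rewrite /shell/= ltNge; case: (0 <= _).
by rewrite setI0 measure0 mule0 expr0n muln_eq0/= eqn0Ngt n_gt0 mul0e.
Qed.

(** A shell is a difference of balls, and by dilation a cone over [E] fills the
    same proportion of every ball. *)
Lemma dV_shell (r1 r2 : R) E : 0 <= r1 <= r2 -> r2 <= 1 -> measurable E ->
  dV (@radial R n @^-1` E `&` shell r1 r2) =
  ((r2 ^+ (2 * n) - r1 ^+ (2 * n))%:E * dV (@radial R n @^-1` E))%E.
Proof.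
move=> /andP[r10 r12] r21 mE.
have mC := measurable_cone mE.
have := @dV_cone r2 E _ mE; rewrite (le_trans r10)// r21 => /(_ isT).
have := @dV_cone r1 E _ mE; rewrite (le_trans r12)// r10 => /(_ isT) H1.
have -> : @radial R n @^-1` E `&` shell 0 r2 =
   (@radial R n @^-1` E `&` shell 0 r1) `|` (@radial R n @^-1` E `&` shell r1 r2).
  rewrite -setIUr; congr (_ `&` _); apply/seteqP; split => z /=; rewrite /shell/=.
    rewrite !nrm_ge0/= => h; have [|] := ltP (nrm z) r1; first by left.
    by right.
  by rewrite !nrm_ge0/= => -[/lt_le_trans/(_ r12)//|/andP[]].
rewrite measureU; last 3 first.
- by apply: measurableI => //; exact: measurable_shell.
- by apply: measurableI => //; exact: measurable_shell.
- apply/seteqP; split => z //=; rewrite /shell/= => -[[_ /andP[_ h]] [_ /andP[]]].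
  by rewrite leNgt h.
rewrite /= H1; have /fineK <- := dV_fin_num mC.
have /fineK <- : dV (@radial R n @^-1` E `&` shell r1 r2) \is a fin_num.
  by apply: dV_fin_num; apply: measurableI => //; exact: measurable_shell.
move: (fine _) (fine _) => a b; rewrite -!EFinM -EFinD => -[h].
by congr EFin; rewrite mulrBl -h; ring.
Qed.

(** Integration in polar coordinates, for functions of the direction. *)
Lemma ge0_integral_shell_radial (r1 r2 : R) (g : 'rV[R[i]]_n -> \bar R) :
  0 <= r1 <= r2 -> r2 <= 1 -> measurable_fun setT g -> (forall z, 0 <= g z)%E ->
  (\int[@dV R n]_(z in shell r1 r2) g (radial z) =
   (r2 ^+ (2 * n) - r1 ^+ (2 * n))%:E * \int[@sigma R n]_z g z)%E.
Proof.
move=> r12 r21 mg g0.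
have c0 : 0 <= r2 ^+ (2 * n) - r1 ^+ (2 * n).
  move: r12 => /andP[h1 h2]; rewrite subr_ge0 lerXn2r ?nnegrE//.
  exact: le_trans h2.
rewrite -(ge0_integral_mrestr _ (measurable_shell r1 r2)); last 2 first.
- by apply: measurableT_comp => //; exact: measurable_radial.
- by move=> z; exact: g0.
pose m := mrestr (@dV R n) (measurable_shell r1 r2).
have -> : (\int[m]_z g (radial z) = \int[image_measure m (@measurable_radial R n)]_z g z)%E.
  rewrite /image_measure.
  by rewrite (ge0_integral_pushforward (@measurable_radial R n) _ measurableT)//.
pose s := mscale (NngNum c0) (@sigma R n).
have -> : (\int[image_measure m (@measurable_radial R n)]_z g z = \int[s]_z g z)%E.
  apply: eq_measure_integral => A mA _.
  exact: (dV_shell r12 r21 mA).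
by rewrite /s ge0_integral_mscale.
Qed.

Lemma sigma_fin_num E : measurable E -> sigma E \is a fin_num.
Proof. by move=> mE; apply: dV_fin_num; exact: measurable_cone. Qed.

(** The rotation [z |-> l z] preserves every shell, and volume by
    [volume_scale]. *)
Lemma ge0_integral_shell_rot (l : R[i]) (r1 r2 : R) (g : 'rV[R[i]]_n -> \bar R) :
  normc l = 1 -> r2 <= 1 -> measurable_fun (shell r1 r2) g ->
  (forall z, shell r1 r2 z -> 0 <= g z)%E ->
  (\int[@dV R n]_(z in shell r1 r2) g (l *: z) =
   \int[@dV R n]_(z in shell r1 r2) g z)%E.
Proof.
move=> l1 r21 mg g0.
have l0 : l != 0 by rewrite -normc_eq0 l1 oner_eq0.
have shl r r' z : shell r r' (l *: z) <-> shell r r' z.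
  by rewrite /shell/= nrmZ l1 mul1r.
have shlE r r' : (fun z => l *: z) @^-1` shell r r' = shell r r'.
  by apply/seteqP; split => z /= /shl.
pose m := image_measure (@dV R n) (@measurable_scale R n l).
have -> : (\int[@dV R n]_(z in shell r1 r2) g z = \int[m]_(z in shell r1 r2) g z)%E.
  apply: eq_measure_integral => A mA AS.
  rewrite [LHS]dVE /m/= /image_measure /pushforward [in RHS]dVE.
  congr (_ * _)%E.
  have -> : (fun z => l *: z) @^-1` A `&` @Bn R n =
            (fun z => l *: z) @^-1` (A `&` @Bn R n).
    by rewrite BnE preimage_setI shlE.
  have mAB : measurable (A `&` @Bn R n).
    by apply: measurableI => //; exact: measurable_Bn.
  by rewrite [RHS](volume_scale l0 mAB) l1 expr1n invr1 mul1e.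
rewrite /m /image_measure (ge0_integral_pushforward (@measurable_scale R n l))//.
- by rewrite shlE.
- exact: measurable_shell.
- by move=> z; rewrite inE; exact: g0.
Qed.

End shells.

(** * Slicing a product measure *)

Section tuple_fibres.
Local Open Scope ereal_scope.
Context d (T : measurableType d) (R : realType).
Variable m : {sigma_finite_measure set T -> \bar R}.

Definition set_coord n (t : n.-tuple T) (i : 'I_n) (x : T) : n.-tuple T :=
  [tuple if j == i then x else tnth t j | j < n].

Definition box (Q : nat -> set T) n : set (n.-tuple T) :=
  [set t | forall j : 'I_n, Q j (tnth t j)].

Lemma measurable_box (Q : nat -> set T) n : (forall j, measurable (Q j)) ->
  measurable (@box Q n).
Proof.
move=> mQ; rewrite (_ : @box Q n =
  \bigcap_k if insub k is Some j then (fun t : n.-tuple T => tnth t j) @^-1` Q j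
             else setT); last first.
  apply/seteqP; split=> t /= h; first by move=> k _; case: insubP => //= j _ _; exact: h.
  by move=> j; have := h j I; rewrite valK.
apply: bigcap_measurableType => k _; case: insubP => //= j _ _.
by rewrite -[X in measurable X]setTI; exact: measurable_tnth.
Qed.

Lemma tuple_power_box_le (Q : nat -> set T) (v : R) n :
  (forall j, measurable (Q j)) -> (forall j, m (Q j) <= v%:E) ->
  tuple_power m n (@box Q n) <= (v ^+ n)%:E.
Proof.
elim: n Q => [|n IH] Q mQ Qv /=.
  by rewrite diracE expr0; case: (_ \in _); rewrite ?lee_fin.
rewrite /tuple_cons_measure /image_measure /pushforward.
rewrite (_ : _ @^-1` _ = Q 0%N `*` @box (fun j => Q j.+1) n); last first.
  apply/seteqP; split=> -[x t] /=.
    move=> h; split; first exact: (h ord0).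
    by move=> j; have := h (lift ord0 j); rewrite tnthS.
  move=> [h0 h] j; case: (unliftP ord0 j) => [k|] ->; last by rewrite tnth0.
  by rewrite tnthS; exact: h.
have mB : measurable (@box (fun j => Q j.+1) n) by exact: measurable_box.
rewrite [leLHS]product_measure1E// exprS EFinM.
apply: lee_pmul => //; first exact: Qv.
by apply: IH => j; [exact: mQ|exact: Qv].
Qed.

Let product_measure12 d1 d2 (T1 : measurableType d1) (T2 : measurableType d2)
    (m1 : {sigma_finite_measure set T1 -> \bar R})
    (m2 : {sigma_finite_measure set T2 -> \bar R}) X :
  measurable X -> (m1 \x m2) X = (m1 \x^ m2) X.
Proof.
move=> mX; apply: product_measure_unique => //.
by move=> A B mA mB; rewrite [LHS]product_measure2E.
Qed.

Let tuple_power_fibre0_le n (E : set (n.+1.-tuple T)) (Q : nat -> set T)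
    (v w : R) :
  (0 <= w)%R -> measurable E ->
  (forall j, measurable (Q j)) -> (forall j, m (Q j) <= v%:E) ->
  (forall t, E t -> forall j : 'I_n.+1, j != ord0 -> Q j (tnth t j)) ->
  (forall t, exists W, [/\ measurable W, m W <= w%:E &
     forall x, E (set_coord t ord0 x) -> W x]) ->
  tuple_power m n.+1 E <= (v ^+ n * w)%:E.
Proof.
move=> w0 mE mQ Qv EQ EW; rewrite /= /tuple_cons_measure /image_measure /pushforward.
pose F := @tuple_cons _ T n @^-1` E.
have mF : measurable F by rewrite -[X in measurable X]setTI; exact: measurable_tuple_cons.
rewrite [leLHS]product_measure12//.
pose B := @box (fun j => Q j.+1) n.
have mB : measurable B by exact: measurable_box.
apply: (@le_trans _ _ (\int[tuple_power m n]_y (w%:E * (\1_B y)%:E))).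
  apply: ge0_le_integral => //=.
  - exact: measurable_fun_ysection.
  - apply/measurable_EFinP; apply: measurable_funM; first exact: measurable_cst.
    exact: measurable_indic.
  - move=> y _; have [[x0 Fx0]|F0] := pselect (exists x0, F (x0, y)); last first.
      rewrite (_ : ysection F y = set0) ?measure0 ?mule_ge0// ?lee_fin//.
      apply/seteqP; split=> x //=; rewrite /ysection/= inE => Fx.
      by apply: F0; exists x.
    have By : B y.
      move=> j; have := EQ _ Fx0 (lift ord0 j); rewrite tnthS; apply.
      by rewrite eq_sym neq_lift.
    rewrite indicE mem_set// mule1.
    have [W [mW Ww EWx]] := EW (tuple_cons (x0, y)).
    apply: le_trans Ww; apply: le_measure; rewrite ?inE//.
      exact: measurable_ysection.
    move=> x; rewrite /ysection/= inE => Fx; apply: EWx.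
    rewrite (_ : set_coord _ _ _ = tuple_cons (x, y))//.
    apply: eq_from_tnth => j; rewrite tnth_mktuple.
    by case: (unliftP ord0 j) => [k|] ->; rewrite ?eqxx ?tnth0// !tnthS.
rewrite ge0_integralZl_EFin//; last first.
  by apply/measurable_EFinP; exact: measurable_indic.
rewrite integral_indic// setIT mulrC EFinM lee_wpmul2l//.
exact: tuple_power_box_le.
Qed.

(** Fubini, one coordinate at a time: each coordinate other than [i] costs a
    factor [v], and [i] the factor [w] of its worst fibre. *)
Lemma tuple_power_fibre_le n (E : set (n.+1.-tuple T)) (Q : nat -> set T)
    (i : 'I_n.+1) (v w : R) :
  (0 <= w)%R -> measurable E ->
  (forall j, measurable (Q j)) -> (forall j, m (Q j) <= v%:E) ->
  (forall t, E t -> forall j : 'I_n.+1, j != i -> Q j (tnth t j)) ->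
  (forall t, exists W, [/\ measurable W, m W <= w%:E &
     forall x, E (set_coord t i x) -> W x]) ->
  tuple_power m n.+1 E <= (v ^+ n * w)%:E.
Proof.
move=> w0; elim: n E Q i => [|n IH] E Q i mE mQ Qv EQ EW.
  by rewrite (ord1 i) in EQ EW; exact: (@tuple_power_fibre0_le _ _ Q).
have [k|] := unliftP ord0 i; last first.
  by move=> i0; rewrite i0 in EQ EW; exact: (@tuple_power_fibre0_le _ _ Q).
move=> ik; rewrite {i}ik in EQ EW.
have v0 : (0 <= v)%R by rewrite -lee_fin (le_trans _ (Qv 0%N)).
rewrite [leLHS]/= /tuple_cons_measure /image_measure /pushforward.
pose F := @tuple_cons _ T n.+1 @^-1` E.
have mF : measurable F by rewrite -[X in measurable X]setTI; exact: measurable_tuple_cons.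
apply: (@le_trans _ _ (\int[m]_x ((v ^+ n * w)%:E * (\1_(Q 0%N) x)%:E))).
  apply: ge0_le_integral => //=.
  - exact: measurable_fun_xsection.
  - apply/measurable_EFinP; apply: measurable_funM; first exact: measurable_cst.
    exact: measurable_indic.
  - move=> x _; have [[y0 Fy0]|F0] := pselect (exists y0, F (x, y0)); last first.
      rewrite (_ : xsection F x = set0) ?measure0 ?mule_ge0// ?lee_fin//.
        by rewrite mulr_ge0 ?exprn_ge0.
      apply/seteqP; split=> y //=; rewrite /xsection/= inE => Fy.
      by apply: F0; exists y.
    have Qx : Q 0%N x.
      by have := EQ _ Fy0 ord0 (neq_lift _ _); rewrite tnth0.
    rewrite indicE mem_set// mule1.
    apply: (IH _ (fun j => Q j.+1) k) => //.
    + exact: measurable_xsection.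
    + move=> y; rewrite /xsection/= inE => Fy j jk.
      have := EQ _ Fy (lift ord0 j); rewrite tnthS; apply.
      by rewrite (inj_eq lift_inj).
    + move=> y; have [W [mW Ww EWx]] := EW (tuple_cons (x, y)).
      exists W; split=> // x'; rewrite /xsection/= inE => Fx; apply: EWx.
      rewrite (_ : set_coord _ _ _ = tuple_cons (x, set_coord y k x'))//.
      apply: eq_from_tnth => j; rewrite tnth_mktuple.
      case: (unliftP ord0 j) => [l|] ->; rewrite ?tnth0 ?tnthS//.
        by rewrite (inj_eq lift_inj) tnth_mktuple.
rewrite ge0_integralZl_EFin//; last 2 first.
- by apply/measurable_EFinP; exact: measurable_indic.
- by rewrite mulr_ge0 ?exprn_ge0.
rewrite integral_indic// setIT exprS -mulrA [in leRHS]mulrC [leRHS]EFinM.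
by rewrite lee_wpmul2l ?Qv ?lee_fin ?mulr_ge0 ?exprn_ge0.
Qed.

End tuple_fibres.

Section complex_measurable.
Context d (T : measurableType d) (R : realType).
Implicit Types (D : set T) (f g : T -> R[i]).

(** Measurability for the product sigma-algebra of the plane. *)
Definition cmeasurable D f :=
  measurable_fun D (fun x => complex.Re (f x) : measurableTypeR R) /\
  measurable_fun D (fun x => complex.Im (f x) : measurableTypeR R).

Lemma cmeasurable_cst D c : cmeasurable D (fun=> c).
Proof. by split; exact: measurable_cst. Qed.

Lemma cmeasurableD D f g : cmeasurable D f -> cmeasurable D g ->
  cmeasurable D (fun x => f x + g x).
Proof.
move=> [f1 f2] [g1 g2]; split.
  rewrite (_ : (fun _ => _) = fun x => complex.Re (f x) + complex.Re (g x)).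
    exact: measurable_funD.
  by apply/funext => x; case: (f x); case: (g x).
rewrite (_ : (fun _ => _) = fun x => complex.Im (f x) + complex.Im (g x)).
  exact: measurable_funD.
by apply/funext => x; case: (f x); case: (g x).
Qed.

Lemma cmeasurableM D f g : cmeasurable D f -> cmeasurable D g ->
  cmeasurable D (fun x => f x * g x).
Proof.
move=> [f1 f2] [g1 g2]; split.
  rewrite (_ : (fun _ => _) = fun x => complex.Re (f x) * complex.Re (g x) -
    complex.Im (f x) * complex.Im (g x)).
    by apply: measurable_funB; exact: measurable_funM.
  by apply/funext => x; case: (f x); case: (g x).
rewrite (_ : (fun _ => _) = fun x => complex.Re (f x) * complex.Im (g x) +
  complex.Im (f x) * complex.Re (g x)).
  by apply: measurable_funD; exact: measurable_funM.
by apply/funext => x; case: (f x); case: (g x).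
Qed.

Lemma cmeasurableX D f k : cmeasurable D f -> cmeasurable D (fun x => f x ^+ k).
Proof.
move=> mf; elim: k => [|k IH].
  rewrite (_ : (fun _ => _) = fun=> 1); first exact: cmeasurable_cst.
  by apply/funext => x; rewrite expr0.
rewrite (_ : (fun _ => _) = fun x => f x * f x ^+ k); first exact: cmeasurableM.
by apply/funext => x; rewrite exprS.
Qed.

Lemma cmeasurable_sum D (I : Type) (r : seq I) (F : I -> T -> R[i]) :
  (forall k, cmeasurable D (F k)) ->
  cmeasurable D (fun x => \sum_(k <- r) F k x).
Proof.
move=> mF; elim: r => [|k r IH].
  rewrite (_ : (fun _ => _) = fun=> 0); first exact: cmeasurable_cst.
  by apply/funext => x; rewrite big_nil.
rewrite (_ : (fun _ => _) = fun x => F k x + \sum_(k <- r) F k x).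
  exact: cmeasurableD.
by apply/funext => x; rewrite big_cons.
Qed.

Lemma cmeasurable_prod D (I : Type) (r : seq I) (F : I -> T -> R[i]) :
  (forall k, cmeasurable D (F k)) ->
  cmeasurable D (fun x => \prod_(k <- r) F k x).
Proof.
move=> mF; elim: r => [|k r IH].
  rewrite (_ : (fun _ => _) = fun=> 1); first exact: cmeasurable_cst.
  by apply/funext => x; rewrite big_nil.
rewrite (_ : (fun _ => _) = fun x => F k x * \prod_(k <- r) F k x).
  exact: cmeasurableM.
by apply/funext => x; rewrite big_cons.
Qed.

Lemma measurable_normc D f : cmeasurable D f ->
  measurable_fun D (fun x => normc (f x) : measurableTypeR R).
Proof.
move=> [f1 f2].
rewrite (_ : (fun _ => _) =
  fun x => (complex.Re (f x) ^+ 2 + complex.Im (f x) ^+ 2) `^ 2^-1).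
  apply: (@measurableT_comp _ _ _ _ _ _ (@powR R ^~ 2^-1)).
    exact: measurable_powR.
  by apply: measurable_funD; exact: measurable_funX.
apply/funext => x; case: (f x) => a b /=.
by rewrite powR12_sqrt// addr_ge0 ?sqr_ge0.
Qed.

End complex_measurable.

Section Cn_measurable.
Variables (R : realType) (n : nat).

Lemma cmeasurable_coord i : cmeasurable setT (fun z : 'rV[R[i]]_n => z 0 i).
Proof.
have mi : measurable_fun setT (fun z : 'rV[R[i]]_n => tnth (to_coords z) i).
  apply: (@measurableT_comp _ _ _ _ _ _ (fun t => tnth t i)).
    exact: measurable_tnth.
  exact: measurable_to_coords.
split.
  rewrite (_ : (fun _ => _) = fst \o (fun z => tnth (to_coords z) i)).
    exact: measurableT_comp.
  by apply/funext => z /=; rewrite tnth_mktuple.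
rewrite (_ : (fun _ => _) = snd \o (fun z => tnth (to_coords z) i)).
  exact: measurableT_comp.
by apply/funext => z /=; rewrite tnth_mktuple.
Qed.

Lemma dotmxE_sum (z a : 'rV[R[i]]_n) : dotmx z a = \sum_i z 0 i * (a 0 i)^*.
Proof. by rewrite dotmxE mxE; apply: eq_bigr => i _; rewrite !mxE. Qed.

Lemma measurable_1Bdot (a : 'rV[R[i]]_n) :
  measurable_fun setT (fun z => normc (1 - dotmx z a) : measurableTypeR R).
Proof.
apply: measurable_normc.
rewrite (_ : (fun _ => _) = fun z : 'rV[R[i]]_n => 1 + (- 1) * \sum_i z 0 i * (a 0 i)^*).
  apply: cmeasurableD; first exact: cmeasurable_cst.
  apply: cmeasurableM; first exact: cmeasurable_cst.
  apply: cmeasurable_sum => i; apply: cmeasurableM; last exact: cmeasurable_cst.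
  exact: cmeasurable_coord.
by apply/funext => z; rewrite dotmxE_sum mulN1r.
Qed.

End Cn_measurable.

(** * Spherical caps *)

Section squares.
Variable R : realType.
Local Notation plane := (measurableTypeR R * measurableTypeR R)%type.

Definition square (c : plane) (h : R) : set plane :=
  [set` `[c.1 - h, c.1 + h]] `*` [set` `[c.2 - h, c.2 + h]].

Lemma measurable_square c h : measurable (square c h).
Proof. by apply: measurableX; exact: measurable_itv. Qed.

Lemma plane_measure_square c h : 0 <= h ->
  plane_measure (square c h) = ((2 * h) ^+ 2)%:E.
Proof.
move=> h0; rewrite [LHS]product_measure1E ?measurable_itv//.
rewrite /= !lebesgue_measure_itv/= !lte_fin !ltrD2l.
have [h1|h1] := ltP (- h) h.
  by rewrite -!EFinD -EFinM; congr EFin; ring.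
have -> : h = 0 by lra.
by rewrite mul0e mulr0 expr0n.
Qed.

Lemma squareP (c x : plane) h :
  normc ((x.1 +i* x.2) - (c.1 +i* c.2)) <= h -> square c h x.
Proof.
move=> H.
have h0 : 0 <= h by rewrite (le_trans _ H)// normc_ge0.
have /= N := normc_sqr ((x.1 +i* x.2) - (c.1 +i* c.2)).
have H2 : normc ((x.1 +i* x.2) - (c.1 +i* c.2)) ^+ 2 <= h ^+ 2.
  by rewrite lerXn2r ?nnegrE ?normc_ge0.
rewrite N in H2.
split; rewrite /= in_itv/= -ler_distlC.
  rewrite -(@ler_pXn2r _ 2)// ?nnegrE// real_normK ?num_real//.
  by rewrite -sqrrN opprB; apply: le_trans H2; rewrite lerDl sqr_ge0.
rewrite -(@ler_pXn2r _ 2)// ?nnegrE// real_normK ?num_real//.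
by rewrite -sqrrN opprB; apply: le_trans H2; rewrite lerDr sqr_ge0.
Qed.

End squares.

Section cap.
Variables (R : realType) (n : nat).
Implicit Types (z a : 'rV[R[i]]_n.+1).
Local Notation plane := (measurableTypeR R * measurableTypeR R)%type.

Lemma measurable_cap a (t : R) :
  measurable [set w | normc (1 - dotmx w a) < t].
Proof.
rewrite (_ : [set w | _] = setT `&`
   (fun z => normc (1 - dotmx z a)) @^-1` `]-oo, t[).
  exact: measurable_1Bdot.
by rewrite setTI; apply/seteqP; split=> z /=; rewrite in_itv.
Qed.

(** The cone over a cap of size [t], cut by the shell of width [t]: in this
    region [<z, a>] varies by [O(t)] in both real directions, while on the
    sphere its real part may vary by more. *)
Definition solid_cap a (t : R) : set 'rV[R[i]]_n.+1 :=
  @radial R n.+1 @^-1` [set w | normc (1 - dotmx w a) < t] `&` shell (1 - t) 1.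

(** All three follow from [Re <xi, a> > 1 - t], where [xi] is the direction of
    [z]; the first one expands [|z - a|^2]. *)
Lemma solid_capP a t z : nrm a <= 1 -> 0 < t -> t <= 2^-1 -> solid_cap a t z ->
  [/\ nrm (z - a) ^+ 2 <= 4 * t, normc (1 - dotmx z a) <= 2 * t &
      2^-1 <= nrm a].
Proof.
move=> a1 t0 t1 [/= zt]; rewrite /shell/= => /andP[tz z1].
set w := dotmx (radial z) a in zt; set r := nrm z in tz z1 *.
have r0 : 0 <= r by exact: nrm_ge0.
have zw : dotmx z a = r%:C * w by rewrite -[in LHS](radialK z) linearZl_LR.
have wa : normc w <= nrm a.
  by rewrite (le_trans (normc_dotmx_le _ _))// ler_piMl ?nrm_ge0// nrm_radial_le1.
have w1 : 1 - t <= complex.Re w.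
  have := normc_geRe (1 - w); case: (w) zt => x y /=; lra.
have wRe := normc_geRe w.
split.
- rewrite nrm_sqrB zw -/r.
  have -> : complex.Re (r%:C * w) = r * complex.Re w.
    by case: (w) => x y /=; rewrite mul0r subr0.
  have := nrm_ge0 a; move: (nrm a) (complex.Re w) a1 w1 => A W a1 w1 A0; nra.
- rewrite zw.
  have -> : 1 - r%:C * w = (1 - w) + (1 - r)%:C * w.
    by rewrite rmorphB/= rmorph1; ring.
  rewrite (le_trans (le_normcD _ _))// ComplexField.Normc.normcM normc_real.
  rewrite ger0_norm ?subr_ge0; last exact: ltW.
  have := normc_ge0 w; move: (normc w) (normc _) wa zt => W V wa zt W0; nra.
- lra.
Qed.

(** Slice along the largest coordinate [i] of [a]. The other coordinates lie in
    squares of area [O(t)] about those of [a]; when they are fixed, [<z, a>] is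
    affine in [z_i] with slope of modulus at least [1 / (2 sqrt n)], which
    leaves [z_i] a square of area [O(t^2)]. *)
Lemma volume_solid_cap a t : nrm a <= 1 -> 0 < t -> t <= 2^-1 ->
  (volume (solid_cap a t) <=
   ((16 * t) ^+ n * (16 ^+ 2 * n.+1%:R * t ^+ 2))%:E)%E.
Proof.
move=> a1 t0 t1.
have mE : measurable (solid_cap a t).
  apply: measurableI; last exact: measurable_shell.
  by apply: measurable_cone; exact: measurable_cap.
have w0 : 0 <= 16 ^+ 2 * n.+1%:R * t ^+ 2.
  by apply: mulr_ge0 (sqr_ge0 t); apply: mulr_ge0 (ler0n _ _); exact: sqr_ge0.
have [[z0 Ez0]|E0] := pselect (exists z, solid_cap a t z); last first.
  rewrite (_ : solid_cap a t = set0) ?measure0 ?lee_fin.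
    by rewrite mulr_ge0// exprn_ge0// mulr_ge0// ltW.
  by apply/seteqP; split=> z //= Ez; apply: E0; exists z.
have [_ _ a2] := solid_capP a1 t0 t1 Ez0.
have [i ai] := ex_coord_ge a (ltn0Sn n).
have ai2 : 1 <= 4 * n.+1%:R * normc (a 0 i) ^+ 2.
  by rewrite -mulrA; move: ai a2; set X := _ * _; have := nrm_ge0 a; nra.
have ai0 : 0 < normc (a 0 i).
  rewrite lt_def normc_ge0 andbT; apply/eqP => h.
  by move: ai2; rewrite h expr0n/= mulr0 ler10.
pose Q (j : nat) : set plane := if insub j is Some k then
   square (complex.Re (a 0 k), complex.Im (a 0 k)) (2 * Num.sqrt t) else set0.
have st0 : 0 <= 2 * Num.sqrt t by rewrite mulr_ge0// sqrtr_ge0.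
rewrite /volume /image_measure /pushforward.
apply: (@tuple_power_fibre_le _ _ _ _ _ _ Q i) => //.
- by rewrite -[X in measurable X]setTI; exact: measurable_of_coords.
- by move=> j; rewrite /Q; case: insubP => // *; exact: measurable_square.
- move=> j; rewrite /Q; case: insubP => [k _ _|_]; last first.
    by rewrite measure0 lee_fin mulr_ge0// ltW.
  rewrite [leLHS]plane_measure_square// lee_fin !exprMn sqr_sqrtr ?(ltW t0)//.
  by lra.
- move=> x Ex j _; have [h _ _] := solid_capP a1 t0 t1 Ex.
  rewrite /Q valK; apply: squareP.
  have := normc_coord_le (of_coords x - a) j; rewrite !mxE => h1.
  have -> : (complex.Re (a 0 j) +i* complex.Im (a 0 j)) = a 0 j by case: (a 0 j).
  apply: (le_trans h1).
  rewrite -(@ler_pXn2r _ 2)// ?nnegrE ?nrm_ge0// (le_trans h)//.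
  by rewrite exprMn sqr_sqrtr ?(ltW t0)//; lra.
- move=> x.
  have [[x0 Ex0]|Ex0] := pselect (exists x0, solid_cap a t (of_coords (set_coord x i x0))); last first.
    exists set0; split; [exact: measurable0|by rewrite measure0 lee_fin|].
    by move=> x1 Ex1; apply: Ex0; exists x1.
  exists (square x0 (4 * t / normc (a 0 i))); split.
  + exact: measurable_square.
  + have h0 : 0 <= 4 * t / normc (a 0 i) by rewrite divr_ge0 ?normc_ge0// mulr_ge0// ltW.
    rewrite [leLHS]plane_measure_square// lee_fin.
    rewrite mulrA exprMn exprVn ler_pdivrMr ?exprn_gt0//.
    by move: (normc _ ^+ 2) ai2 (sqr_ge0 t) => X; rewrite exprMn; nra.
  + move=> x1 Ex1; apply: squareP.
    have [_ h1 _] := solid_capP a1 t0 t1 Ex1.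
    have [_ h0 _] := solid_capP a1 t0 t1 Ex0.
    rewrite ler_pdivlMr//.
    have aJ : normc (a 0 i) = normc (a 0 i)^* by case: (a 0 i) => u v /=; rewrite sqrrN.
    rewrite aJ -ComplexField.Normc.normcM.
    have -> : (x1.1 +i* x1.2 - x0.1 +i* x0.2) * (a 0 i)^* =
      (1 - dotmx (of_coords (set_coord x i x0)) a) -
      (1 - dotmx (of_coords (set_coord x i x1)) a).
      rewrite !dotmxE_sum !(bigD1 (P := xpredT) i)//= !mxE !tnth_mktuple eqxx.
      rewrite (eq_bigr (fun j => of_coords x 0 j * (a 0 j)^*)); last first.
        by move=> j ji; rewrite !mxE tnth_mktuple (negbTE ji).
      rewrite [in X in _ = _ - X](eq_bigr (fun j => of_coords x 0 j * (a 0 j)^*)); last first.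
        by move=> j ji; rewrite !mxE tnth_mktuple (negbTE ji).
      by ring.
    move: (dotmx _ a) (dotmx _ a) h0 h1 => u v hu hv.
    by rewrite (le_trans (le_normcD _ _))// normcN; lra.
Qed.

(** Cap estimate: the cone over a cap of size [t] occupies in the shell of
    width [t] the same proportion, at least [t], as everywhere else. *)
Lemma sigma_cap : exists2 C : R, 0 <= C & forall a t, nrm a <= 1 -> 0 < t ->
  (sigma ([set w | normc (1 - dotmx w a) < t])%R <= (C * t ^+ n.+1)%:E)%E.
Proof.
pose c := (fine (volume (@Bn R n.+1)))^-1.
have c0 : 0 <= c by exact: inv_volume_Bn_ge0.
pose S := fine (@sigma R n.+1 setT).
have S0 : 0 <= S by apply: fine_ge0; exact: measure_ge0.
exists (c * 16 ^+ n * 16 ^+ 2 * n.+1%:R + S * 2 ^+ n.+1).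
  by rewrite addr_ge0 ?mulr_ge0// exprn_ge0.
move=> a t a1 t0; set A := [set w | _].
have mA : measurable A by exact: measurable_cap.
have tn0 : 0 < t ^+ n.+1 by rewrite exprn_gt0.
have [t1|t1] := leP t 2^-1; last first.
  apply: (@le_trans _ _ (@sigma R n.+1 setT)).
    by apply: le_measure; rewrite ?inE.
  rewrite -[leLHS]fineK ?sigma_fin_num// lee_fin -/S mulrDl -[X in _ + X]mulrA -exprMn.
  have h1 : 1 <= (2 * t) ^+ n.+1 by rewrite exprn_ege1//; lra.
  have h2 : 0 <= c * 16 ^+ n * 16 ^+ 2 * n.+1%:R * t ^+ n.+1.
    by rewrite !mulr_ge0// ?exprn_ge0// ltW.
  by move: h1 h2; set X := _ ^+ _; set Y := _ * _ * t ^+ _; nra.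
have r12 : 0 <= 1 - t <= 1 by apply/andP; split; lra.
have H := @dV_shell R n.+1 (ltn0Sn n) (1 - t) 1 A r12 (lexx 1) mA.
have U : (dV (@radial R n.+1 @^-1` A `&` shell (1 - t) 1) <=
   (c * ((16 * t) ^+ n * (16 ^+ 2 * n.+1%:R * t ^+ 2)))%:E)%E.
  rewrite dVE EFinM; apply: lee_wpmul2l; first by rewrite lee_fin.
  apply: le_trans (volume_solid_cap a1 t0 t1).
  apply: le_measure; rewrite ?inE.
  - apply: measurableI; last exact: measurable_Bn.
    by apply: measurableI; [exact: measurable_cone|exact: measurable_shell].
  - by apply: measurableI; [exact: measurable_cone|exact: measurable_shell].
  - by move=> z [].
rewrite H in U; rewrite [sigma A](_ : _ = dV (@radial R n.+1 @^-1` A))//.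
have /fineK E := dV_fin_num (measurable_cone mA).
rewrite -E -EFinM lee_fin expr1n in U; rewrite -E lee_fin.
set s := fine _ in U *.
have s0 : 0 <= s by apply: fine_ge0; exact: measure_ge0.
have tt : t <= 1 - (1 - t) ^+ (2 * n.+1).
  rewrite mulnS exprS -[X in X - _]mulr1.
  have : (1 - t) ^+ (1 + 2 * n) <= 1 by rewrite exprn_ile1//; lra.
  by move: (_ ^+ (1 + _)) => X X1; nra.
have : t * s <= t * (c * 16 ^+ n * 16 ^+ 2 * n.+1%:R * t ^+ n.+1).
  apply: (@le_trans _ _ ((1 - (1 - t) ^+ (2 * n.+1)) * s)).
    by rewrite ler_wpM2r.
  apply: (le_trans U); rewrite exprMn (exprS t n) le_eqVlt; apply/orP; left.
  by apply/eqP; ring.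
rewrite ler_pM2l// => h; rewrite (le_trans h)// mulrDl lerDl.
by rewrite !mulr_ge0// ?exprn_ge0// ltW.
Qed.

End cap.

(** * The Moebius weight *)

Section series.
Variable R : realType.

Lemma nneseries_le (u : nat -> \bar R) (B : \bar R) :
  (forall j, 0 <= u j)%E -> (forall m, \sum_(0 <= j < m) u j <= B)%E ->
  (\sum_(0 <= j <oo) u j <= B)%E.
Proof.
move=> u0 uB; apply: lime_le; first by apply: is_cvg_nneseries => j _ _; exact: u0.
by apply: nearW => m; exact: uB.
Qed.


Lemma sum_geometric_le (x : R) m : 0 <= x < 1 ->
  \sum_(0 <= j < m) x ^+ j <= (1 - x)^-1.
Proof.
move=> /andP[x0 x1]; have d0 : 0 < 1 - x by rewrite subr_gt0.
rewrite -(@ler_pM2l _ (1 - x))// mulfV ?gt_eqF//.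
have -> : (1 - x) * \sum_(0 <= j < m) x ^+ j = 1 - x ^+ m.
  by rewrite big_mkord -[RHS]opprB subrX1 -mulNr opprB.
by rewrite gerBl exprn_ge0.
Qed.

Lemma nneseries_geometric_le (x : R) : 0 <= x < 1 ->
  (\sum_(0 <= j <oo) (x ^+ j)%:E <= ((1 - x)^-1)%:E)%E.
Proof.
move=> x01; apply: nneseries_le => [j|m].
  by rewrite lee_fin exprn_ge0//; case/andP : x01.
by rewrite sumEFin lee_fin sum_geometric_le.
Qed.

Lemma dyadic_bracket (d y : R) : 0 < d -> d <= y ->
  exists j, 2 ^+ j * d <= y < 2 ^+ j.+1 * d.
Proof.
move=> d0 dy.
have exP : exists j, y < 2 ^+ j.+1 * d.
  exists (Num.truncn (y / d)); rewrite -ltr_pdivrMr//.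
  rewrite (lt_le_trans (truncnS_gt _))// -natrX ler_nat.
  by rewrite ltnW// ltn_expl.
case: (ex_minnP exP) => j jP jmin; exists j; rewrite jP andbT.
case: j jP jmin => [|j] jP jmin; first by rewrite expr0 mul1r.
by rewrite leNgt; apply/negP => /jmin; rewrite ltnn.
Qed.

End series.

Section kernel.
Variables (R : realType) (n : nat).
Implicit Types (z a : 'rV[R[i]]_n.+1).
Local Notation N := n.+1.

Lemma nrm_lt1 z : Bn z = (nrm z < 1). Proof. by rewrite /Bn/= -nrmE. Qed.

(** Where [|1 - <w, a>|] is about [2 ^ j d], with [d = 1 - |a|], the integrand
    is about [(2 ^ j d) ^ - 2N] on a set of measure [O((2 ^ j d) ^ N)]; these
    contributions form a geometric series led by [d ^ - N]. *)
Lemma sigma_kernel : exists2 C : R, 0 <= C & forall a, nrm a < 1 ->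
  (\int[@sigma R N]_w ((normc (1 - dotmx w a))%R ^- (2 * N))%:E <=
   (C * (1 - nrm a) ^- N)%:E)%E.
Proof.
have [C C0 capC] := sigma_cap R n.
exists (2 * (C * 2 ^+ N)); first by rewrite !mulr_ge0// exprn_ge0.
move=> a a1; set d := 1 - nrm a; have d0 : 0 < d by rewrite subr_gt0.
pose A (j : nat) := [set w : 'rV[R[i]]_N | normc (1 - dotmx w a) < 2 ^+ j.+1 * d].
have mA j : measurable (A j) by exact: measurable_cap.
pose c (j : nat) := (2 ^+ j * d) ^- (2 * N).
have c0 j : 0 <= c j by rewrite invr_ge0 exprn_ge0// mulr_ge0 ?exprn_ge0// ltW.
have mg : measurable_fun setT
    (fun w : 'rV[R[i]]_N => ((normc (1 - dotmx w a))%R ^- (2 * N))%:E).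
  apply/measurable_EFinP.
  rewrite (_ : (fun _ => _) =
    fun w : 'rV[R[i]]_N => normc (1 - dotmx w a) `^ (- (2 * N)%:R)).
    apply: (@measurableT_comp _ _ _ _ _ _ (@powR R ^~ (- (2 * N)%:R))).
      exact: measurable_powR.
    exact: measurable_1Bdot.
  by apply/funext => w; rewrite powR_invn// normc_ge0.
have mAj j : measurable_fun setT (fun w => ((c j)%:E * (\1_(A j) w)%:E)%E).
  apply/measurable_EFinP; apply: measurable_funM; first exact: measurable_cst.
  exact: measurable_indic.
rewrite /sigma /image_measure (ge0_integral_pushforward (@measurable_radial R N) _ measurableT)//; last first.
  by move=> w _; rewrite lee_fin invr_ge0 exprn_ge0// normc_ge0.
rewrite preimage_setT.
apply: (@le_trans _ _ (\int[@dV R N]_z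
    \sum_(0 <= j <oo) ((c j)%:E * (\1_(A j) (radial z))%:E))%E).
  apply: ge0_le_integral; first exact: measurableT.
  - by move=> z _; rewrite lee_fin invr_ge0 exprn_ge0// normc_ge0.
  - by apply: measurableT_comp mg _; exact: measurable_radial.
  - apply: ge0_emeasurable_sum => [j z _ _|j _]; first by rewrite mule_ge0// lee_fin.
    by apply: measurableT_comp (mAj j) _; exact: measurable_radial.
  - move=> z _; rewrite /comp; set y := normc (1 - dotmx (radial z) a).
    have dy : d <= y by exact: normc_1Bdot_ger (nrm_radial_le1 z).
    have [j /andP[j1 j2]] := dyadic_bracket d0 dy.
    apply: le_trans (nneseries_lim_ge j.+1 _); last first.
      by move=> k _ _; rewrite mule_ge0// lee_fin.
    rewrite big_nat_recr//= -[leLHS]add0e; apply: leeD.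
      by apply: sume_ge0 => k _; rewrite mule_ge0// lee_fin.
    rewrite indicE mem_set ?mule1 ?lee_fin//.
    rewrite lef_pV2 ?posrE ?exprn_gt0 ?mulr_gt0 ?exprn_gt0//.
      by rewrite lerXn2r ?nnegrE ?mulr_ge0 ?exprn_ge0 ?normc_ge0// ltW.
    by rewrite (lt_le_trans d0).
rewrite integral_nneseries; last 3 first.
- exact: measurableT.
- by move=> j; apply: measurableT_comp (mAj j) _; exact: measurable_radial.
- by move=> j z _; rewrite mule_ge0// lee_fin.
apply: (@le_trans _ _ (\sum_(0 <= j <oo)
   ((C * 2 ^+ N * d ^- N)%:E * (2^-1 ^+ j)%:E))%E).
  apply: lee_nneseries => [j _ _|j _].
    by apply: integral_ge0 => z _; rewrite mule_ge0// lee_fin.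
  have -> : (\int[@dV R N]_z ((c j)%:E * (\1_(A j) (radial z))%:E) =
    (c j)%:E * sigma (A j))%E.
    rewrite ge0_integralZl_EFin//; last first.
      apply/measurable_EFinP; apply: measurableT_comp; first exact: measurable_indic.
      exact: measurable_radial.
    congr (_ * _)%E.
    rewrite (_ : (fun z => _) = fun z => (\1_(@radial R N @^-1` A j) z)%:E)//.
    by rewrite integral_indic ?setIT//; exact: measurable_cone.
  have t0 : 0 < 2 ^+ j.+1 * d by rewrite mulr_gt0// exprn_gt0.
  apply: (@le_trans _ _ ((c j)%:E * (C * (2 ^+ j.+1 * d) ^+ N)%:E)%E).
    by apply: lee_wpmul2l; [rewrite lee_fin|exact: capC (ltW a1) t0].
  rewrite -!EFinM lee_fin /c.
  have -> : (2 ^+ j * d) ^- (2 * N) * (C * (2 ^+ j.+1 * d) ^+ N) =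
     C * 2 ^+ N * d ^- N * (2^-1 ^+ j) ^+ N.
    rewrite (exprS 2 j) !exprMn (mulnC 2 N) !exprM exprVn.
    have p0 : (2 ^+ j) ^+ N != 0 :> R by rewrite expf_neq0// expf_neq0.
    have q0 : d ^+ N != 0 by rewrite expf_neq0// gt_eqF.
    have -> : (2 ^+ j)^-1 ^+ N = ((2 ^+ j) ^+ N)^-1 :> R by rewrite exprVn.
    move: ((2 ^+ j) ^+ N) (d ^+ N) (2 ^+ N) p0 q0 => P Q S P0 Q0; field.
    by rewrite P0 Q0.
  apply: ler_wpM2l.
    by rewrite !mulr_ge0// ?invr_ge0 ?exprn_ge0// ltW.
  have h0 : 0 <= 2^-1 ^+ j :> R by rewrite exprn_ge0.
  have h1 : 2^-1 ^+ j <= 1 :> R by rewrite exprn_ile1//; lra.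
  by rewrite exprS ler_piMr// exprn_ile1.
rewrite nneseriesZl; last by move=> j _; rewrite lee_fin exprn_ge0.
apply: (@le_trans _ _ ((C * 2 ^+ N * d ^- N)%:E * 2%:E)%E).
  apply: lee_wpmul2l.
    by rewrite lee_fin !mulr_ge0// ?invr_ge0 ?exprn_ge0// ltW.
  have -> : 2%:E = ((1 - 2^-1)^-1)%:E :> \bar R by congr EFin; field.
  by apply: nneseries_geometric_le; apply/andP; split; lra.
rewrite -EFinM lee_fin -/d le_eqVlt; apply/orP; left; apply/eqP.
by ring.
Qed.


(** By [one_minus_Phi] this is [(1 - |Phi_a z|^2) / (1 - |z|^2)]. *)
Definition Mobius_weight a z : R :=
  (1 - nrm a ^+ 2) / normc (1 - dotmx z a) ^+ 2.

Lemma Mobius_weight_ge0 a z : nrm a < 1 -> 0 <= Mobius_weight a z.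
Proof.
move=> a1; rewrite divr_ge0 ?exprn_ge0 ?normc_ge0// subr_ge0.
by rewrite exprn_ile1 ?nrm_ge0// ltW.
Qed.

Let powR_le_1D (W T s : R) : 0 <= W -> W <= T -> 0 <= s <= 1 ->
  W `^ (N%:R * s) <= 1 + T ^+ N.
Proof.
move=> W0 WT /andP[s0 s1]; have T0 : 0 <= T by exact: le_trans WT.
have N0 : 0 <= N%:R :> R by [].
have [W1|W1] := leP W 1.
  rewrite (@le_trans _ _ 1)//; last by rewrite lerDl exprn_ge0.
  have E1 : 1 `^ (N%:R * s) = 1 :> R by rewrite powR1.
  rewrite -[leRHS]E1; apply: ge0_ler_powR => //; rewrite ?nnegrE//.
  exact: mulr_ge0.
apply: (@le_trans _ _ (W ^+ N)).
  by rewrite -powR_mulrn//; apply: (ler_powR (ltW W1)); rewrite ler_piMr.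
by rewrite (@le_trans _ _ (T ^+ N))// ?lerDr// lerXn2r.
Qed.

Let weight_aux (x y r : R) : 0 <= r -> r < 1 -> y <= 2 * x -> 0 < x -> 0 < y ->
  (1 - r ^+ 2) / x ^+ 2 <= 8 * (1 - r) / y ^+ 2.
Proof.
move=> r0 r1 h1 h2 h3.
rewrite ler_pdivrMr ?exprn_gt0// mulrAC ler_pdivlMr ?exprn_gt0//.
have h5 : y ^+ 2 <= 4 * x ^+ 2 by nra.
have h4 : 1 - r ^+ 2 <= 2 * (1 - r) by nra.
apply: (@le_trans _ _ (2 * (1 - r) * y ^+ 2)).
  by rewrite ler_wpM2r// sqr_ge0.
have : 0 <= 1 - r by rewrite subr_ge0 ltW.
move: (y ^+ 2) (x ^+ 2) (1 - r) h5 => Y X D h5 D0; nra.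
Qed.

Lemma Mobius_weight_radial a z : nrm a < 1 -> nrm z <= 1 ->
  Mobius_weight a z <= 8 * (1 - nrm a) / normc (1 - dotmx (radial z) a) ^+ 2.
Proof.
move=> a1 z1; have h1 := normc_1Bdot_radial z1 (ltW a1).
have d0 : 0 < 1 - nrm a by rewrite subr_gt0.
have h2 := lt_le_trans d0 (normc_1Bdot_ger a z1).
have h3 := lt_le_trans d0 (normc_1Bdot_ger a (nrm_radial_le1 z)).
exact: weight_aux (nrm_ge0 a) a1 h1 h2 h3.
Qed.

Lemma measurable_Mobius_weight a (s : R) : nrm a < 1 ->
  measurable_fun setT (fun z => Mobius_weight a z `^ s : measurableTypeR R).
Proof.
move=> a1; apply: (@measurableT_comp _ _ _ _ _ _ (@powR R ^~ s)).
  exact: measurable_powR.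
apply: measurable_funM; first exact: measurable_cst.
rewrite (_ : (fun _ => _) =
    fun w : 'rV[R[i]]_N => normc (1 - dotmx w a) `^ (- 2%:R)).
  apply: (@measurableT_comp _ _ _ _ _ _ (@powR R ^~ (- 2%:R))).
    exact: measurable_powR.
  exact: measurable_1Bdot.
by apply/funext => w; rewrite powR_invn// normc_ge0.
Qed.

(** As [x ^ s <= 1 + x] for [0 <= s <= 1], only the exponent [s = 1] needs an
    estimate, and there the radial comparison reduces to the sphere. *)
Lemma integral_Mobius_weight (s : R) : 0 <= s <= 1 ->
  exists2 C : R, 0 <= C & forall a r1 r2, nrm a < 1 -> 0 <= r1 <= r2 -> r2 <= 1 ->
  (\int[@dV R N]_(z in shell r1 r2) (Mobius_weight a z `^ (N%:R * s))%:E <=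
   (C * (r2 ^+ (2 * N) - r1 ^+ (2 * N)))%:E)%E.
Proof.
move=> /andP[s0 s1]; have [K K0 HK] := sigma_kernel.
pose S := fine (@sigma R N setT).
have S0 : 0 <= S by apply: fine_ge0; exact: measure_ge0.
exists (S + 8 ^+ N * K); first by rewrite addr_ge0// mulr_ge0// exprn_ge0.
move=> a r1 r2 a1 r12 r21; set d := 1 - nrm a; have d0 : 0 < d by rewrite subr_gt0.
have c0 : 0 <= r2 ^+ (2 * N) - r1 ^+ (2 * N).
  move: r12 => /andP[h1 h2]; rewrite subr_ge0 lerXn2r ?nnegrE//.
  exact: le_trans h2.
pose k (w : 'rV[R[i]]_N) := normc (1 - dotmx w a) ^- (2 * N).
have k0 w : 0 <= k w by rewrite invr_ge0 exprn_ge0// normc_ge0.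
have mk : measurable_fun setT (fun w => (k w)%:E).
  apply/measurable_EFinP; rewrite /k.
  rewrite (_ : (fun _ => _) =
    fun w : 'rV[R[i]]_N => normc (1 - dotmx w a) `^ (- (2 * N)%:R)).
    apply: (@measurableT_comp _ _ _ _ _ _ (@powR R ^~ (- (2 * N)%:R))).
      exact: measurable_powR.
    exact: measurable_1Bdot.
  by apply/funext => w; rewrite powR_invn// normc_ge0.
pose g (w : 'rV[R[i]]_N) := (1%:E + (8 ^+ N * d ^+ N)%:E * (k w)%:E)%E.
have e0 : 0 <= 8 ^+ N * d ^+ N by rewrite mulr_ge0 ?exprn_ge0// ltW.
have g0 w : (0 <= g w)%E by rewrite /g -EFinM lee_fin addr_ge0// mulr_ge0.
have mg2 : measurable_fun setT (fun w => (8 ^+ N * d ^+ N)%:E * (k w)%:E)%E.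
  by apply: measurable_funeM.
have mg : measurable_fun setT g by apply: emeasurable_funD.
apply: (@le_trans _ _ (\int[@dV R N]_(z in shell r1 r2) g (radial z))%E).
  apply: ge0_le_integral; first exact: measurable_shell.
  - by move=> z _; rewrite lee_fin powR_ge0.
  - apply/measurable_EFinP; apply: (measurable_funS measurableT (@subsetT _ _)).
    exact: measurable_Mobius_weight.
  - apply: (measurable_funS measurableT (@subsetT _ _)).
    by apply: measurableT_comp mg _; exact: measurable_radial.
  - move=> z; rewrite /shell/= => /andP[_ zr].
    have z1 : nrm z <= 1 by rewrite ltW// (lt_le_trans zr).
    rewrite /g /k -EFinM -EFinD lee_fin.
    have E (y : R) : 8 ^+ N * d ^+ N * y ^- (2 * N) = (8 * d / y ^+ 2) ^+ N.
      by rewrite !exprMn exprVn exprM.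
    rewrite E; apply: powR_le_1D; last by rewrite s0.
    - exact: Mobius_weight_ge0.
    - exact: Mobius_weight_radial.
rewrite (ge0_integral_shell_radial (ltn0Sn n) r12 r21 mg g0) mulrC EFinM.
apply: lee_wpmul2l; first by rewrite lee_fin.
rewrite /g ge0_integralD//; last first.
  by move=> w _; rewrite -EFinM lee_fin mulr_ge0.
rewrite integral_cst// mul1e EFinD -[X in (X + _)%E]fineK ?sigma_fin_num//.
apply: leeD => //.
rewrite ge0_integralZl_EFin//; last by move=> w _; rewrite lee_fin.
apply: (@le_trans _ _ ((8 ^+ N * d ^+ N)%:E * (K * d ^- N)%:E)%E).
  by apply: lee_wpmul2l; [rewrite lee_fin|exact: HK].
rewrite -EFinM lee_fin le_eqVlt; apply/orP; left; apply/eqP.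
have : d ^+ N != 0 by rewrite expf_neq0// gt_eqF.
by move: (d ^+ N) => D D0; field.
Qed.

End kernel.

(** * Hadamard gaps and dyadic blocks *)

Section gaps.
Variables (R : realType) (nn : nat -> nat).
Hypothesis gaps : exists2 c : R, 1 < c & forall k, c <= (nn k.+1)%:R / (nn k)%:R.

Definition in_block (k j : nat) := (2 ^ k <= nn j < 2 ^ k.+1)%N.

Definition block j := trunc_log 2 (nn j).

Lemma gaps_gt0 j : (0 < nn j)%N.
Proof.
have [c c1 h] := gaps; have := h j; rewrite lt0n; apply: contraTneq => ->.
by rewrite invr0 mulr0 -ltNge (lt_trans ltr01).
Qed.

Lemma gaps_ltn j : (nn j < nn j.+1)%N.
Proof.
have [c c1 h] := gaps; have := h j.
rewrite ler_pdivlMr ?ltr0n ?gaps_gt0// => h'; rewrite -(@ltr_nat R).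
apply: lt_le_trans h'; rewrite -[ltLHS]mul1r ltr_pM2r// ltr0n; exact: gaps_gt0.
Qed.

Lemma gaps_homo i j : (i <= j)%N -> (nn i <= nn j)%N.
Proof. by apply: (@homo_leq _ nn leq) => //; [exact: leq_trans|move=> k; exact/ltnW/gaps_ltn]. Qed.

(** [nn (j + L) >= c ^ L * nn j], and [c ^ L >= 2] for large [L]. *)
Lemma gaps_double : exists L, forall j, (2 * nn j <= nn (j + L))%N.
Proof.
have [c c1 h] := gaps.
have H L j : c ^+ L * (nn j)%:R <= (nn (j + L))%:R :> R.
  elim: L => [|L IH]; first by rewrite expr0 mul1r addn0.
  rewrite addnS exprS -mulrA; apply: (@le_trans _ _ (c * (nn (j + L))%:R)).
    by rewrite ler_wpM2l// (le_trans ler01)// ltW.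
  by have := h (j + L)%N; rewrite ler_pdivlMr ?ltr0n ?gaps_gt0.
have c0 : 0 < c - 1 by rewrite subr_gt0.
have [L HL] : exists L, 2 <= c ^+ L.
  have B L : 1 + L%:R * (c - 1) <= c ^+ L.
    elim: L => [|L IH]; first by rewrite mul0r addr0 expr0.
    rewrite exprS -natr1; apply: (@le_trans _ _ (c * (1 + L%:R * (c - 1)))).
      have : 0 <= L%:R :> R by [].
      by move: (L%:R) => l l0; have := mulr_ge0 l0 (sqr_ge0 (c - 1)); nra.
    by rewrite ler_wpM2l// (le_trans ler01)// ltW.
  exists (Num.truncn (c - 1)^-1).+1; apply: le_trans (B _).
  rewrite -[leLHS](_ : 1 + 1 = _)// lerD2l -ler_pdivrMr// mul1r.
  exact/ltW/truncnS_gt.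
exists L => j; rewrite -(@ler_nat R) natrM (le_trans _ (H L j))//.
by rewrite ler_wpM2r.
Qed.

Lemma in_blockE k j : in_block k j = (k == block j).
Proof.
rewrite /in_block /block; apply/idP/eqP.
  by move=> h; rewrite (trunc_log_eq _ h).
move=> ->; apply: trunc_log_bounds => //; exact: gaps_gt0.
Qed.

(** After [L] further indices the exponent has at least doubled, hence has left
    the block. *)
Lemma block_count : exists L : nat, forall k m,
  (\sum_(0 <= j < m | in_block k j) 1 <= L)%N.
Proof.
have [L HL] := gaps_double; exists L => k m.
rewrite sum1_count -size_filter.
have [[j0 hj0]|no] := pselect (exists j, in_block k j); last first.
  rewrite (_ : [seq _ <- _ | _] = [::])//; apply/eqP.
  rewrite -size_eq0 size_filter -leqn0 leqNgt -has_count.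
  by apply/hasPn => j _; apply/negP => hj; apply: no; exists j.
have exP : exists j, in_block k j by exists j0.
case: (ex_minnP exP) => i iP imin.
rewrite -[X in (_ <= X)%N](size_iota i L); apply: uniq_leq_size.
  by rewrite filter_uniq// iota_uniq.
move=> j; rewrite mem_filter => /andP[jP _]; rewrite mem_iota imin//=.
rewrite ltnNge; apply/negP => Lj.
move: jP => /andP[_]; rewrite ltnNge => /negP; apply.
rewrite (leq_trans _ (gaps_homo Lj))// (leq_trans _ (HL i))// expnS leq_mul2l/=.
by case/andP : iP.
Qed.

Let sum_const_count (P : pred nat) m (B : R) :
  \sum_(0 <= j < m | P j) B = (\sum_(0 <= j < m | P j) 1)%N%:R * B.
Proof. by rewrite natr_sum mulr_suml; apply: eq_bigr => j _; rewrite mul1r. Qed.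

Lemma block_sum_le : exists L : nat, forall k (u : nat -> \bar R) (B : R),
  0 <= B -> (forall j, 0 <= u j)%E -> (forall j, in_block k j -> (u j <= B%:E)%E) ->
  (\sum_(0 <= j <oo | in_block k j) u j <= (L%:R * B)%:E)%E.
Proof.
have [L HL] := block_count; exists L => k u B B0 u0 uB.
apply: lime_le; first by apply: is_cvg_nneseries => j _ _; exact: u0.
apply: nearW => m.
apply: (@le_trans _ _ (\sum_(0 <= j < m | in_block k j) B%:E)%E).
  by apply: lee_sum.
rewrite sumEFin lee_fin sum_const_count.
by rewrite ler_wpM2r// ler_nat; exact: HL.
Qed.

(** Sort the indices by block. *)
Lemma sum_block_le : exists L : nat, forall (g : nat -> R) (B : R) J,
  (forall k, 0 <= g k) -> (forall K, \sum_(0 <= k < K) g k <= B) ->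
  \sum_(0 <= j < J) g (block j) <= L%:R * B.
Proof.
have [L HL] := block_count; exists L => g B J g0 gB.
pose K := (block J).+1.
have bK j : (j < J)%N -> (block j < K)%N.
  by move=> jJ; rewrite ltnS /block leq_trunc_log// gaps_homo// ltnW.
apply: (@le_trans _ _ (\sum_(0 <= k < K) L%:R * g k)); last first.
  by rewrite -mulr_sumr ler_wpM2l.
have -> : \sum_(0 <= j < J) g (block j) =
    \sum_(0 <= k < K) \sum_(0 <= j < J | in_block k j) g k.
  under [RHS]eq_bigr do rewrite big_mkcond/=.
  rewrite exchange_big/=; apply: eq_big_nat => j /andP[_ jJ].
  rewrite (bigD1_seq (block j)) ?mem_index_iota ?iota_uniq ?bK//=.
  rewrite in_blockE eqxx big1 ?addr0// => k kj.
  by rewrite in_blockE (negbTE kj).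
apply: ler_sum => k _; rewrite sum_const_count.
by rewrite ler_wpM2r// ler_nat; exact: HL.
Qed.

End gaps.

Section real_bounds.
Variable R : realType.
Implicit Types (x r p : R).

(** The elementary half of Hoelder's inequality, with the loss that the
    factor [b_j] is replaced by its largest possible value. *)
Lemma sum_mul_powR_le p (a b : nat -> R) (A B : R) J : 0 < p ->
  (forall j, 0 <= a j) -> (forall j, 0 <= b j) ->
  (forall m, \sum_(0 <= j < m) a j <= A) ->
  (forall m, \sum_(0 <= j < m) b j `^ p <= B) ->
  \sum_(0 <= j < J) a j * b j <= A * B `^ p^-1.
Proof.
move=> p0 a0 b0 aA bB.
have bj j : b j <= B `^ p^-1.
  rewrite -[leLHS](powRr1 (b0 j)) -(@mulfV _ p) ?gt_eqF// powRrM.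
  apply: ge0_ler_powR; rewrite ?invr_ge0 ?nnegrE ?powR_ge0 ?(ltW p0)//.
    by rewrite (le_trans _ (bB 0%N))// big_geq.
  rewrite (le_trans _ (bB j.+1))// big_nat_recr//= lerDr sumr_ge0// => k _.
  exact: powR_ge0.
apply: (@le_trans _ _ (\sum_(0 <= j < J) a j * B `^ p^-1)).
  by apply: ler_sum => j _; rewrite ler_wpM2l.
by rewrite -mulr_suml ler_wpM2r// powR_ge0.
Qed.

Lemma pow_shell_half m : (1 - (2 ^+ m)^-1) ^+ (2 ^ m)%N <= 2^-1 :> R.
Proof.
have M0 : 0 < 2 ^+ m :> R by rewrite exprn_gt0.
have M1 : (2 ^+ m)^-1 <= 1 :> R by rewrite invf_le1// exprn_ege1// ler1n.
apply: (@le_trans _ _ (expR (- (2 ^+ m)^-1) ^+ (2 ^ m)%N)).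
  rewrite lerXn2r ?nnegrE ?expR_ge0 ?subr_ge0//.
  by have := expR_ge1Dx (- (2 ^+ m)^-1 : R).
rewrite -expRM_natl natrX mulrN mulfV ?gt_eqF// expRN.
rewrite lef_pV2 ?posrE ?expR_gt0//.
by have := expR_ge1Dx (1 : R).
Qed.

Lemma pow_shell_quarter m : 4^-1 <= (1 - (2 ^+ m.+1)^-1) ^+ (2 ^ m.+1)%N :> R.
Proof.
elim: m => [|m IH]; first by rewrite expr1 expn1; lra.
apply: (le_trans IH); rewrite [in leRHS]expnS exprM.
have e0 : 0 <= (2 ^+ m.+2)^-1 :> R by rewrite invr_ge0 exprn_ge0.
have e1 : (2 ^+ m.+1)^-1 <= 1 :> R by rewrite invf_le1 ?exprn_gt0// exprn_ege1// ler1n.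
have e2 : (2 ^+ m.+1)^-1 = 2 * (2 ^+ m.+2)^-1 :> R.
  by rewrite (exprS 2 m.+1) invfM mulrA mulfV ?mul1r.
rewrite lerXn2r ?nnegrE ?subr_ge0 ?sqr_ge0// e2.
by move: (_^-1) e0 => e e0; rewrite expr2; nra.
Qed.

(** [2 K i <= i ^ 2 + K ^ 2] and [i ^ 2 <= 2 * 2 ^ i]: exponentials of [i] lose
    against [2 ^ 2 ^ i]. *)
Lemma exp_le_double_exp (X : R) : exists2 C : R, 0 < C & forall i, X ^+ i <= C * 2 ^+ (2 ^ i)%N.
Proof.
have [K HK] : exists K, `|X| <= 2 ^+ K.
  exists (Num.truncn `|X|).+1; rewrite (le_trans (ltW (truncnS_gt _)))//.
  by rewrite -natrX ler_nat ltnW// ltn_expl.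
exists (2 ^+ (K * K)); first by rewrite exprn_gt0.
move=> i; rewrite -exprD.
have sq : (i * i <= 2 * 2 ^ i)%N.
  case: i => [|[|[|]]]// i; elim: i => [|i IH]//.
  by rewrite expnS; move: IH; move: (2 ^ i.+3)%N => T; lia.
apply: (@le_trans _ _ (2 ^+ (K * i)%N)).
  rewrite (le_trans (ler_norm _))// normrX exprM lerXn2r ?nnegrE ?exprn_ge0//.
by rewrite ler_weXn2l ?ler1n//; move: (2 ^ i)%N sq => T; nia.
Qed.

End real_bounds.

Section majorant.
Variables (R : realType) (nn : nat -> nat).
Hypothesis gaps : exists2 c : R, 1 < c & forall k, c <= (nn k.+1)%:R / (nn k)%:R.
Local Notation block := (block nn).
Local Notation in_block := (in_block nn).

Let dist (m k : nat) := ((m - k) + (k - m))%N.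

Let distC m k : dist m k = dist k m. Proof. by rewrite /dist addnC. Qed.

Let expr_dist (x : R) m k :
  x ^+ (2 * m + 4 * (k - m)) = x ^+ dist m k * x ^+ dist m k * x ^+ (2 * k).
Proof. by rewrite -!exprD; congr (_ ^+ _); rewrite /dist; lia. Qed.

Let powR2N_lt1 (t : R) : 0 < t -> 2 `^ (- t) < 1 :> R.
Proof.
move=> t0; rewrite powRN invf_lt1 ?powR_gt0//.
by rewrite /powR pnatr_eq0/= expR_gt1 mulr_gt0// ln_gt0// ltr1n.
Qed.

Let sum_dist_le (x : R) m K : 0 <= x < 1 ->
  \sum_(0 <= k < K) x ^+ dist m k <= 2 / (1 - x).
Proof.
move=> x01; have /andP[x0 x1] := x01.
apply: (@le_trans _ _ (\sum_(0 <= k < m + K) x ^+ dist m k)).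
  rewrite [leRHS](big_cat_nat (leq0n K) (leq_addl m K))/= lerDl sumr_ge0// => k _.
  by rewrite exprn_ge0.
rewrite (big_cat_nat (leq0n m) (leq_addr K m))/= (_ : 2 = 1 + 1)// mulrDl mul1r.
apply: lerD.
  rewrite big_nat_rev/=; apply: le_trans (sum_geometric_le m x01).
  rewrite big_nat [leRHS]big_nat; apply: ler_sum => k /andP[_ km].
  have -> : dist m (0 + m - k.+1) = k.+1 by rewrite /dist; lia.
  by rewrite ler_wiXn2l// ltW.
have -> : \sum_(m <= k < m + K) x ^+ dist m k =
    \sum_(0 <= k < K) x ^+ dist m (k + m).
  by rewrite -[X in \sum_(X <= _ < _) _]add0n big_addn addnC addnK.
apply: le_trans (sum_geometric_le K x01).
apply: ler_sum => k _.
by rewrite (_ : dist m (k + m) = k)// /dist; lia.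
Qed.

(** Discrete Hardy inequality behind the growth of a lacunary series: on the
    sphere of radius [1 - 2 ^ - (m + 1)] the terms of block [k] are damped by
    [2 ^ - (a / p) |k - m|] relative to their weight, and convolution with a
    geometric kernel preserves [p]-summability. *)
Lemma gap_dyadic_majorant (a p : R) (u : nat -> R) : 0 < a -> 0 < p ->
  (forall j, 0 <= u j) ->
  (\sum_(0 <= k <oo) ((2 `^ (k%:R * a))^-1)%:E *
     \sum_(0 <= j <oo | in_block k j) (u j `^ p)%:E < +oo)%E ->
  exists G : nat -> R, [/\ forall m, 0 <= G m,
    forall m J, \sum_(0 <= j < J) u j * (1 - (2 ^+ m.+1)^-1) ^+ nn j <= G m &
    (\sum_(0 <= m <oo) ((2 `^ (m%:R * a))^-1 * G m `^ p)%:E < +oo)%E].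
Proof.
move=> a0 p0 u0 Hsum.
(* Then [2 ^ - (k a) = rho ^ (2 k)], and the damping [x ^ (2 dist)] is shared
   equally between the two factors of [sum_mul_powR_le]. *)
pose x : R := 2 `^ (- (a / p / 2)); pose rho := x `^ p.
have x0 : 0 < x by exact: powR_gt0.
have x1 : x < 1.
  by apply: powR2N_lt1; rewrite !divr_gt0.
have rho0 : 0 < rho by exact: powR_gt0.
have rhoE : rho = 2 `^ (- (a / 2)).
  rewrite /rho /x -powRrM; congr (_ `^ _); field; by rewrite gt_eqF.
have rho1 : rho < 1.
  by rewrite rhoE; apply: powR2N_lt1; rewrite divr_gt0.
have wE k : (2 `^ (k%:R * a))^-1 = rho ^+ (2 * k).
  rewrite rhoE -powR_mulrn ?powR_ge0// -powRrM -powRN; congr (_ `^ _).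
  by rewrite natrM; field.
have x01 : 0 <= x < 1 by rewrite ltW.
have rho01 : 0 <= rho < 1 by rewrite ltW.
have xXp k : (x ^+ k) `^ p = rho ^+ k.
  by rewrite -powR_mulrn ?powR_ge0// powRAC powR_mulrn ?powR_ge0.
pose v j := rho ^+ (2 * block j) * u j `^ p.
have v0 j : 0 <= v j by rewrite mulr_ge0 ?powR_ge0// exprn_ge0// ltW.
have Sv : (\sum_(0 <= j <oo) (v j)%:E < +oo)%E.
  apply: le_lt_trans Hsum.
  pose t k j := (if in_block k j then (rho ^+ (2 * k) * u j `^ p)%:E else 0)%E.
  have t0 k j : (0 <= t k j)%E.
    rewrite /t; case: ifP => // _; rewrite lee_fin mulr_ge0 ?powR_ge0// exprn_ge0//.
    exact: ltW.
  rewrite [leRHS](_ : _ = (\sum_(0 <= k <oo) \sum_(0 <= j <oo) t k j)%E).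
    rewrite nneseries_interchange//; apply: lee_nneseries => [j _ _|j _].
      by rewrite lee_fin.
    apply: le_trans (nneseries_lim_ge (block j).+1 _); last by move=> *; exact: t0.
    rewrite big_nat_recr//= -[leLHS]add0e; apply: leeD.
      by apply: sume_ge0 => k _; exact: t0.
    by rewrite /t (in_blockE gaps) eqxx.
  apply: eq_eseriesr => k _; rewrite wE -nneseriesZl; last first.
    by move=> j _; rewrite lee_fin powR_ge0.
  by rewrite eseries_mkcond; apply: eq_eseriesr => j _; rewrite /t; case: ifP.
have [L HL] := sum_block_le gaps.
pose A : R := L%:R * (2 / (1 - x)).
have A0 : 0 <= A by rewrite mulr_ge0// divr_ge0// subr_ge0 ltW.
pose w m j := rho ^+ dist m (block j) * v j.
have w0 m j : 0 <= w m j by rewrite mulr_ge0// exprn_ge0// ltW.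
have Bfin m : (\sum_(0 <= j <oo) (w m j)%:E)%E \is a fin_num.
  rewrite ge0_fin_numE; last by apply: nneseries_ge0 => j _ _; rewrite lee_fin.
  apply: le_lt_trans Sv; apply: lee_nneseries => [j _ _|j _]; rewrite lee_fin//.
  by rewrite ler_piMl// exprn_ile1// ltW.
pose B m := fine (\sum_(0 <= j <oo) (w m j)%:E)%E.
have B0 m : 0 <= B m.
  by apply: fine_ge0; apply: nneseries_ge0 => j _ _; rewrite lee_fin.
have [C0 C00 HC0] := exp_le_double_exp (x ^- 4).
pose C := 1 + C0 * x ^- 4.
have C1 : 1 <= C by rewrite lerDl mulr_ge0 ?invr_ge0 ?exprn_ge0// ltW.
have damp m k : (1 - (2 ^+ m.+1)^-1) ^+ (2 ^ k)%N <= C * x ^+ (4 * (k - m)).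
  have e1 : (2 ^+ m.+1)^-1 <= 1 :> R.
    by rewrite invf_le1 ?exprn_gt0// exprn_ege1// ler1n.
  have e0 : 0 <= (2 ^+ m.+1)^-1 :> R by rewrite invr_ge0 exprn_ge0.
  have r0 : 0 <= 1 - (2 ^+ m.+1)^-1 :> R by rewrite subr_ge0.
  have r1 : 1 - (2 ^+ m.+1)^-1 <= 1 :> R by rewrite gerBl.
  have [km|mk] := leqP k m.
    rewrite (_ : (k - m)%N = 0%N) ?muln0 ?expr0 ?mulr1; last by apply/eqP; rewrite subn_eq0.
    by rewrite (le_trans _ C1)// exprn_ile1.
  rewrite -(subnKC mk) expnD exprM; set i := (k - m.+1)%N.
  apply: (@le_trans _ _ (2^-1 ^+ (2 ^ i)%N)).
    by rewrite lerXn2r ?nnegrE ?exprn_ge0//; exact: pow_shell_half.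
  rewrite addSnnS addKn.
  have H := HC0 i.
  have p1 : 0 < 2 ^+ (2 ^ i)%N :> R by rewrite exprn_gt0.
  have p2 : 0 < x ^+ (4 * i) by rewrite exprn_gt0.
  have H2 : 2^-1 ^+ (2 ^ i)%N <= C0 * x ^+ (4 * i).
    rewrite exprVn -[leLHS]mul1r ler_pdivrMr// -(@ler_pM2l _ (x ^- (4 * i))) ?invr_gt0//.
    rewrite mulr1 [leRHS](_ : _ = C0 * 2 ^+ (2 ^ i)%N).
      by apply: le_trans H; rewrite exprVn -exprM.
    by field; rewrite gt_eqF.
  apply: (le_trans H2); rewrite mulnS exprD mulrA ler_pM2r//.
  rewrite /C mulrDl mul1r divfK ?expf_neq0 ?gt_eqF//.
  by rewrite lerDr exprn_ge0// ltW.
pose G m := C * x ^- (2 * m) * (A * B m `^ p^-1).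
have G0 m : 0 <= G m.
  apply: mulr_ge0; last by apply: mulr_ge0 => //; exact: powR_ge0.
  by apply: mulr_ge0; [exact: le_trans C1|rewrite invr_ge0 exprn_ge0// ltW].
exists G; split; first exact: G0.
- move=> m J; rewrite /G.
  pose aa j := x ^+ dist m (block j); pose bb j := aa j * (x ^+ (2 * block j) * u j).
  have aa0 j : 0 <= aa j by rewrite exprn_ge0// ltW.
  have bb0 j : 0 <= bb j by rewrite !mulr_ge0// exprn_ge0// ltW.
  apply: (@le_trans _ _ (C * x ^- (2 * m) * \sum_(0 <= j < J) aa j * bb j)).
    rewrite mulr_sumr; apply: ler_sum => j _.
    have xm : 0 < x ^+ (2 * m) by rewrite exprn_gt0.
    rewrite -[leRHS]mulrA mulrCA ler_pdivlMl//.
    apply: (@le_trans _ _ (x ^+ (2 * m) * (u j * (C * x ^+ (4 * (block j - m)))))).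
      rewrite ler_wpM2l ?(ltW xm)// ler_wpM2l//; apply: le_trans (damp m (block j)).
      rewrite ler_wiXn2l//.
      + by rewrite subr_ge0 invf_le1 ?exprn_gt0// exprn_ege1// ler1n.
      + by have := in_blockE gaps (block j) j; rewrite eqxx => /andP[].
    rewrite le_eqVlt; apply/orP; left; apply/eqP.
    transitivity (C * u j * x ^+ (2 * m + 4 * (block j - m))).
      by rewrite exprD; ring.
    by rewrite expr_dist /bb /aa; ring.
  apply: ler_wpM2l.
    by rewrite mulr_ge0 ?invr_ge0 ?exprn_ge0//; [exact: le_trans C1|exact: ltW].
  apply: sum_mul_powR_le => //.
  + by move=> M; apply: (HL (fun k => x ^+ dist m k)) => [k|K];
      [rewrite exprn_ge0// ltW|exact: sum_dist_le].
  + move=> M; rewrite -lee_fin /B fineK// -sumEFin.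
    apply: le_trans (nneseries_lim_ge M _); last by move=> j _ _; rewrite lee_fin.
    apply: lee_sum => j _; rewrite lee_fin /bb /aa /w /v.
    by rewrite !powRM ?mulr_ge0 ?exprn_ge0 ?(ltW x0)// !xXp.
- have -> : (\sum_(0 <= m <oo) ((2 `^ (m%:R * a))^-1 * G m `^ p)%:E)%E =
      (\sum_(0 <= m <oo) ((C * A) `^ p)%:E * \sum_(0 <= j <oo) (w m j)%:E)%E.
    apply: eq_eseriesr => m _; rewrite -[in RHS](fineK (Bfin m)) -EFinM; congr EFin.
    rewrite wE /G -/(B m).
    have xm : 0 < x ^+ (2 * m) by rewrite exprn_gt0.
    have rm : rho ^+ (2 * m) != 0 by rewrite expf_neq0// gt_eqF.
    have -> : C / x ^+ (2 * m) * (A * B m `^ p^-1) =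
       (C * A) * ((x ^+ (2 * m))^-1 * B m `^ p^-1) by ring.
    have CA : 0 <= C * A by rewrite mulr_ge0//; exact: le_trans C1.
    have xV : 0 <= (x ^+ (2 * m))^-1 by rewrite invr_ge0 ltW.
    rewrite (powRM p CA) ?mulr_ge0 ?powR_ge0// (powRM p xV) ?powR_ge0//.
    rewrite -powRrM mulVf ?gt_eqF// powRr1//.
    have -> : ((x ^+ (2 * m))^-1) `^ p = (rho ^+ (2 * m))^-1.
      by rewrite -powR_inv1 ?ltW// powRAC xXp powR_inv1// exprn_ge0// ltW.
    by rewrite mulrCA mulrA; field.
  rewrite nneseriesZl; last first.
    by move=> m _; apply: nneseries_ge0 => j _ _; rewrite lee_fin.
  rewrite lte_mul_pinfty// ?lee_fin ?powR_ge0//.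
  rewrite nneseries_interchange; last by move=> *; rewrite lee_fin.
  apply: (@le_lt_trans _ _ (\sum_(0 <= j <oo) ((2 / (1 - rho))%:E * (v j)%:E))%E).
    apply: lee_nneseries => [j _ _|j _].
      by apply: nneseries_ge0 => m _ _; rewrite lee_fin.
    apply: nneseries_le => [m|M]; first by rewrite lee_fin.
    rewrite sumEFin -EFinM lee_fin /w -mulr_suml ler_wpM2r//.
    under eq_bigr do rewrite distC.
    exact: sum_dist_le.
  rewrite nneseriesZl; last by move=> j _; rewrite lee_fin.
  by rewrite lte_mul_pinfty// lee_fin divr_ge0// subr_ge0 ltW.
Qed.

End majorant.

(** * The homogeneous expansion *)

Section polynomials.
Variables (R : realType) (n : nat).
Implicit Types (Q : mpoly n R[i]) (z : 'rV[R[i]]_n) (l : R[i]).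

Lemma poly_evalE Q z : poly_eval Q z =
  \sum_(m <- msupp Q) mcoeff m Q * \prod_i z 0 i ^+ m i.
Proof. exact: mevalE. Qed.

(** Every monomial of [Q] scales by [l ^+ d]. *)
Lemma poly_eval_homog Q d l z : Q \is ishomog1 d mdeg ->
  poly_eval Q (l *: z) = l ^+ d * poly_eval Q z.
Proof.
move=> /allP hQ; rewrite !poly_evalE mulr_sumr big_seq [RHS]big_seq.
apply: eq_bigr => m mQ; rewrite mulrCA; congr (_ * _).
have := hQ _ mQ; rewrite /= => /eqP <-; rewrite mdegE expr_sum -big_split/=.
by apply: eq_bigr => i _; rewrite !mxE exprMn.
Qed.

Lemma cmeasurable_poly_eval Q : cmeasurable setT (poly_eval Q).
Proof.
rewrite (_ : poly_eval Q = fun z => \sum_(m <- msupp Q) mcoeff m Q *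
   \prod_(i <- index_enum 'I_n) z 0 i ^+ m i); last first.
  by apply/funext => z; rewrite poly_evalE.
apply: cmeasurable_sum => m; apply: cmeasurableM; first exact: cmeasurable_cst.
apply: cmeasurable_prod => i; apply: cmeasurableX; exact: cmeasurable_coord.
Qed.

Lemma normc_prod (I : Type) (r : seq I) (F : I -> R[i]) :
  normc (\prod_(k <- r) F k) = \prod_(k <- r) normc (F k).
Proof.
elim: r => [|k r IH]; first by rewrite !big_nil ComplexField.Normc.normc1.
by rewrite !big_cons ComplexField.Normc.normcM IH.
Qed.

Lemma normc_poly_eval_le Q z : nrm z <= 1 ->
  normc (poly_eval Q z) <= \sum_(m <- msupp Q) normc (mcoeff m Q).
Proof.
move=> z1; rewrite poly_evalE (le_trans (normc_sum _ _ _))//.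
apply: ler_sum => m _; rewrite ComplexField.Normc.normcM normc_prod.
rewrite ler_piMr ?normc_ge0//; apply: prodr_ile1 => i _.
rewrite normc_ge0/= normcX exprn_ile1 ?normc_ge0//.
exact: le_trans (normc_coord_le z i) z1.
Qed.

Lemma SnE z : Sn z <-> nrm z = 1.
Proof. by rewrite /Sn/= -nrmE. Qed.

(** The supremum is finite: the coefficients bound [Q] on the closed ball. *)
Lemma Msup_ge Q z : Sn z -> normc (poly_eval Q z) <= Msup Q.
Proof.
move=> Sz; apply: ub_le_sup; last by exists z.
exists (\sum_(m <- msupp Q) normc (mcoeff m Q)) => _ [w /SnE w1 <-].
by apply: normc_poly_eval_le; rewrite w1.
Qed.

Lemma Msup_ge0 Q : (0 < n)%N -> 0 <= Msup Q.
Proof.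
move=> n0; pose w : 'rV[R[i]]_n := const_mx 1.
have w0 : w != 0.
  by apply/eqP => /rowP/(_ (Ordinal n0)); rewrite !mxE => /eqP; rewrite oner_eq0.
apply: le_trans (normc_ge0 (poly_eval Q (radial w))) (Msup_ge _ _).
by apply/SnE; exact: nrm_radial.
Qed.

Lemma normc_poly_eval_Msup Q d z : (0 < d)%N -> Q \is ishomog1 d mdeg ->
  normc (poly_eval Q z) <= Msup Q * nrm z ^+ d.
Proof.
move=> d0 hQ; rewrite -[in leLHS](radialK z) (poly_eval_homog _ _ hQ).
rewrite ComplexField.Normc.normcM normcX normc_real ger0_norm ?nrm_ge0// mulrC.
have [->|z0] := eqVneq z 0.
  by rewrite nrm0 expr0n gtn_eqF// !mulr0.
rewrite ler_wpM2r ?exprn_ge0 ?nrm_ge0//; apply: Msup_ge.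
by apply/SnE; exact: nrm_radial.
Qed.

End polynomials.

Section expansion.
Variables (R : realType) (n : nat) (f : 'rV[R[i]]_n -> R[i]) (nn : nat -> nat).
Variable P : nat -> mpoly n R[i].
Hypothesis hf : Hadamard_gaps f nn P.
Implicit Types z : 'rV[R[i]]_n.

Lemma Hadamard_gaps_ratio :
  exists2 c : R, 1 < c & forall k, c <= (nn k.+1)%:R / (nn k)%:R.
Proof. by case: hf. Qed.

Lemma Hadamard_homog k l z :
  poly_eval (P k) (l *: z) = l ^+ nn k * poly_eval (P k) z.
Proof. by case: hf => _ hP _ _; exact: poly_eval_homog. Qed.

Definition psum m z := \sum_(0 <= k < m) poly_eval (P k) z.

Lemma psum_cvg z : nrm z < 1 -> forall e : R, 0 < e ->
  exists M, forall m, (M <= m)%N -> normc (f z - psum m z) < e.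
Proof.
case: hf => _ _ hcv _ z1 e e0.
have zB : Bn z by rewrite /Bn/= -nrmE.
have := hcv z zB => /cvgrPdist_lt/(_ e%:C).
rewrite ltcR => /(_ e0) [M _ HM]; exists M => m Mm.
by have := HM m Mm; rewrite normr_normc ltcR.
Qed.

(** [f] is a pointwise limit of polynomials in the ball. *)
Lemma cmeasurable_f D : D `<=` [set z | nrm z < 1] -> cmeasurable D f.
Proof.
move=> DB.
have mpsum m : cmeasurable D (psum m).
  have [h1 h2] : cmeasurable setT (psum m).
    by apply: cmeasurable_sum => k; exact: cmeasurable_poly_eval.
  by split; exact: (measurable_funS measurableT (@subsetT _ _)).
split.
  apply: (measurable_fun_cvg (h := fun m z => complex.Re (psum m z))).
    by move=> m; have [] := mpsum m.
  move=> z Dz; apply/cvgrPdist_lt => /= e e0.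
  have [M HM] := psum_cvg (DB _ Dz) e0; exists M => // m /= Mm.
  apply: le_lt_trans (HM m Mm).
  case: (f z) (psum m z) => [x y] [x' y'] /=.
  by rewrite -sqrtr_sqr ler_sqrt ?addr_ge0 ?sqr_ge0// lerDl sqr_ge0.
apply: (measurable_fun_cvg (h := fun m z => complex.Im (psum m z))).
  by move=> m; have [] := mpsum m.
move=> z Dz; apply/cvgrPdist_lt => /= e e0.
have [M HM] := psum_cvg (DB _ Dz) e0; exists M => // m /= Mm.
apply: le_lt_trans (HM m Mm).
case: (f z) (psum m z) => [x y] [x' y'] /=.
by rewrite -sqrtr_sqr ler_sqrt ?addr_ge0 ?sqr_ge0// lerDr sqr_ge0.
Qed.

Lemma measurable_normc_f_powR D p : D `<=` [set z | nrm z < 1] ->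
  measurable_fun D (fun z => normc (f z) `^ p : measurableTypeR R).
Proof.
move=> DB; apply: (@measurableT_comp _ _ _ _ _ _ (@powR R ^~ p)).
  exact: measurable_powR.
by apply: measurable_normc; exact: cmeasurable_f.
Qed.

Lemma normc_f_le z (n_gt0 : (0 < n)%N) (r G : R) : nrm z <= r -> r < 1 ->
  (forall J, \sum_(0 <= j < J) Msup (P j) * r ^+ nn j <= G) -> normc (f z) <= G.
Proof.
move=> zr r1 HG; have z1 := le_lt_trans zr r1.
have h m : normc (psum m z) <= G.
  apply: le_trans (HG m); apply: le_trans (normc_sum _ _ _) _.
  apply: ler_sum => j _; have [_ hP _ _] := hf.
  have g0 := gaps_gt0 Hadamard_gaps_ratio j.
  apply: le_trans (normc_poly_eval_Msup z g0 (hP j)) _.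
  rewrite ler_wpM2l ?Msup_ge0// lerXn2r ?nnegrE ?nrm_ge0//.
  exact: le_trans (nrm_ge0 z) zr.
apply/ler_addgt0Pr => e e0; have [M HM] := psum_cvg z1 e0.
rewrite -[f z](subrK (psum M z)) (le_trans (le_normcD _ _))// addrC lerD//.
by rewrite ltW// HM.
Qed.

End expansion.

(** * From dyadic sums to the norm *)

Section tannery.
Variables (R : realType) (T : Type) (F : set_system T).
Hypothesis FF : Filter F.

(** Tannery's theorem: dominated convergence to [0] for series. *)
Lemma nneseries_near_le (I : T -> nat -> \bar R) (b : nat -> R) :
  (forall a m, 0 <= I a m)%E -> (forall m, 0 <= b m) ->
  (\sum_(0 <= m <oo) (b m)%:E < +oo)%E ->
  (\forall a \near F, forall m, (I a m <= (b m)%:E)%E) ->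
  (forall m (e : R), 0 < e -> \forall a \near F, (I a m <= e%:E)%E) ->
  forall e : R, 0 < e -> \forall a \near F, (\sum_(0 <= m <oo) I a m <= e%:E)%E.
Proof.
move=> I0 b0 bfin Ib Ie e e0.
have e2 : 0 < e / 2 by rewrite divr_gt0.
have bE : forall k, xpredT k -> (0 <= (b k)%:E)%E by move=> k _; rewrite lee_fin.
have tail : (fun k => \sum_(k <= m <oo) (b m)%:E)%E @ \oo --> 0%E.
  by apply: nneseries_tail_cvg bfin _ => k _; rewrite lee_fin.
have [M HM] : exists M, (\sum_(M <= m <oo) (b m)%:E <= (e / 2)%:E)%E.
  move/fine_cvgP : tail => [[M1 _ H1]] /cvgrPdist_le/(_ _ e2)[M2 _ H2].
  exists (maxn M1 M2); have := H1 _ (leq_maxl M1 M2 : [set m | (M1 <= m)%N] _).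
  have := H2 _ (leq_maxr M1 M2 : [set m | (M2 <= m)%N] _) => /=.
  rewrite sub0r normrN => h /fineK <-; rewrite lee_fin.
  exact: le_trans (ler_norm _) h.
have head : forall K (d : R), 0 < d ->
    \forall a \near F, (\sum_(0 <= m < K) I a m <= d%:E)%E.
  elim=> [|K IH] d d0.
    by near=> a; rewrite big_geq// lee_fin ltW.
  have d2 : 0 < d / 2 by rewrite divr_gt0.
  near=> a; rewrite big_nat_recr//= (splitr d) EFinD; apply: leeD.
    by near: a; exact: IH.
  by near: a; exact: Ie.
near=> a; rewrite (nneseries_split 0 M); last by move=> k _; exact: I0.
rewrite add0n (splitr e) EFinD; apply: leeD.
  by near: a; exact: head.
apply: le_trans HM; apply: lee_nneseries => // k _.
by move: k; near: a.
Unshelve. all: by end_near. Qed.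

End tannery.

Section dyadic_shells.
Variables (R : realType) (n : nat).
Implicit Types z : 'rV[R[i]]_n.

Definition dshell m : set 'rV[R[i]]_n :=
  shell (1 - (2 ^+ m)^-1) (1 - (2 ^+ m.+1)^-1).

Lemma invr2X_gt0 m : 0 < (2 ^+ m)^-1 :> R.
Proof. by rewrite invr_gt0 exprn_gt0. Qed.

Lemma invr2X_le1 m : (2 ^+ m)^-1 <= 1 :> R.
Proof. by rewrite invf_le1 ?exprn_gt0// exprn_ege1// ler1n. Qed.

Lemma invr2XS m : (2 ^+ m.+1)^-1 = (2 ^+ m)^-1 / 2 :> R.
Proof. by rewrite exprS invfM mulrC. Qed.

Lemma shell_bigcup : shell 0 1 = \bigcup_m dshell m.
Proof.
apply/seteqP; split=> z; rewrite /shell /dshell/=; last first.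
  move=> [m _ /andP[h1 h2]]; rewrite nrm_ge0/=.
  by rewrite (lt_trans h2)// gtrBl invr2X_gt0.
move=> /andP[z0 z1]; have d0 : 0 < 1 - nrm z by rewrite subr_gt0.
have exP : exists m, (2 ^+ m.+1)^-1 < 1 - nrm z.
  exists (Num.truncn (1 - nrm z)^-1); rewrite -[ltRHS]invrK.
  rewrite ltf_pV2 ?posrE ?exprn_gt0 ?invr_gt0//.
  rewrite (lt_le_trans (truncnS_gt _))// -natrX ler_nat.
  by rewrite ltnW// ltn_expl.
case: (ex_minnP exP) => m mP mmin; exists m => //; apply/andP; split; last by lra.
case: m mP mmin => [|m] mP mmin; first by rewrite expr0 invr1 subrr.
have : ~~ ((2 ^+ m.+1)^-1 < 1 - nrm z) by apply/negP => /mmin; rewrite ltnn.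
by rewrite -leNgt; lra.
Qed.

Lemma trivIset_dshell : trivIset setT dshell.
Proof.
apply: ltn_trivIset => i j ij; apply/seteqP; split=> z //=.
rewrite /dshell /shell/= => -[/andP[h1 h2] /andP[h3 h4]].
have : (2 ^+ i)^-1 <= (2 ^+ j.+1)^-1 :> R.
  by rewrite lef_pV2 ?posrE ?exprn_gt0// ler_weXn2l ?ler1n.
move=> h5; have : nrm z < nrm z; last by rewrite ltxx.
by apply: (lt_le_trans h2); apply: le_trans h3; rewrite lerD2l lerN2.
Qed.

Lemma ge0_integral_dshells (mu : {measure set 'rV[R[i]]_n -> \bar R})
    (g : 'rV[R[i]]_n -> \bar R) :
  measurable_fun (shell 0 1) g -> (forall z, shell 0 1 z -> 0 <= g z)%E ->
  (\int[mu]_(z in shell 0 1) g z = \sum_(0 <= m <oo) \int[mu]_(z in dshell m) g z)%E.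
Proof.
rewrite shell_bigcup => mg g0; rewrite ge0_integral_bigcup//.
  by move=> k; exact: measurable_shell.
exact: trivIset_dshell.
Qed.

Let powR_bracket (e b : R) : 2^-1 <= e -> e <= 2 ->
  (2 `^ `|b|)^-1 <= e `^ b <= 2 `^ `|b|.
Proof.
move=> e1 e2; have e0 : 0 < e by rewrite (lt_le_trans _ e1)// invr_gt0.
have le : `|ln e| <= ln 2.
  rewrite ler_norml -lnV ?posrE// !ler_ln ?posrE ?invr_gt0// e1 e2//.
have h : `|b * ln e| <= `|b| * ln 2 by rewrite normrM ler_wpM2l.
rewrite /powR pnatr_eq0/= (gt_eqF e0) -expRN !ler_expR.
by move: h; rewrite ler_norml => /andP[-> ->].
Qed.

(** [1 - |z|^2] is [2 ^ - m] times a factor between [1/2] and [2]. *)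
Lemma dshell_defect (b : R) m z : dshell m z ->
  (2 `^ `|b|)^-1 * ((2 ^+ m)^-1) `^ b <= (1 - nrm z ^+ 2) `^ b <=
  2 `^ `|b| * ((2 ^+ m)^-1) `^ b.
Proof.
rewrite /dshell /shell/= invr2XS => /andP[h1 h2].
have := invr2X_gt0 m; have := invr2X_le1 m; have := nrm_ge0 z.
move: (_^-1) (nrm z) h1 h2 => t r h1 h2 r0 t1 t0.
have e1 : 2^-1 <= (1 - r ^+ 2) / t by rewrite ler_pdivlMr//; nra.
have e2 : (1 - r ^+ 2) / t <= 2 by rewrite ler_pdivrMr//; nra.
have -> : (1 - r ^+ 2) `^ b = ((1 - r ^+ 2) / t) `^ b * t `^ b.
  by rewrite -powRM ?divfK ?gt_eqF ?(ltW t0)// (le_trans _ e1)// invr_ge0.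
by have /andP[H1 H2] := powR_bracket b e1 e2; rewrite !ler_wpM2r ?powR_ge0.
Qed.

(** [y ^ k - x ^ k <= k (y - x)] on the unit interval. *)
Lemma dshell_width m : (0 < n)%N ->
  (1 - (2 ^+ m.+1)^-1) ^+ (2 * n) - (1 - (2 ^+ m)^-1) ^+ (2 * n)
  <= n%:R * (2 ^+ m)^-1 :> R.
Proof.
move=> n0; rewrite invr2XS.
have := invr2X_gt0 m; have := invr2X_le1 m; move: (_^-1) => t t1 t0.
have H k (x y : R) : 0 <= x -> x <= y -> y <= 1 -> y ^+ k - x ^+ k <= k%:R * (y - x).
  move=> x0 xy y1; elim: k => [|k IH]; first by rewrite !expr0 subrr mul0r.
  rewrite !exprS -natr1.
  have yk : y ^+ k <= 1 by rewrite exprn_ile1// (le_trans x0).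
  have xk : 0 <= x ^+ k by rewrite exprn_ge0.
  have xyk : x ^+ k <= y ^+ k by rewrite lerXn2r ?nnegrE// (le_trans x0).
  by move: (x ^+ k) (y ^+ k) (k%:R) IH yk xk xyk => X Y K IH yk xk xyk; nra.
apply: le_trans (H _ _ _ _ _ _) _; rewrite ?subr_ge0 ?lerD2l ?lerN2 ?gerBl//.
- by rewrite ler_pdivrMr//; lra.
- by rewrite divr_ge0// ltW.
- by rewrite natrM le_eqVlt; apply/orP; left; apply/eqP; field.
Qed.

End dyadic_shells.

Section norm_integral.
Variables (R : realType) (n : nat).
Local Notation N := n.+1.
Variables (p q s : R) (f : 'rV[R[i]]_N -> R[i]).
Implicit Types (z a : 'rV[R[i]]_N).
Local Notation alpha := (N%:R * s + q - N%:R).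

Definition radial_weight z : R := (1 - nrm z ^+ 2) `^ (alpha - 1).

Definition integrand a z : R :=
  normc (f z) `^ p * radial_weight z * Mobius_weight a z `^ (N%:R * s).

Lemma integrand_ge0 a z : 0 <= integrand a z.
Proof. by rewrite /integrand !mulr_ge0// powR_ge0. Qed.

Let integrandE_aux (A D W t : R) : 0 < D -> 0 <= W ->
  A * D `^ q * (W * D) `^ t * D ^- N.+1 = A * D `^ (t + q - N%:R - 1) * W `^ t.
Proof.
move=> D0 W0; rewrite (powRM _ W0 (ltW D0)) -powR_invn ?ltW//.
have -> : t + q - N%:R - 1 = t + q + (- N.+1%:R) by rewrite -(natr1 N); ring.
by rewrite !(powRD (x := D)) ?(gt_eqF D0) ?implybT//; ring.
Qed.

Lemma Nintegral_integrandE a : nrm a < 1 ->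
  Nintegral p q s f a = (\int[@dV R N]_(z in shell 0 1) (integrand a z)%:E)%E.
Proof.
move=> a1; rewrite /Nintegral BnE; apply: eq_integral => z.
rewrite inE /shell/= => /andP[_ z1]; congr EFin.
have E : (1 - nrm (Phi a z) ^+ 2) = Mobius_weight a z * (1 - nrm z ^+ 2).
  by rewrite (one_minus_Phi a1 z1) mulrAC.
rewrite -nrmE E; apply: integrandE_aux; last exact: Mobius_weight_ge0.
by rewrite subr_gt0 exprn_ilt1 ?nrm_ge0.
Qed.

Lemma measurable_radial_weight : measurable_fun setT (radial_weight : _ -> measurableTypeR R).
Proof.
apply: (@measurableT_comp _ _ _ _ _ _ (@powR R ^~ (alpha - 1))).
  exact: measurable_powR.
apply: measurable_funB; first exact: measurable_cst.
by apply: measurable_funX; exact: measurable_nrm.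
Qed.

End norm_integral.

Section sufficiency.
Variables (R : realType) (n : nat).
Local Notation N := n.+1.
Variables (p q s : R) (f : 'rV[R[i]]_N -> R[i]) (nn : nat -> nat).
Variable P : nat -> mpoly N R[i].
Hypothesis hf : Hadamard_gaps f nn P.
Hypothesis p_gt0 : 0 < p.
Hypothesis s_gt0 : 0 < s.
Hypothesis s_le1 : s <= 1.
Implicit Types (z a : 'rV[R[i]]_N).
Local Notation alpha := (N%:R * s + q - N%:R).
Hypothesis alpha_gt0 : 0 < alpha.
Local Notation integrand := (integrand p q s f).

Lemma measurable_integrand a D : nrm a < 1 -> D `<=` [set z | nrm z < 1] ->
  measurable_fun D (fun z => (integrand a z)%:E).
Proof.
move=> a1 DB; apply/measurable_EFinP; apply: measurable_funM; last first.
  apply: (measurable_funS measurableT (@subsetT _ _)).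
  exact: measurable_Mobius_weight.
apply: measurable_funM; first exact: (measurable_normc_f_powR hf).
apply: (measurable_funS measurableT (@subsetT _ _)).
exact: measurable_radial_weight.
Qed.

Lemma dshell_lt1 m : @dshell R N m `<=` [set z | nrm z < 1].
Proof.
move=> z; rewrite /dshell /shell/= => /andP[_ h]; apply: (lt_le_trans h).
by rewrite gerBl ltW// invr2X_gt0.
Qed.

Lemma Nintegral_dshells a : nrm a < 1 ->
  Nintegral p q s f a =
  (\sum_(0 <= m <oo) \int[@dV R N]_(z in dshell m) (integrand a z)%:E)%E.
Proof.
move=> a1; rewrite Nintegral_integrandE// ge0_integral_dshells//.
- by apply: measurable_integrand => // z; rewrite /shell/= => /andP[].
- by move=> z _; rewrite lee_fin integrand_ge0.
Qed.

Section from_majorant.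
Variable G : nat -> R.
Hypothesis G0 : forall m, 0 <= G m.
Hypothesis HG : forall m J,
  \sum_(0 <= j < J) Msup (P j) * (1 - (2 ^+ m.+1)^-1) ^+ nn j <= G m.

Let f_le m z : dshell m z -> normc (f z) <= G m.
Proof.
rewrite /dshell /shell/= => /andP[_ h].
apply: (normc_f_le hf (ltn0Sn n) (ltW h)) (HG m).
by rewrite gtrBl invr2X_gt0.
Qed.

Let K := 2 `^ `|alpha - 1|.

Let K0 : 0 <= K. Proof. exact: powR_ge0. Qed.

Let bound m := G m `^ p * (K * (2 ^+ m)^-1 `^ (alpha - 1)).

Let bound0 m : 0 <= bound m.
Proof. by rewrite !mulr_ge0// powR_ge0. Qed.

Let integrand_le a m z : dshell m z ->
  integrand a z <= bound m * Mobius_weight a z `^ (N%:R * s).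
Proof.
move=> zm; rewrite /integrand ler_wpM2r ?powR_ge0// ler_pM ?powR_ge0//.
  by apply: ge0_ler_powR; rewrite ?nnegrE ?normc_ge0 ?(ltW p_gt0)//; exact: f_le.
by have /andP[] := dshell_defect (alpha - 1) zm.
Qed.

(** The sizes of [f] and of the radial weight are constant on a dyadic shell,
    up to a factor, so only the mean of the Moebius weight matters. *)
Lemma dshell_integral_le : exists2 C : R, 0 <= C & forall a m, nrm a < 1 ->
  (\int[@dV R N]_(z in dshell m) (integrand a z)%:E <=
   (C * ((2 `^ (m%:R * alpha))^-1 * G m `^ p))%:E)%E.
Proof.
have s01 : 0 <= s <= 1 by rewrite (ltW s_gt0).
have [C C0 HC] := @integral_Mobius_weight R n s s01.
exists (K * C * N%:R); first by rewrite !mulr_ge0.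
move=> a m a1.
apply: (@le_trans _ _ (\int[@dV R N]_(z in dshell m)
   ((bound m)%:E * (Mobius_weight a z `^ (N%:R * s))%:E))%E).
  apply: ge0_le_integral; first exact: measurable_shell.
  - by move=> z _; rewrite lee_fin integrand_ge0.
  - by apply: measurable_integrand => //; exact: dshell_lt1.
  - apply: measurable_funeM; apply/measurable_EFinP.
    apply: (measurable_funS measurableT (@subsetT _ _)).
    exact: measurable_Mobius_weight.
  - by move=> z zm; rewrite -EFinM lee_fin; exact: integrand_le.
rewrite ge0_integralZl_EFin//; last 3 first.
- exact: measurable_shell.
- by move=> z _; rewrite lee_fin powR_ge0.
- apply/measurable_EFinP; apply: (measurable_funS measurableT (@subsetT _ _)).
  exact: measurable_Mobius_weight.
have r0 : 0 <= 1 - (2 ^+ m)^-1 :> R by rewrite subr_ge0 invr2X_le1.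
have r12 : 1 - (2 ^+ m)^-1 <= 1 - (2 ^+ m.+1)^-1 :> R.
  by rewrite lerD2l lerN2 invr2XS; have := invr2X_gt0 R m; lra.
have r2 : 1 - (2 ^+ m.+1)^-1 <= 1 :> R by rewrite gerBl ltW// invr2X_gt0.
have r012 := introT andP (conj r0 r12).
apply: (@le_trans _ _ ((bound m)%:E * (C * (N%:R * (2 ^+ m)^-1))%:E)%E).
  apply: lee_wpmul2l; first by rewrite lee_fin.
  apply: le_trans (HC a _ _ a1 r012 r2) _; rewrite lee_fin.
  by rewrite ler_wpM2l//; exact: dshell_width.
rewrite -EFinM lee_fin /bound.
have t0 := invr2X_gt0 R m.
have -> : (2 `^ (m%:R * alpha))^-1 = (2 ^+ m)^-1 `^ (alpha - 1) * (2 ^+ m)^-1.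
  rewrite [RHS]mulrC (mulr_powRB1 (ltW t0) alpha_gt0).
  have -> : (2 ^+ m)^-1 = 2 `^ (- m%:R) :> R by rewrite powRN powR_mulrn.
  by rewrite -powRrM mulNr powRN.
by rewrite le_eqVlt; apply/orP; left; apply/eqP; ring.
Qed.

Let defect_le (x u : R) : 0 <= x -> x < 1 -> 1 - u / 2 < x -> 1 - x ^+ 2 <= u.
Proof. by move=> x0 x1 ux; nra. Qed.

(** On a fixed shell [|1 - <z, a>|] is bounded below, so the Moebius weight is
    [O(1 - |a|^2)]. *)
Lemma dshell_integral_vanish m (e : R) : 0 < e ->
  exists2 r : R, r < 1 & forall a, r < nrm a < 1 ->
  (\int[@dV R N]_(z in dshell m) (integrand a z)%:E <= e%:E)%E.
Proof.
move=> e0; pose S := fine (@dV R N (dshell m)).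
have mD : measurable (@dshell R N m) by exact: measurable_shell.
have S0 : 0 <= S by apply: fine_ge0; exact: measure_ge0.
pose t : R := (2 ^+ m.+1)^-1; have t0 : 0 < t by exact: invr2X_gt0.
have Ns0 : 0 < N%:R * s by rewrite mulr_gt0.
pose c := bound m * S + 1.
have c0 : 0 < c by rewrite /c addrC ltr_pwDl// mulr_ge0.
pose d := (e / c) `^ (N%:R * s)^-1.
have d0 : 0 < d by rewrite powR_gt0// divr_gt0.
exists (1 - d * t ^+ 2 / 2).
  by rewrite gtrBl !mulr_gt0// ?invr_gt0// exprn_gt0.
move=> a /andP[ra a1].
have Wd z : dshell m z -> Mobius_weight a z <= d.
  rewrite /dshell /shell/= => /andP[_ zr].
  have h := normc_1Bdot_ge z (ltW a1).
  have tz : t <= 1 - nrm z by rewrite /t; lra.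
  have {h} h := le_trans tz h.
  have y0 := lt_le_trans t0 h.
  rewrite /Mobius_weight ler_pdivrMr ?exprn_gt0//.
  apply: (@le_trans _ _ (d * t ^+ 2)); last first.
    by rewrite (ler_pM2l d0) lerXn2r ?nnegrE ?(ltW t0) ?(ltW y0).
  exact: defect_le (nrm_ge0 a) a1 ra.
apply: (@le_trans _ _ (\int[@dV R N]_(z in dshell m) (cst (bound m * (e / c))%:E z))%E).
  apply: ge0_le_integral => //.
  - by move=> z _; rewrite lee_fin integrand_ge0.
  - by apply: measurable_integrand => //; exact: dshell_lt1.
  - move=> z zm; rewrite lee_fin; apply: (le_trans (integrand_le a zm)).
    rewrite ler_wpM2l//; apply: (@le_trans _ _ (d `^ (N%:R * s))).
      apply: ge0_ler_powR; rewrite ?nnegrE ?(ltW Ns0) ?(ltW d0)//; last exact: Wd.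
      exact: Mobius_weight_ge0.
    by rewrite /d -powRrM mulVf ?gt_eqF// powRr1// ltW// divr_gt0.
rewrite integral_cst//= -(fineK (dV_fin_num mD)) -/S -EFinM lee_fin.
rewrite mulrAC mulrA ler_pdivrMr// mulrC ler_wpM2l ?(ltW e0)//.
by rewrite /c lerDl.
Qed.

End from_majorant.

Lemma Bn_boundary_filter : Filter (@Bn_boundary R N).
Proof.
apply: filter_from_filter; first by exists 0 => /=; rewrite ltr01.
move=> r1 r2 /= h1 h2; exists (Num.max r1 r2); first by rewrite /= gt_max h1.
by move=> a /=; rewrite gt_max => /andP[/andP[-> ->] ->].
Qed.

Lemma dyadic_Msup_N0space :
  (dyadic_sum N q s nn (fun j => (Msup (P j) `^ p)%:E) < +oo)%E ->
  N0space p q s f.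
Proof.
move=> Ha.
have u0 j : 0 <= Msup (P j) by exact: Msup_ge0.
have [G [G0 HG Gsum]] :=
  gap_dyadic_majorant (Hadamard_gaps_ratio hf) alpha_gt0 p_gt0 u0 Ha.
have [C C0 HC] := dshell_integral_le G0 HG.
pose b m := C * ((2 `^ (m%:R * alpha))^-1 * G m `^ p).
have b0 m : 0 <= b m by rewrite !mulr_ge0 ?powR_ge0// invr_ge0 powR_ge0.
have bfin : (\sum_(0 <= m <oo) (b m)%:E < +oo)%E.
  rewrite /b; under eq_eseriesr do rewrite EFinM.
  rewrite nneseriesZl; last first.
    by move=> m _; rewrite lee_fin mulr_ge0 ?powR_ge0// invr_ge0 powR_ge0.
  by rewrite lte_mul_pinfty.
have I0 a m : (0 <= \int[@dV R N]_(z in dshell m) (integrand a z)%:E)%E.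
  by apply: integral_ge0 => z _; rewrite lee_fin integrand_ge0.
have hol : holomorphic_Bn f by case: hf.
split; first split => //.
  rewrite /Nnorm; apply: poweR_lty.
  apply: le_lt_trans bfin; apply: ge_ereal_sup => _ [a aB <-].
  have a1 : nrm a < 1 by rewrite -nrm_lt1.
  rewrite Nintegral_dshells//; apply: lee_nneseries => m _ //.
  exact: HC.
have FF := Bn_boundary_filter.
have H (e : R) : 0 < e -> \forall a \near @Bn_boundary R N,
    (Nintegral p q s f a <= e%:E)%E.
  move=> e0.
  have near1 : \forall a \near @Bn_boundary R N, nrm a < 1.
    by exists 0 => [|a]; rewrite /= ?ltr01// nrmE => /andP[].
  have T := @nneseries_near_le R _ _ FF
    (fun a m => \int[@dV R N]_(z in dshell m) (integrand a z)%:E)%E b I0 b0 bfin.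
  have T1 : \forall a \near @Bn_boundary R N, forall m,
    (\int[@dV R N]_(z in dshell m) (integrand a z)%:E <= (b m)%:E)%E.
    by apply: filterS near1 => a a1 m; exact: HC.
  have T2 m (e' : R) : 0 < e' -> \forall a \near @Bn_boundary R N,
    (\int[@dV R N]_(z in dshell m) (integrand a z)%:E <= e'%:E)%E.
    move=> e'0; have [r r1 Hr] := dshell_integral_vanish G0 HG m e'0.
    by exists r => // a /=; rewrite -nrmE; exact: Hr.
  have := T T1 T2 e e0; apply: filterS2 near1 => a a1.
  by rewrite Nintegral_dshells.
have N0 a : (0 <= Nintegral p q s f a)%E.
  apply: integral_ge0 => z zB; rewrite lee_fin !mulr_ge0 ?powR_ge0//.
  rewrite invr_ge0 exprn_ge0// subr_ge0 exprn_ile1 -?nrmE ?nrm_ge0//.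
  by rewrite ltW// -nrm_lt1.
apply/fine_cvgP; split.
  have := H 1 ltr01; apply: filterS => a Ha1.
  by rewrite ge0_fin_numE// (le_lt_trans Ha1)// ltry.
apply/cvgrPdist_le => e e0; have := H e e0; apply: filterS => a Ha1 /=.
rewrite sub0r normrN ger0_norm ?fine_ge0//.
by rewrite -lee_fin fineK// ge0_fin_numE// (le_lt_trans Ha1)// ltry.
Qed.

End sufficiency.

(** * Averages over roots of unity *)

Section roots_of_unity.
Variable R : realType.

(** Iterated square roots of [-1]. *)
Lemma prim_root_pow2 e : exists w : R[i],
  (2 ^ e.+1)%N.-primitive_root w /\ normc w = 1.
Proof.
have [w w1] : exists w : R[i], w ^+ (2 ^ e)%N = -1.
  elim: e => [|e [w w1]]; first by exists (-1); rewrite expr1.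
  by exists (sqrtc w); rewrite expnS exprM sqr_sqrtc.
have w2 : w ^+ (2 ^ e.+1)%N = 1 by rewrite expnS mulnC exprM w1 sqrrN expr1n.
exists w; split; last first.
  have : normc w ^+ (2 ^ e.+1)%N = 1.
    by rewrite -normcX w2 ComplexField.Normc.normc1.
  by move=> /eqP; rewrite pexpr_eq1 ?normc_ge0// ?expn_gt0// => /eqP.
have [m wm] := prim_order_exists (expn_gt0 2 e.+1 : (0 < 2 ^ e.+1)%N) w2.
move=> /(@dvdn_pfactor 2 m e.+1 isT)[k].
rewrite leq_eqVlt => /predU1P[-> <-//|ke mE].
have /eqP : w ^+ (2 ^ e)%N = 1.
  apply/eqP; rewrite -(prim_order_dvd wm) mE; apply: dvdn_exp2l.
  by rewrite -ltnS.
by rewrite w1 eq_sym -subr_eq0 opprK -mulr2n pnatr_eq0.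
Qed.

Lemma sum_prim_root (M i j : nat) (w : R[i]) : M.-primitive_root w ->
  (i < M)%N -> (j < M)%N ->
  \sum_(l < M) (w ^+ l) ^+ i * (w ^+ l) ^- j = if i == j then M%:R else 0.
Proof.
move=> wM iM jM; have w0 : w != 0.
  by apply/eqP => w0; have := prim_expr_order wM; rewrite w0 expr0n;
    case: (M) (prim_order_gt0 wM) => // M' _ /eqP; rewrite eq_sym oner_eq0.
pose y := w ^+ i / w ^+ j.
have -> : \sum_(l < M) (w ^+ l) ^+ i * (w ^+ l) ^- j = \sum_(l < M) y ^+ l.
  apply: eq_bigr => l _; rewrite /y exprMn exprVn -!exprM.
  by rewrite (mulnC i) (mulnC j).
case: eqP => [ij|/eqP ij].
  rewrite (eq_bigr (fun=> 1)) ?sumr_const ?card_ord// => l _.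
  by rewrite /y ij divff ?expr1n// expf_neq0.
have y1 : y != 1.
  apply: contra ij => /eqP yE; have : w ^+ i == w ^+ j.
    by rewrite -[w ^+ i](@divfK _ (w ^+ j)) ?expf_neq0// -/y yE mul1r.
  by rewrite (eq_prim_root_expr wM) !modn_small.
have yM : y ^+ M = 1.
  rewrite /y exprMn exprVn -!exprM (mulnC i) (mulnC j) !exprM.
  by rewrite (prim_expr_order wM) !expr1n divr1.
apply/eqP; have := subrX1 y M; rewrite yM subrr => /esym/eqP.
by rewrite mulf_eq0 subr_eq0 (negbTE y1).
Qed.

End roots_of_unity.

Section power_mean.
Variable R : realType.

(** Jensen's inequality for equal weights: the mean of [M + 2] numbers is a
    convex combination of the mean of the first [M + 1] and of the last. *)
Lemma powR_mean_le (p : R) (M : nat) (t : nat -> R) : 1 <= p ->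
  (forall l, 0 <= t l) ->
  (M.+1%:R^-1 * \sum_(0 <= l < M.+1) t l) `^ p <=
  M.+1%:R^-1 * \sum_(0 <= l < M.+1) t l `^ p.
Proof.
move=> p1 t0; elim: M => [|M IH].
  by rewrite !big_nat1 invr1 !mul1r.
rewrite !(@big_nat_recr _ _ _ M.+1)//=.
set S := \sum_(0 <= l < M.+1) t l; set Q := \sum_(0 <= l < M.+1) t l `^ p.
have S0 : 0 <= S by rewrite sumr_ge0.
pose lam : R := M.+1%:R / M.+2%:R.
have m1 : 0 < M.+1%:R :> R by rewrite ltr0n.
have m2 : 0 < M.+2%:R :> R by rewrite ltr0n.
have m12 : M.+2%:R = M.+1%:R + 1 :> R by rewrite -natr1.
have lam0 : 0 <= lam by rewrite divr_ge0.
have lam1 : lam <= 1 by rewrite ler_pdivrMr// mul1r ler_nat.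
have E (x y : R) : M.+2%:R^-1 * (x + y) = lam * (M.+1%:R^-1 * x) + (1 - lam) * y.
  rewrite /lam m12; field; rewrite -natr1 in m12.
  by rewrite gt_eqF//= -m12 gt_eqF.
rewrite !E; apply: (@le_trans _ _ (lam * (M.+1%:R^-1 * S) `^ p + (1 - lam) * t M.+1 `^ p)).
  have := convex_powR p1 (Itv01 lam0 lam1) (x := M.+1%:R^-1 * S) (y := t M.+1).
  apply; rewrite inE/= in_itv/= andbT//.
  by rewrite mulr_ge0// invr_ge0 ltW.
by rewrite lerD2r ler_wpM2l.
Qed.

End power_mean.

Section liminf.
Variable R : realType.
Implicit Types (u : (\bar R)^nat) (K : \bar R).

Lemma limn_einf_le u K : (forall n, u n <= K)%E -> (limn_einf u <= K)%E.
Proof.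
move=> uK; rewrite limn_einf_lim; apply: lime_le; first exact: is_cvg_einfs.
apply: nearW => n; apply: le_trans (uK n); apply: ereal_inf_lbound.
by exists n => //=.
Qed.

Lemma limn_einf_ge u K : (forall n, K <= u n)%E -> (K <= limn_einf u)%E.
Proof.
move=> uK; rewrite limn_einf_lim; apply: lime_ge; first exact: is_cvg_einfs.
by apply: nearW => n; apply: le_ereal_inf_tmp => _ [m _ <-].
Qed.

End liminf.

Lemma normc_dist_le (R : realType) (x y : R[i]) : `|normc x - normc y| <= normc (x - y).
Proof.
rewrite ler_norml ler_normcB andbT lerNl opprB.
by rewrite normc_distC ler_normcB.
Qed.

Section averages.
Variables (R : realType) (n : nat) (f : 'rV[R[i]]_n -> R[i]) (nn : nat -> nat).
Variable P : nat -> mpoly n R[i].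
Hypothesis hf : Hadamard_gaps f nn P.
Implicit Types z : 'rV[R[i]]_n.
Local Notation psum := (psum P).

Let nn_ge k : (k <= nn k)%N.
Proof.
elim: k => // k IH; exact: leq_ltn_trans IH (gaps_ltn (Hadamard_gaps_ratio hf) k).
Qed.

Let nn_inj i j : nn i = nn j -> i = j.
Proof.
have H := gaps_ltn (Hadamard_gaps_ratio hf).
have inc a b : (a < b)%N -> (nn a < nn b)%N.
  by move=> ab; exact: leq_trans (H a) (gaps_homo (Hadamard_gaps_ratio hf) ab).
move=> E; apply/eqP; case: (ltngtP i j) => // ij;
  by have := inc _ _ ij; rewrite E ltnn.
Qed.

(** Abel's lemma: the expansion still converges at a point slightly farther
    from the origin, so its terms decay geometrically. *)
Lemma terms_geometric z : nrm z < 1 -> exists B rho : R,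
  [/\ 0 <= B, 0 <= rho < 1 & forall k, normc (poly_eval (P k) z) <= B * rho ^+ k].
Proof.
move=> z1; pose rho := (1 + nrm z) / 2.
have z0 := nrm_ge0 z.
have rho0 : 0 < rho by rewrite /rho; lra.
have rho1 : rho < 1 by rewrite /rho; lra.
pose y := (rho^-1)%:C *: z.
have y1 : nrm y < 1.
  by rewrite nrmZ normc_real gtr0_norm ?invr_gt0// mulrC ltr_pdivrMr// mul1r /rho; lra.
have zy : z = rho%:C *: y.
  by rewrite /y scalerA -rmorphM/= mulfV ?gt_eqF// scale1r.
have [M HM] := psum_cvg hf y1 ltr01.
have tail k : (M <= k)%N -> normc (poly_eval (P k) y) <= 2.
  move=> Mk.
  have -> : poly_eval (P k) y = (f y - psum k y) - (f y - psum k.+1 y).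
    by rewrite /psum big_nat_recr//=; ring.
  rewrite (le_trans (le_normcD _ _))// normcN.
  have := HM k Mk; have := HM k.+1 (leqW Mk); lra.
pose B := 2 + \sum_(0 <= k < M) normc (poly_eval (P k) y).
have S0 m : 0 <= \sum_(0 <= k < m) normc (poly_eval (P k) y).
  by rewrite sumr_ge0// => k _; exact: normc_ge0.
have yB k : normc (poly_eval (P k) y) <= B.
  have [kM|Mk] := ltnP k M; last first.
    by rewrite (le_trans (tail _ Mk))// /B lerDl.
  rewrite /B (bigD1_seq k) ?mem_index_iota ?iota_uniq//=.
  rewrite addrCA lerDl addr_ge0// sumr_ge0// => l _; exact: normc_ge0.
exists B, rho; split; [by rewrite addr_ge0|by rewrite ltW|] => k.
rewrite {1}zy (Hadamard_homog hf) ComplexField.Normc.normcM normcX normc_real.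
rewrite gtr0_norm// mulrC ler_pM ?normc_ge0 ?exprn_ge0 ?(ltW rho0)//.
by rewrite ler_wiXn2l ?(ltW rho0) ?(ltW rho1).
Qed.

(** The bound involves [w] only through the moduli of the terms, so it is
    uniform on the circle [l w], [|l| = 1]. *)
Lemma psum_tail (w : 'rV[R[i]]_n) (B rho : R) m : nrm w < 1 -> 0 <= B -> 0 <= rho < 1 ->
  (forall k, normc (poly_eval (P k) w) <= B * rho ^+ k) ->
  normc (f w - psum m w) <= B * rho ^+ m / (1 - rho).
Proof.
move=> w1 B0 rho01 H; have /andP[rho0 rho1] := rho01.
apply/ler_addgt0Pr => e e0; have [M HM] := psum_cvg hf w1 e0.
have -> : f w - psum m w = (f w - psum (m + M) w) + (psum (m + M) w - psum m w) by ring.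
rewrite (le_trans (le_normcD _ _))// addrC lerD//; last first.
  by rewrite ltW// HM// leq_addl.
have -> : psum (m + M) w - psum m w = \sum_(m <= k < m + M) poly_eval (P k) w.
  by rewrite /psum (big_cat_nat (leq0n m) (leq_addr M m))/= addrAC subrr add0r.
apply: le_trans (normc_sum _ _ _) _.
apply: (@le_trans _ _ (\sum_(m <= k < m + M) B * rho ^+ k)); first exact: ler_sum.
rewrite -mulr_sumr -mulrA ler_wpM2l//.
rewrite -[X in \sum_(X <= _ < _) _]add0n big_addn addnC addnK.
rewrite (eq_bigr (fun k => rho ^+ m * rho ^+ k)); last first.
  by move=> k _; rewrite -exprD addnC.
by rewrite -mulr_sumr ler_wpM2l ?exprn_ge0// sum_geometric_le.
Qed.

Section root.
Variables (M : nat) (w : R[i]).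
Hypothesis wM : M.-primitive_root w.
Hypothesis w1 : normc w = 1.

Let M_gt0 : (0 < M)%N. Proof. exact: prim_order_gt0 wM. Qed.

(** Averaging over the [M]-th roots of unity extracts the terms of degree
    congruent to [d] modulo [M]. *)
Definition root_average d (g : 'rV[R[i]]_n -> R[i]) z : R[i] :=
  M%:R^-1 * \sum_(l < M) (w ^+ l) ^- d * g (w ^+ l *: z).

Let normc_wX l : normc (w ^+ l) = 1.
Proof. by rewrite normcX w1 expr1n. Qed.

Let normc_natV : normc (M%:R^-1 : R[i]) = M%:R^-1.
Proof.
rewrite ComplexField.Normc.normcV; congr (_^-1).
by rewrite -[M%:R](rmorph_nat (real_complex R)) normc_real ger0_norm.
Qed.

Lemma normc_root_average_le d g z :
  normc (root_average d g z) <=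
  M%:R^-1 * \sum_(0 <= l < M) normc (g (w ^+ l *: z)).
Proof.
rewrite /root_average ComplexField.Normc.normcM normc_natV.
rewrite ler_wpM2l ?invr_ge0// (le_trans (normc_sum _ _ _))// big_mkord.
apply: ler_sum => l _; rewrite ComplexField.Normc.normcM ComplexField.Normc.normcV.
by rewrite normcX normc_wX expr1n invr1 mul1r.
Qed.

(** Below degree [M] only the term of degree [nn j] is congruent to it. *)
Lemma root_average_psum j m z : (j < m)%N -> (nn m <= M)%N ->
  root_average (nn j) (psum m) z = poly_eval (P j) z.
Proof.
move=> jm mM; rewrite /root_average.
have small k : (k < m)%N -> (nn k < M)%N.
  move=> km; apply: leq_trans mM.
  exact: leq_trans (gaps_ltn (Hadamard_gaps_ratio hf) k) (gaps_homo (Hadamard_gaps_ratio hf) km).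
have -> : \sum_(l < M) (w ^+ l) ^- nn j * psum m (w ^+ l *: z) =
  \sum_(0 <= k < m) poly_eval (P k) z *
    \sum_(l < M) (w ^+ l) ^+ nn k * (w ^+ l) ^- nn j.
  rewrite (eq_bigr (fun l : 'I_M => \sum_(0 <= k < m)
     poly_eval (P k) z * ((w ^+ l) ^+ nn k * (w ^+ l) ^- nn j))).
    by rewrite exchange_big/=; apply: eq_bigr => k _; rewrite mulr_sumr.
  move=> l _; rewrite /psum mulr_sumr; apply: eq_bigr => k _.
  by rewrite (Hadamard_homog hf); ring.
rewrite (bigD1_seq j) ?mem_index_iota ?iota_uniq//=.
rewrite [X in _ + X]big_seq_cond [X in _ + X]big1 ?addr0; last first.
  move=> k; rewrite mem_index_iota => /andP[/andP[_ km] kj].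
  rewrite (sum_prim_root wM) ?small//; case: eqP => [/nn_inj kE|_]; last by rewrite mulr0.
  by rewrite kE eqxx in kj.
rewrite (sum_prim_root wM) ?small// eqxx mulrCA mulVf ?mulr1//.
by rewrite pnatr_eq0 -lt0n.
Qed.

Lemma root_average_close j m z (B rho : R) : (j < m)%N -> (nn m <= M)%N ->
  nrm z < 1 -> 0 <= B -> 0 <= rho < 1 ->
  (forall k, normc (poly_eval (P k) z) <= B * rho ^+ k) ->
  normc (root_average (nn j) f z - poly_eval (P j) z) <= B * rho ^+ m / (1 - rho).
Proof.
move=> jm mM z1 B0 rho01 H; rewrite -(root_average_psum z jm mM).
have -> : root_average (nn j) f z - root_average (nn j) (psum m) z =
          root_average (nn j) (fun u => f u - psum m u) z.
  rewrite /root_average -mulrBr -sumrB; congr (_ * _).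
  by apply: eq_bigr => l _; rewrite -mulrBr.
apply: le_trans (normc_root_average_le _ _ _) _.
set T := B * rho ^+ m / (1 - rho).
apply: (@le_trans _ _ (M%:R^-1 * \sum_(0 <= l < M) T)).
  rewrite ler_wpM2l ?invr_ge0//; apply: ler_sum => l _.
  apply: psum_tail => //; first by rewrite nrmZ normc_wX mul1r.
  move=> k; rewrite (Hadamard_homog hf) ComplexField.Normc.normcM normcX normc_wX.
  by rewrite expr1n mul1r.
by rewrite sumr_const_nat subn0 -(mulr_natl T) mulrA mulVf ?mul1r// pnatr_eq0 -lt0n.
Qed.

End root.

Section shell.
Variables (p r1 r2 : R).
Hypotheses (p_ge1 : 1 <= p) (r2_lt1 : r2 < 1).
Local Notation A := (@shell R n r1 r2).

Let p_ge0 : 0 <= p. Proof. exact: le_trans p_ge1. Qed.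

Let A_lt1 z : A z -> nrm z < 1.
Proof. by rewrite /shell/= => /andP[_ h]; exact: lt_trans r2_lt1. Qed.

Let A_sub : A `<=` [set z | nrm z < 1]. Proof. by move=> z /A_lt1. Qed.

Let A_rot (l : R[i]) z : normc l = 1 -> A z -> A (l *: z).
Proof. by move=> l1; rewrite /shell/= nrmZ l1 mul1r. Qed.

Let cmeasurable_f_rot (l : R[i]) : normc l = 1 -> cmeasurable A (fun z => f (l *: z)).
Proof.
move=> l1; have [m1 m2] := cmeasurable_f hf A_sub.
have mA : measurable A by exact: measurable_shell.
have sub : (fun z => l *: z) @` A `<=` A by move=> _ [z Az <-]; exact: A_rot.
have ml : measurable_fun A (fun z => l *: z).
  by apply: (measurable_funS measurableT (@subsetT _ _)); exact: measurable_scale.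
split; [exact: (measurable_comp mA sub m1 ml)|exact: (measurable_comp mA sub m2 ml)].
Qed.

(** Jensen's inequality, then rotation invariance of the shell. *)
Let integral_root_average_le e (w : R[i]) d :
  (2 ^ e.+1)%N.-primitive_root w -> normc w = 1 ->
  (\int[@dV R n]_(z in A) (normc (root_average (2 ^ e.+1) w d f z) `^ p)%:E <=
   \int[@dV R n]_(z in A) (normc (f z) `^ p)%:E)%E.
Proof.
move=> wM w1; set M := (2 ^ e.+1)%N.
have wX l : normc (w ^+ l) = 1 by rewrite normcX w1 expr1n.
have mA : measurable A by exact: measurable_shell.
have mpow g : measurable_fun A (fun z => normc (g z) : measurableTypeR R) ->
    measurable_fun A (fun z => (normc (g z) `^ p)%:E).
  move=> mg; apply/measurable_EFinP.
  by apply: (@measurableT_comp _ _ _ _ _ _ (@powR R ^~ p)) => //; exact: measurable_powR.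
have mfl l : measurable_fun A (fun z => (normc (f (w ^+ l *: z)) `^ p)%:E).
  by apply: mpow; apply: measurable_normc; exact: cmeasurable_f_rot.
have mav : cmeasurable A (root_average M w d f).
  apply: cmeasurableM; first exact: cmeasurable_cst.
  apply: cmeasurable_sum => l; apply: cmeasurableM; first exact: cmeasurable_cst.
  exact: cmeasurable_f_rot.
have [m Mm] : exists m, M = m.+1.
  by exists M.-1; rewrite prednK// expn_gt0.
have c0 : 0 <= M%:R^-1 :> R by rewrite invr_ge0.
apply: (@le_trans _ _ (\int[@dV R n]_(z in A)
   ((M%:R^-1)%:E * \sum_(0 <= l < M) (normc (f (w ^+ l *: z)) `^ p)%:E))%E).
  apply: ge0_le_integral => //.
  - by move=> z _; rewrite lee_fin powR_ge0.
  - by apply: mpow; exact: measurable_normc.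
  - by apply: measurable_funeM; exact: emeasurable_sum.
  - move=> z Az; rewrite sumEFin -EFinM lee_fin.
    apply: (@le_trans _ _ ((M%:R^-1 * \sum_(0 <= l < M) normc (f (w ^+ l *: z))) `^ p)).
      apply: ge0_ler_powR; rewrite ?nnegrE ?normc_ge0//.
        by rewrite mulr_ge0// sumr_ge0// => l _; exact: normc_ge0.
      exact: normc_root_average_le.
    by rewrite Mm; apply: powR_mean_le => // l; exact: normc_ge0.
rewrite ge0_integralZl_EFin//; last 2 first.
- by move=> z _; apply: sume_ge0 => l _; rewrite lee_fin powR_ge0.
- exact: emeasurable_sum.
rewrite ge0_integral_sum//; last by move=> l z _; rewrite lee_fin powR_ge0.
rewrite (eq_bigr (fun=> \int[@dV R n]_(z in A) (normc (f z) `^ p)%:E)%E); last first.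
  move=> l _; rewrite (ge0_integral_shell_rot (g := fun z => (normc (f z) `^ p)%:E)) ?wX ?(ltW r2_lt1)//.
    by apply: mpow; apply: measurable_normc; exact: (cmeasurable_f hf A_sub).
  by move=> z _; rewrite lee_fin powR_ge0.
have -> (X : \bar R) k : (0 <= X)%E -> (\sum_(0 <= l < k) X = k%:R%:E * X)%E.
  move=> X0; elim: k => [|k IH]; first by rewrite big_geq// mul0e.
  by rewrite big_nat_recr//= IH -natr1 EFinD ge0_muleDl ?lee_fin// mul1e.
  by rewrite muleA -EFinM mulVf ?mul1e// pnatr_eq0 Mm.
by apply: integral_ge0 => z _; rewrite lee_fin powR_ge0.
Qed.

(** By Fatou's lemma, on each shell the [p]-mean of [f] dominates those of its
    homogeneous parts, which are limits of averages of rotations of [f]. *)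
Lemma integral_poly_eval_le j :
  (\int[@dV R n]_(z in A) (normc (poly_eval (P j) z) `^ p)%:E <=
   \int[@dV R n]_(z in A) (normc (f z) `^ p)%:E)%E.
Proof.
have mA : measurable A by exact: measurable_shell.
have [w Hw] := choice (prim_root_pow2 R).
pose h e z := (normc (root_average (2 ^ e.+1) (w e) (nn j) f z) `^ p)%:E.
have mh e : measurable_fun A (h e).
  apply/measurable_EFinP; apply: (@measurableT_comp _ _ _ _ _ _ (@powR R ^~ p)).
    exact: measurable_powR.
  apply: measurable_normc; apply: cmeasurableM; first exact: cmeasurable_cst.
  apply: cmeasurable_sum => l; apply: cmeasurableM; first exact: cmeasurable_cst.
  by apply: cmeasurable_f_rot; have [_ w1] := Hw e; rewrite normcX w1 expr1n.
have h0 e z : A z -> (0 <= h e z)%E by move=> _; rewrite lee_fin powR_ge0.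
have hlim z : A z -> ((normc (poly_eval (P j) z) `^ p)%:E <= limn_einf (h^~ z))%E.
  move=> Az; have z1 := A_lt1 Az.
  have [B [rho [B0 rho01 HB]]] := terms_geometric z1.
  have cv : (fun e => normc (root_average (2 ^ e.+1) (w e) (nn j) f z)) @ \oo -->
            normc (poly_eval (P j) z).
    apply/cvgrPdist_le => /= eps eps0.
    have : (fun m => B * rho ^+ m / (1 - rho)) @ \oo --> (B * 0 / (1 - rho) : R).
      apply: cvgM; last exact: cvg_cst.
      apply: cvgM; first exact: cvg_cst.
      by apply: cvg_expr; have /andP[rho0 rho1] := rho01; rewrite ger0_norm.
    rewrite mulr0 mul0r => /cvgrPdist_le/(_ _ eps0)[m0 _ Hm0].
    pose m := maxn m0 j.+1.
    have Tm : B * rho ^+ m / (1 - rho) <= eps.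
      have := Hm0 m (leq_maxl _ _); rewrite /= sub0r normrN.
      exact: le_trans (ler_norm _).
    exists (nn m) => // e /= me; have [wM w1] := Hw e.
    have mM : (nn m <= 2 ^ e.+1)%N.
      by rewrite (leq_trans me)// (leq_trans (ltnW (ltn_expl e (isT : (1 < 2)%N))))// leq_exp2l.
    have H := root_average_close wM w1 (leq_maxr m0 j.+1) mM z1 B0 rho01 HB.
    apply: le_trans Tm; apply: le_trans H.
    by rewrite distrC normc_dist_le.
  have [c0|c0] := eqVneq (normc (poly_eval (P j) z)) 0.
    rewrite c0 powR0; last by rewrite gt_eqF// (lt_le_trans ltr01).
    by apply: limn_einf_ge => e; exact: h0.
  have cpos : 0 < normc (poly_eval (P j) z) by rewrite lt_def c0 normc_ge0.
  have cont : {for normc (poly_eval (P j) z), continuous (@powR R ^~ p)}.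
    apply: differentiable_continuous; apply/derivable1_diffP.
    by apply: derivable_powR; rewrite in_itv/= cpos.
  have cvh : h^~ z @ \oo --> (normc (poly_eval (P j) z) `^ p)%:E.
    apply: cvg_EFin; first exact: nearW.
    exact: (@continuous_cvg _ _ _ _ _ _ (@powR R ^~ p) _ cont cv).
  by rewrite is_cvg_limn_einfE ?(cvg_lim _ cvh)//; apply/cvg_ex; exists (normc (poly_eval (P j) z) `^ p)%:E.
apply: (@le_trans _ _ (\int[@dV R n]_(z in A) limn_einf (h^~ z))%E).
  apply: ge0_le_integral => //.
  - by move=> z _; rewrite lee_fin powR_ge0.
  - apply/measurable_EFinP; apply: (@measurableT_comp _ _ _ _ _ _ (@powR R ^~ p)).
      exact: measurable_powR.
    apply: (measurable_funS measurableT (@subsetT _ _)).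
    by apply: measurable_normc; exact: cmeasurable_poly_eval.
  - rewrite /limn_einf; apply: measurableT_comp => //.
    apply: (measurable_fun_limn_esup (f := fun e z => (- h e z)%E)) => e.
    exact: measurableT_comp.
apply: le_trans (fatou _ mA mh h0) _.
by apply: limn_einf_le => e; have [wM w1] := Hw e; exact: integral_root_average_le.
Qed.

End shell.

End averages.

(** * From the norm to dyadic sums *)

Section necessity.
Variables (R : realType) (n : nat).
Local Notation N := n.+1.
Variables (p q s : R) (f : 'rV[R[i]]_N -> R[i]) (nn : nat -> nat).
Variable P : nat -> mpoly N R[i].
Hypothesis hf : Hadamard_gaps f nn P.
Hypothesis p_ge1 : 1 <= p.
Implicit Types (z a : 'rV[R[i]]_N).
Local Notation alpha := (N%:R * s + q - N%:R).
Local Notation integrand := (integrand p q s f).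

Let p_gt0 : 0 < p. Proof. exact: lt_le_trans p_ge1. Qed.

Let mpoly_pow j D : measurable_fun D (fun z => (normc (poly_eval (P j) z) `^ p)%:E).
Proof.
apply: (measurable_funS measurableT (@subsetT _ _)); apply/measurable_EFinP.
apply: (@measurableT_comp _ _ _ _ _ _ (@powR R ^~ p)).
  exact: measurable_powR.
by apply: measurable_normc; exact: cmeasurable_poly_eval.
Qed.

Lemma Lp_powRE j : (Lp p (P j) `^ p =
  \int[@sigma R N]_(xi in @Sn R N) (normc (poly_eval (P j) xi) `^ p)%:E)%E.
Proof.
rewrite /Lp -poweRrM mulVf ?gt_eqF// poweRe1//.
by apply: integral_ge0 => z _; rewrite lee_fin powR_ge0.
Qed.

Lemma measurable_Sn : measurable (@Sn R N).
Proof.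
rewrite (_ : @Sn R N = setT `&` @nrm R N @^-1` [set 1]).
  exact: measurable_nrm.
by rewrite setTI; apply/seteqP; split=> z /SnE.
Qed.

Lemma Mobius_weight0 z : Mobius_weight 0 z = 1.
Proof.
rewrite /Mobius_weight nrm0 expr0n/= subr0 linear0r subr0.
by rewrite ComplexField.Normc.normc1 expr1n divr1.
Qed.

Let width_ge (x y : R) k : 0 <= x -> x <= y -> (y - x) * x ^+ k <= y ^+ k.+1 - x ^+ k.+1.
Proof.
move=> x0 xy; rewrite mulrBl -!exprS lerD2r exprS ler_wpM2l ?(le_trans x0)//.
by rewrite lerXn2r ?nnegrE// (le_trans x0).
Qed.

(** On the shell following block [k], the damping [|z| ^ n_j] of the terms of
    block [k] is bounded below. *)
Lemma Lp_le_dshell : exists2 C : R, 0 <= C & forall k j, in_block nn k j ->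
  (Lp p (P j) `^ p <=
   (C * 2 `^ (k%:R * alpha))%:E *
   \int[@dV R N]_(z in dshell k.+1) (integrand 0 z)%:E)%E.
Proof.
pose K : R := 2 `^ `|alpha - 1|.
have K0 : 0 < K by exact: powR_gt0.
pose C : R := K * 4 `^ p * 2 ^+ (2 * N) * 2 `^ alpha.
have C0 : 0 <= C by rewrite !mulr_ge0 ?powR_ge0// exprn_ge0.
exists C => // k j jk.
set r1 : R := 1 - (2 ^+ k.+1)^-1; set r2 : R := 1 - (2 ^+ k.+2)^-1.
pose t : R := (2 ^+ k.+1)^-1.
have t0 : 0 < t by exact: invr2X_gt0.
have t1 : t <= 2^-1.
  by rewrite /t invr2XS ler_pdivrMr// mulVf// invr2X_le1.
have r1E : r1 = 1 - t by [].
have r2E : r2 = 1 - t / 2 by rewrite /r2 invr2XS.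
have r12 : 0 <= r1 <= r2 by rewrite r1E r2E; apply/andP; split; lra.
have r2lt1 : r2 < 1 by rewrite r2E; lra.
have r10 : 0 <= r1 by case/andP : r12.
have mD : measurable (@dshell R N k.+1) by exact: measurable_shell.
pose L := (\int[@sigma R N]_xi (normc (poly_eval (P j) xi) `^ p)%:E)%E.
have L0 : (0 <= L)%E by apply: integral_ge0 => z _; rewrite lee_fin powR_ge0.
have LpL : (Lp p (P j) `^ p <= L)%E.
  rewrite Lp_powRE; apply: ge0_subset_integral => //; first exact: measurable_Sn.
  by move=> z _; rewrite lee_fin powR_ge0.
apply: (le_trans LpL).
pose c1 : R := 4^-1 `^ p; pose c2 : R := r2 ^+ (2 * N) - r1 ^+ (2 * N).
have c10 : 0 <= c1 by exact: powR_ge0.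
pose g xi : \bar R := (normc (poly_eval (P j) xi) `^ p)%:E.
have g0 xi : (0 <= g xi)%E by rewrite lee_fin powR_ge0.
have mg : measurable_fun setT g by exact: mpoly_pow.
have mgr : measurable_fun (@dshell R N k.+1) (fun z => g (radial z)).
  apply: (measurable_funS measurableT (@subsetT _ _)).
  by apply: measurableT_comp mg _; exact: measurable_radial.
have damp z : dshell k.+1 z -> 4^-1 <= nrm z ^+ nn j.
  rewrite /dshell /shell/= => /andP[zr1 zr2].
  have z1 : nrm z <= 1 by rewrite ltW// (lt_trans zr2).
  apply: le_trans (pow_shell_quarter R k) _.
  apply: (@le_trans _ _ (nrm z ^+ (2 ^ k.+1)%N)).
    by rewrite lerXn2r ?nnegrE ?nrm_ge0.
  by rewrite ler_wiXn2l ?nrm_ge0//; case/andP : jk => _ /ltnW.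
have step1 : (c1%:E * (c2%:E * L) <= \int[@dV R N]_(z in dshell k.+1) g z)%E.
  rewrite -(ge0_integral_shell_radial (ltn0Sn n) r12 (ltW r2lt1) mg g0).
  apply: (@le_trans _ _ (\int[@dV R N]_(z in dshell k.+1) (c1%:E * g (radial z)))%E).
    by rewrite (ge0_integralZl_EFin _ mD (fun z _ => g0 (radial z)) mgr c10).
  apply: (ge0_le_integral _ mD).
  - by move=> z _; exact: mule_ge0.
  - exact: measurable_funeM.
  - exact: mpoly_pow.
  - move=> z zD; rewrite /g -EFinM lee_fin.
    rewrite -{2}(radialK z) (Hadamard_homog hf) ComplexField.Normc.normcM normcX.
    rewrite normc_real ger0_norm ?nrm_ge0// powRM ?exprn_ge0 ?nrm_ge0 ?normc_ge0//.
    rewrite ler_wpM2r ?powR_ge0//.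
    apply: ge0_ler_powR; rewrite ?nnegrE ?(ltW p_gt0) ?exprn_ge0 ?nrm_ge0 ?invr_ge0//.
    exact: damp.
have step2 : (\int[@dV R N]_(z in dshell k.+1) g z <=
    \int[@dV R N]_(z in dshell k.+1) (normc (f z) `^ p)%:E)%E.
  exact: (integral_poly_eval_le hf r1 p_ge1 r2lt1 j).
pose c3 : R := K^-1 * t `^ (alpha - 1).
have c30 : 0 <= c3 by rewrite mulr_ge0 ?powR_ge0// invr_ge0 ltW.
have mfp : measurable_fun (@dshell R N k.+1) (fun z => (normc (f z) `^ p)%:E).
  apply/measurable_EFinP; apply: (measurable_normc_f_powR hf).
  exact: dshell_lt1.
have n01 : nrm (0 : 'rV[R[i]]_N) < 1 by rewrite nrm0.
have step3 : (c3%:E * \int[@dV R N]_(z in dshell k.+1) (normc (f z) `^ p)%:E <=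
    \int[@dV R N]_(z in dshell k.+1) (integrand 0 z)%:E)%E.
  rewrite -(ge0_integralZl_EFin _ mD (fun z _ => powR_ge0 (normc (f z)) p : (0 <= _%:E)%E) mfp c30).
  apply: (ge0_le_integral _ mD).
  - by move=> z _; rewrite -EFinM lee_fin mulr_ge0// powR_ge0.
  - exact: measurable_funeM.
  - by apply: (measurable_integrand _ _ _ hf) => //; exact: dshell_lt1.
  - move=> z zD; rewrite -EFinM lee_fin /integrand Mobius_weight0 powR1 mulr1.
    rewrite mulrC ler_wpM2l ?powR_ge0//.
    by have /andP[] := dshell_defect (alpha - 1) zD.
have c123 : 1 <= C * 2 `^ (k%:R * alpha) * (c3 * (c1 * c2)).
  have c2t : t <= 2 ^+ (2 * N) * c2.
    have h : (r2 - r1) * r1 ^+ (2 * n).+1 <= c2.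
      rewrite /c2 (_ : (2 * N)%N = (2 * n).+2); last by rewrite mulnS.
      by apply: width_ge; case/andP : r12.
    apply: (@le_trans _ _ (2 ^+ (2 * N) * ((r2 - r1) * r1 ^+ (2 * n).+1))); last first.
      by rewrite ler_wpM2l// exprn_ge0.
    have -> : r2 - r1 = t / 2 by rewrite r1E r2E; field.
    apply: (@le_trans _ _ (2 ^+ (2 * N) * (t / 2 * 2^-1 ^+ (2 * n).+1))); last first.
      rewrite ler_wpM2l ?exprn_ge0// ler_wpM2l ?divr_ge0 ?(ltW t0)//.
      by rewrite lerXn2r ?nnegrE ?invr_ge0// r1E; lra.
    rewrite (_ : (2 * N)%N = (2 * n).+2); last by rewrite mulnS.
    rewrite exprVn !exprS le_eqVlt; apply/orP; left; apply/eqP.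
    have : 2 ^+ (2 * n) != 0 :> R by rewrite expf_neq0.
    by move: (2 ^+ (2 * n)) => X X0; field.
  have tE : 2 `^ alpha * 2 `^ (k%:R * alpha) * t `^ (alpha - 1) = t^-1.
    have tp : t = 2 `^ (- k.+1%:R) by rewrite powRN powR_mulrn.
    rewrite -!powRD ?pnatr_eq0 ?implybT// {1}tp -powRrM -powRD ?pnatr_eq0 ?implybT//.
    rewrite /t invrK -powR_mulrn//; congr (_ `^ _).
    by rewrite -natr1; ring.
  have p4 : 4 `^ p * c1 = 1 by rewrite /c1 -powRM ?invr_ge0// mulfV// powR1.
  have -> : C * 2 `^ (k%:R * alpha) * (c3 * (c1 * c2)) =
     (K * K^-1) * (4 `^ p * c1) * (2 `^ alpha * 2 `^ (k%:R * alpha) * t `^ (alpha - 1)) *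
     (2 ^+ (2 * N) * c2) by rewrite /C /c3; ring.
  by rewrite tE p4 mulfV ?gt_eqF// !mul1r mulrC ler_pdivlMr// mul1r.
apply: (@le_trans _ _ ((C * 2 `^ (k%:R * alpha))%:E * (c3%:E * (c1%:E * (c2%:E * L))))%E).
  have -> : ((C * 2 `^ (k%:R * alpha))%:E * (c3%:E * (c1%:E * (c2%:E * L))) =
     (C * 2 `^ (k%:R * alpha) * (c3 * (c1 * c2)))%:E * L)%E.
    by rewrite (EFinM (_ * _) (c3 * _)) (EFinM c3) (EFinM c1) !muleA.
  rewrite -{1}[L]mul1e; apply: (lee_wpmul2r L0).
  by rewrite lee_fin; exact: c123.
apply: lee_wpmul2l; first by rewrite lee_fin mulr_ge0 ?powR_ge0.
apply: le_trans step3; apply: lee_wpmul2l; first by rewrite lee_fin.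
exact: le_trans step1 step2.
Qed.

Lemma Nspace_dyadic_Lp : Nspace p q s f ->
  (dyadic_sum N q s nn (fun j => Lp p (P j) `^ p) < +oo)%E.
Proof.
move=> [_ fN]; have n01 : nrm (0 : 'rV[R[i]]_N) < 1 by rewrite nrm0.
pose I m := (\int[@dV R N]_(z in dshell m) (integrand 0 z)%:E)%E.
have I0 m : (0 <= I m)%E by apply: integral_ge0 => z _; rewrite lee_fin integrand_ge0.
have Ifin : (\sum_(0 <= m <oo) I m < +oo)%E.
  rewrite -(Nintegral_dshells p q s hf n01).
  have : (ereal_sup [set Nintegral p q s f a | a in @Bn R N] < +oo)%E.
    by apply: lty_poweRy fN; rewrite invr_eq0 gt_eqF.
  apply: le_lt_trans; apply: ereal_sup_ubound; exists 0 => //.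
  by rewrite nrm_lt1.
have Im m : I m \is a fin_num.
  rewrite ge0_fin_numE//; apply: le_lt_trans Ifin.
  apply: le_trans (nneseries_lim_ge m.+1 _); last by move=> k _ _; exact: I0.
  by rewrite big_nat_recr//= -[leLHS]add0e leeD// sume_ge0.
have [C C0 HC] := Lp_le_dshell.
have [L HL] := block_sum_le (Hadamard_gaps_ratio hf).
have J0 m : 0 <= fine (I m) by exact: fine_ge0.
apply: (@le_lt_trans _ _ (\sum_(0 <= k <oo) ((L%:R * C)%:E * I k.+1))%E).
  apply: lee_nneseries => [k _ _|k _].
    rewrite mule_ge0 ?lee_fin ?invr_ge0 ?powR_ge0//.
    by apply: nneseries_ge0 => j _ _; exact: poweR_ge0.
  have b0 : 0 <= C * 2 `^ (k%:R * alpha) * fine (I k.+1).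
    by rewrite !mulr_ge0// powR_ge0.
  apply: (@le_trans _ _ ((2 `^ (k%:R * alpha))^-1%:E *
     (L%:R * (C * 2 `^ (k%:R * alpha) * fine (I k.+1)))%:E)%E).
    apply: lee_wpmul2l; first by rewrite lee_fin invr_ge0 powR_ge0.
    apply: HL => //; first by move=> j; exact: poweR_ge0.
    move=> j jk; apply: (le_trans (HC k j jk)).
    by rewrite [leRHS]EFinM fineK.
  rewrite -[in leRHS](fineK (Im k.+1)) -!EFinM lee_fin.
  rewrite le_eqVlt; apply/orP; left; apply/eqP.
  have : 2 `^ (k%:R * alpha) != 0 :> R by rewrite gt_eqF// powR_gt0.
  by move: (2 `^ _) => X X0; field.
rewrite nneseriesZl; last by move=> k _; exact: I0.
rewrite lte_mul_pinfty//; first by rewrite lee_fin mulr_ge0.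
apply: le_lt_trans Ifin; apply: nneseries_le => [m|m]; first exact: I0.
apply: le_trans (nneseries_lim_ge m.+1 _); last by move=> k _ _; exact: I0.
by rewrite big_nat_recl//= -[leLHS]add0e leeD.
Qed.

End necessity.

(** * Hadamard gap series in the spaces [N(p, q, s)] *)

Unset Implicit Arguments.
Local Close Scope classical_set_scope.

Theorem theorem3p1 (R : realType) (n : nat) (p q s : R)
    (f : 'rV[R[i]]_n -> R[i]) (nn : nat -> nat) (P : nat -> mpoly.mpoly n R[i])
    (hn : (0 < n)%N) (hp : 1 <= p) (hq : 0 < q)
    (hs0 : Num.max 0 (1 - q / n%:R) < s) (hs1 : s <= 1)
    (hf : Hadamard_gaps f nn P) :
  [/\ (dyadic_sum n q s nn (fun j => (Msup (P j) `^ p)%:E) < +oo)%E ->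
        N0space p q s f,
      N0space p q s f -> Nspace p q s f &
      Nspace p q s f ->
        (dyadic_sum n q s nn (fun j => (Lp p (P j) `^ p)%E) < +oo)%E].
Proof.
case: n hn f P hs0 hf => // n _ f P hs0 hf.
have p0 : 0 < p by exact: lt_le_trans hp.
move: hs0; rewrite gt_max => /andP[s0 hqs].
have N0 : 0 < n.+1%:R :> R by rewrite ltr0n.
have alpha0 : 0 < n.+1%:R * s + q - n.+1%:R.
  have : n.+1%:R * (1 - q / n.+1%:R) < n.+1%:R * s by rewrite ltr_pM2l.
  by rewrite mulrBr mulr1 mulrCA mulfV ?gt_eqF// mulr1; lra.
split; first exact: dyadic_Msup_N0space.
- by case.
- exact: Nspace_dyadic_Lp.
Qed.
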